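(* Let $\mu\in\mathcal{M}_{\mathrm{loc},\mathrm{unif}}(\mathbb{R})$ be a weak Gordon measure with weight $C>0$. Then $H_\mu$ does not have any eigenvalues $z\in\mathbb{C}$ with $|z| < C^2-\|\mu\|_{\mathrm{unif}}$.
   Context: A local measure on $\mathbb{R}$ is a map $\mu$ from the bounded Borel subsets of $\mathbb{R}$ to $\mathbb{C}$ such that $\mathbf{1}_K\mu:=\mu(\cdot\cap K)$ is a complex Radon measure for every compact $K\subseteq\mathbb{R}$; $|\mu|$ denotes its total variation (a nonnegative Radon measure on $\mathbb{R}$). Put $\|\mu\|_{\mathrm{unif}}:=\sup_{a\in\mathbb{R}}|\mu|((a,a+1])$, and let $\mathcal{M}_{\mathrm{loc},\mathrm{unif}}(\mathbb{R})$ be the space of all local measures $\mu$ with $\|\mu\|_{\mathrm{unif}}<\infty$. Let $W^1_\infty(\mathbb{R})$ denote the (complex-valued) Lipschitz continuous functions on $\mathbb{R}$. For $\mu\in\mathcal{M}_{\mathrm{loc},\mathrm{unif}}(\mathbb{R})$ and $I\subseteq\mathbb{R}$ define $$\|\mu\|_I:=\sup\Bigl\{\Bigl|\int u\,d\mu\Bigr| : u\in W^1_\infty(\mathbb{R}),\ \operatorname{spt}u\subseteq I,\ \operatorname{diam}\operatorname{spt}u\le 2,\ \|u'\|_\infty\le 1\Bigr\}.$$ For $p\in\mathbb{R}$, $\mu(\cdot+p)$ denotes the translate $B\mapsto\mu(B+p)$. For $C>0$, $\mu$ is called a weak Gordon measure with weight $C$ if there is a sequence $(p_m)$ in $(0,\infty)$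 with $p_m\to\infty$ and $\lim_{m\to\infty}e^{Cp_m}\|\mu-\mu(\cdot+p_m)\|_{[-p_m,p_m]}=0$. The operator $H_\mu$ in $L_2(\mathbb{R})$ is defined by $D(H_\mu):=\{u\in L_2(\mathbb{R})\cap C(\mathbb{R}) : -u''+u\mu\in L_2(\mathbb{R})\}$, $H_\mu u:=-u''+u\mu$, in the sense of distributions; i.e. for $u,f\in L_2(\mathbb{R})$, one has $u\in D(H_\mu)$ and $H_\mu u=f$ iff $u$ is continuous and $\int_{\mathbb{R}}f\varphi=-\int_{\mathbb{R}}u\varphi''+\int_{\mathbb{R}}u\varphi\,d\mu$ for all $\varphi\in C_c^\infty(\mathbb{R})$. *)

(* Defs.v *)
From HB Require Import structures.
From mathcomp Require Import all_boot all_order all_algebra.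
From mathcomp Require Import all_classical all_reals all_analysis.
From mathcomp Require Import measurable_realfun ess_sup_inf.
From mathcomp.real_closed Require Import complex.
Set Implicit Arguments.
Unset Strict Implicit.
Unset Printing Implicit Defensive.
Import Order.TTheory GRing.Theory Num.Theory.
Import numFieldNormedType.Exports.
Import Normc.
Local Open Scope complex_scope.
Local Open Scope classical_set_scope.
Local Open Scope ring_scope.

Section total_variation.
Context {R : realType}.
Implicit Types (mu nu : set R -> R[i]) (A : set R) (p : R).

(* The supremum runs over finite families of disjoint bounded Borel subsets of A
   (they need not cover A), so that it makes sense both for complex measures and
   for local measures, which are only meaningful on bounded Borel sets. *)
Definition total_variation mu A : \bar R :=
  ereal_sup [set x | exists n (F : nat -> set R),
    [/\ forall k, measurable (F k) /\ bounded_set (F k),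
        forall k, F k `<=` A,
        trivIset setT F
      & x = (\sum_(k < n) normc (mu (F k)))%:E]].

(* Countable additivity is stated for the real and imaginary parts; the last
   clause is the Radon property of |nu|. *)
Record complex_radon nu : Prop := ComplexRadon {
  cr0 : nu set0 = 0 ;
  cr_re : semi_sigma_additive (fun B => (complex.Re (nu B))%:E) ;
  cr_im : semi_sigma_additive (fun B => (complex.Im (nu B))%:E) ;
  cr_inner : forall A, measurable A -> forall e : R, 0 < e ->
    exists K, [/\ compact K, K `<=` A
      & (total_variation nu (A `\` K) <= e%:E)%E]
}.

Lemma total_variation_le mu A B :
  A `<=` B -> (total_variation mu A <= total_variation mu B)%E.
Proof.
move=> AB; apply: le_ereal_sup => _ [n [F [mF FA tF ->]]].
by exists n, F; split=> // k; exact: subset_trans (FA k) AB.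
Qed.

Lemma normcB (x y : R[i]) : normc (x - y) <= normc x + normc y.
Proof.
by have := ler_normB x y; rewrite lecE => /andP[].
Qed.

Lemma total_variationB mu nu A :
  (total_variation (fun B => mu B - nu B)%R A
   <= total_variation mu A + total_variation nu A)%E.
Proof.
apply: ge_ereal_sup => _ [n [F [mF FA tF ->]]].
apply: (@le_trans _ _ ((\sum_(k < n) normc (mu (F k)))%:E
                       + (\sum_(k < n) normc (nu (F k)))%:E)%E).
  rewrite -EFinD lee_fin -big_split/=; apply: ler_sum => k _; exact: normcB.
by apply: leeD; apply: ereal_sup_ubound; exists n, F.
Qed.

End total_variation.

Section local_measure.
Context {R : realType}.
Implicit Types (nu : set R -> R[i]) (A B K : set R) (p : R).

(* Only the values on bounded Borel sets are meaningful. *)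
Record local_measure := LocalMeasure {
  lm_fun :> set R -> R[i] ;
  lm_radon : forall K, compact K -> complex_radon (fun B => lm_fun (B `&` K))
}.

Implicit Types mu : local_measure.

Let sub_add (u : nat -> set R) nu1 nu2 (h : R[i] -> R) (B : set R) :
  (forall x y, h (x - y) = h x - h y) ->
  (\sum_(0 <= i < n) (h (nu1 (u i)))%:E @[n --> \oo] --> (h (nu1 B))%:E)%E ->
  (\sum_(0 <= i < n) (h (nu2 (u i)))%:E @[n --> \oo] --> (h (nu2 B))%:E)%E ->
  (\sum_(0 <= i < n) (h (nu1 (u i) - nu2 (u i))%R)%:E @[n --> \oo]
     --> (h (nu1 B - nu2 B)%R)%:E)%E.
Proof.
move=> hB c1 c2.
have -> : (fun n => \sum_(0 <= i < n) (h (nu1 (u i) - nu2 (u i))%R)%:E)%E =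
  (fun n => \sum_(0 <= i < n) (h (nu1 (u i)))%:E
            - \sum_(0 <= i < n) (h (nu2 (u i)))%:E)%E.
  apply/funext => n; rewrite !sumEFin -EFinB -sumrB; congr _%:E.
  by apply: eq_bigr => i _; rewrite hB.
by rewrite hB EFinB; apply: cvgeB.
Qed.

Lemma complex_radonB nu1 nu2 : complex_radon nu1 -> complex_radon nu2 ->
  complex_radon (fun B => nu1 B - nu2 B).
Proof.
move=> [z1 r1 i1 t1] [z2 r2 i2 t2]; split.
- by rewrite z1 z2 subrr.
- move=> F mF tF mU; apply: sub_add; first by move=> [? ?] [? ?].
    exact: r1.
  exact: r2.
- move=> F mF tF mU; apply: sub_add; first by move=> [? ?] [? ?].
    exact: i1.
  exact: i2.
move=> A mA e e0.
have e20 : 0 < e / 2 by rewrite divr_gt0.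
have [K1 [cK1 K1A h1]] := t1 A mA _ e20.
have [K2 [cK2 K2A h2]] := t2 A mA _ e20.
exists (K1 `|` K2); split; first exact: compactU.
  by rewrite subUset.
apply: le_trans (total_variationB _ _ _) _.
rewrite [e]splitr EFinD; apply: leeD.
  apply: le_trans h1; apply: total_variation_le; apply: setDS; exact: subsetUl.
apply: le_trans h2; apply: total_variation_le; apply: setDS; exact: subsetUr.
Qed.

Definition lm_sub mu1 mu2 : local_measure :=
  @LocalMeasure (fun B => mu1 B - mu2 B)
    (fun K cK => complex_radonB (lm_radon mu1 cK) (lm_radon mu2 cK)).

Definition translate p B : set R := [set x + p | x in B].

Lemma translateE p B : translate p B = (fun x => x - p) @^-1` B.
Proof.
apply/seteqP; split=> [_ [x Bx <-]|x Bx] /=; first by rewrite addrK.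
by exists (x - p) => //; rewrite subrK.
Qed.

Lemma translateK p B : translate (- p) (translate p B) = B.
Proof. by rewrite !translateE; apply/seteqP; split=> x /=; rewrite opprK addrK. Qed.

Lemma measurable_translate p B : measurable B -> measurable (translate p B).
Proof.
move=> mB; rewrite translateE -[X in measurable X]setTI.
by apply: measurable_funB => //; exact: measurable_cst.
Qed.

Lemma compact_translate p K : compact K -> compact (translate p K).
Proof.
move=> cK; apply: continuous_compact => //.
apply: continuous_subspaceT => x.
by apply: cvgD; [exact: cvg_id|exact: cvg_cst].
Qed.

Lemma bounded_translate p B : bounded_set B -> bounded_set (translate p B).
Proof.
move=> [M [_ hM]]; exists (M + 1 + `|p|); split; first exact: num_real.
move=> N /ltW ltN _ [x Bx <-] /=; apply: le_trans ltN.
apply: le_trans (ler_normD _ _) _; rewrite lerD2r.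
by apply: (hM (M + 1)) => //; rewrite ltrDl.
Qed.

Lemma trivIset_translate p (F : nat -> set R) :
  trivIset setT F -> trivIset setT (fun k => translate p (F k)).
Proof.
move=> tF i j _ _ [x]; rewrite !translateE => -[/= xi xj].
by apply: tF => //; exists (x - p).
Qed.

Lemma complex_radon_translate mu p K : compact K ->
  complex_radon (fun B => mu (translate p (B `&` K))).
Proof.
move=> cK; have [z r i t] := lm_radon mu (compact_translate (p := p) cK).
have E B : translate p (B `&` K) = translate p B `&` translate p K.
  by rewrite !translateE preimage_setI.
have U (F : nat -> set R) :
    translate p (\bigcup_n F n) = \bigcup_n translate p (F n).
  rewrite translateE preimage_bigcup.
  by apply: eq_bigcup => // k _; rewrite translateE.
split.
- by rewrite E (_ : translate p set0 = set0) // /translate image_set0.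
- move=> F mF tF mU; under eq_fun do under eq_bigr do rewrite E.
  rewrite E U; apply: r => [k||].
  + exact: measurable_translate.
  + exact: trivIset_translate.
  + by apply: bigcupT_measurable => k; exact: measurable_translate.
- move=> F mF tF mU; under eq_fun do under eq_bigr do rewrite E.
  rewrite E U; apply: i => [k||].
  + exact: measurable_translate.
  + exact: trivIset_translate.
  + by apply: bigcupT_measurable => k; exact: measurable_translate.
move=> A mA e e0.
have [L [cL LA h]] := t _ (measurable_translate p mA) _ e0.
exists (translate (- p) L); split; first exact: compact_translate.
  by rewrite -(translateK p A) => _ [x Lx <-]; exists x => //; exact: LA.
apply: le_trans h; apply: ge_ereal_sup => _ [n [F [mF FA tF ->]]].
apply: ereal_sup_ubound; exists n, (fun k => translate p (F k)); split.
- by move=> k; have [? ?] := mF k; split;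
    [exact: measurable_translate|exact: bounded_translate].
- move=> k _ [x Fx <-]; have [Ax nLx] := FA k x Fx; split; first by exists x.
  by move=> Lxp; apply: nLx; exists (x + p) => //; rewrite addrK.
- exact: trivIset_translate.
- by congr _%:E; apply: eq_bigr => k _; rewrite E.
Qed.

(* B |-> mu (B + p) *)
Definition lm_translate mu p : local_measure :=
  @LocalMeasure (fun B => mu (translate p B))
    (fun K cK => complex_radon_translate mu p cK).

Definition unif_norm mu : \bar R :=
  ereal_sup [set total_variation mu `]a, a + 1] | a in [set: R]].

Definition loc_unif : set local_measure := [set mu | (unif_norm mu < +oo)%E].

End local_measure.
Arguments local_measure : clear implicits.

Section integral.
Context {R : realType}.
Implicit Types (nu : set R -> R[i]) (mu : local_measure R).

Definition re_charge nu & complex_radon nu : set R -> \bar R :=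
  fun B => (complex.Re (nu B))%:E.
Definition im_charge nu & complex_radon nu : set R -> \bar R :=
  fun B => (complex.Im (nu B))%:E.

Section charges.
Variables (nu : set R -> R[i]) (h : complex_radon nu).
Local Notation re_charge := (re_charge h).
Local Notation im_charge := (im_charge h).

Let re0 : re_charge set0 = 0%E. Proof. by rewrite /re_charge (cr0 h). Qed.
Let refin B : measurable B -> re_charge B \is a fin_num. Proof. by []. Qed.
Let readd : semi_sigma_additive re_charge. Proof. exact: cr_re h. Qed.
HB.instance Definition _ := isCharge.Build _ _ _ re_charge re0 refin readd.

Let im0 : im_charge set0 = 0%E. Proof. by rewrite /im_charge (cr0 h). Qed.
Let imfin B : measurable B -> im_charge B \is a fin_num. Proof. by []. Qed.
Let imadd : semi_sigma_additive im_charge. Proof. exact: cr_im h. Qed.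
HB.instance Definition _ := isCharge.Build _ _ _ im_charge im0 imfin imadd.
End charges.

Lemma hahn_exists (c : {charge set R -> \bar R}) :
  exists PN : set R * set R, hahn_decomposition c PN.1 PN.2.
Proof. by have [P [N ?]] := Hahn_decomposition c; exists (P, N). Qed.

Definition hahn c := projT2 (cid (hahn_exists c)).

(* Does not depend on the chosen Hahn decomposition. *)
Definition charge_integral (c : {charge set R -> \bar R})
    (f : R -> R) : R :=
  \int[jordan_pos (hahn c)]_x f x - \int[jordan_neg (hahn c)]_x f x.

Definition cmeasure_integral nu (h : complex_radon nu) (f : R -> R[i]) : R[i] :=
  (charge_integral (re_charge h) (fun x => complex.Re (f x))
   - charge_integral (im_charge h) (fun x => complex.Im (f x)))
  +i* (charge_integral (re_charge h) (fun x => complex.Im (f x))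
   + charge_integral (im_charge h) (fun x => complex.Re (f x))).

Definition spt (f : R -> R[i]) : set R := closure [set x | f x != 0].

(* The integral of f against the complex measure 1_K mu with K = spt f; it is
   only meant for f with compact support. *)
Definition lm_integral mu (f : R -> R[i]) : R[i] :=
  match pselect (compact (spt f)) with
  | left cK => cmeasure_integral (lm_radon mu cK) f
  | right _ => 0
  end.

Definition leb_integral (f : R -> R[i]) : R[i] :=
  (\int[lebesgue_measure]_x complex.Re (f x))
  +i* (\int[lebesgue_measure]_x complex.Im (f x)).

End integral.

Section functions.
Context {R : realType}.
Implicit Types (f u : R -> R[i]).

(* Continuity, derivatives and integrals of complex-valued functions are taken
   componentwise, C being identified with R^2. *)
Definition ccontinuous f :=
  continuous (@complex.Re R \o f) /\ continuous (@complex.Im R \o f).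

Definition cderive f : R -> R[i] :=
  fun x => derive1 (@complex.Re R \o f) x +i* derive1 (@complex.Im R \o f) x.

Definition smooth (g : R -> R) := forall n x, derivable (derive1n n g) x 1.

Definition test_function f :=
  [/\ smooth (@complex.Re R \o f), smooth (@complex.Im R \o f) & compact (spt f)].

(* W^1_oo(R) in the sense of the Lipschitz continuous functions *)
Definition clipschitz f :=
  exists L : R, forall x y, normc (f x - f y) <= L * `|x - y|.

(* The points where u is not differentiable, at which derive1 is a junk value,
   form a null set when u is Lipschitz. *)
Definition sup_norm_deriv u : \bar R :=
  ess_sup lebesgue_measure (fun x => (normc (cderive u x))%:E).

Definition in_L2 f :=
  [/\ measurable_fun setT (@complex.Re R \o f),
      measurable_fun setT (@complex.Im R \o f)
    & (\int[lebesgue_measure]_x ((normc (f x)) ^+ 2)%:E < +oo)%E].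

End functions.

Section gordon_schroedinger.
Context {R : realType}.
Implicit Types (mu : local_measure R) (u f : R -> R[i]).

Definition local_norm mu (I : set R) : \bar R :=
  ereal_sup [set (normc (lm_integral mu u))%:E | u in
    [set u | [/\ clipschitz u, spt u `<=` I,
                 forall x y, spt u x -> spt u y -> `|x - y| <= 2
               & (sup_norm_deriv u <= 1)%E]]].

Definition weak_gordon mu (C : R) := exists p : nat -> R,
  [/\ forall m, 0 < p m,
      p @ \oo --> +oo
    & ((expR (C * p m))%:E
        * local_norm (lm_sub mu (lm_translate mu (p m))) `[(- p m)%R, p m])%E
      @[m --> \oo] --> 0%E].

(* u \in D(H_mu) and H_mu u = f, where u is the continuous representative of its
   class in L_2 and f any representative. *)
Definition schroedinger mu u f :=
  [/\ in_L2 u, in_L2 f, ccontinuous u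
    & forall phi, test_function phi ->
        leb_integral (fun x => f x * phi x)
        = - leb_integral (fun x => u x * cderive (cderive phi) x)
          + lm_integral mu (fun x => u x * phi x)].

Definition schroedinger_eigenvalue mu (z : R[i]) := exists u,
  schroedinger mu u (fun x => z * u x)
  /\ ~ {ae lebesgue_measure, forall x, u x = 0}.

End gordon_schroedinger.

(* Main.v *)
Require Import Defs.
From mathcomp Require Import all_boot all_order all_algebra.
From mathcomp Require Import all_classical all_reals all_analysis.
From mathcomp Require Import measurable_realfun ess_sup_inf ring lra.
From mathcomp.real_closed Require Import complex.
Set Implicit Arguments.
Unset Strict Implicit.
Unset Printing Implicit Defensive.
Import Order.TTheory GRing.Theory Num.Theory.
Import numFieldNormedType.Exports.
Import Normc.
Local Open Scope complex_scope.
Local Open Scope classical_set_scope.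
Local Open Scope ring_scope.
#[local] Arguments normc : simpl never.

(** Let u be an eigenfunction with eigenvalue z, so that u'' = u nu for
nu = mu - z dx, and let Om be the sum of the uniform norm of mu and |z|, so that
Om < C ^ 2. If mu were periodic with period p, the Cayley-Hamilton theorem for the
monodromy matrix would give u (x + p) + u (x - p) = b u (x) with b independent of
x. At x = p - t this reads u (- t) = b u (p - t) - u (2 p - t), and u tends to 0 at
infinity; so u would vanish to the left of 0 if such p could be taken arbitrarily
large, and hence everywhere.

For a weak Gordon measure the identity holds up to a small error. The Wronskians of
u and u (. + p) at x and at x - p differ by the integral of u u (. + p) against the
difference of mu and its translate, which the local norm controls. Therefore the
quotient of q = u (. + p) + u (. - p) and u is almost constant on an interval where
u does not vanish, and its value defines b. Then w = q - b u has almost vanishing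
data on that interval and solves w'' = w nu up to a source that is small in the
local norm, so that w (p - t) is small provided that solutions do not grow faster
than e^(C x). This holds by a Riccati argument: if R'' = R |nu| and r = R' / R, then
r' = |nu| - r ^ 2, and r <= (C + r ^ 2 / C) / 2 shows that ln R + r / (2 C) grows at
most like the integral of C / 2 + |nu| / (2 C), that is, at a rate smaller than C.

The derivative of u exists only almost everywhere and jumps at the atoms of mu. All
arguments therefore concern the values of u: testing the weak equation with tents
gives a three-point identity (tent_identity), from which u is bounded, Lipschitz,
tends to 0 (solution_decay) and has the unique continuation property
(solution_unique_continuation). On a grid of mesh h the identity becomes a
recursion with coefficients N k, the integrals of tents against nu, and an error
that tends to 0 with h. The Wronskian and Riccati arguments are carried out for such
sequences in gordon_growth and discrete_gronwall; they use about nu only the sum of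
the |N k| over unit intervals, and a bound of the sums of c k (N (n + k) - N k) for
Lipschitz weights c, which lm_integral_le_local_norm provides.

Integrals against mu and against Lebesgue measure enter through their Riemann sums
(represents). This makes linearity, translations and the bound by the total
variation elementary, although each integral is defined by means of the support of
its own integrand. *)

(** * The modulus of a complex number and a discrete Gronwall inequality *)

Section complex_modulus.
Context {R : realType}.
Implicit Types (x y : R[i]).

Lemma normc_ge0 x : 0 <= normc x.
Proof. by case: x => a b /=; exact: sqrtr_ge0. Qed.

Lemma normcR (a : R) : normc a%:C = `|a|.
Proof. by rewrite /normc /= expr0n addr0 sqrtr_sqr. Qed.

Lemma normcNE x : normc (- x) = normc x.
Proof. by case: x => a b; rewrite /normc /= !sqrrN. Qed.

Lemma normcD_le x y : normc (x + y) <= normc x + normc y.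
Proof. by have := normcB x (- y); rewrite opprK normcNE. Qed.

Lemma normc_distC x y : normc (x - y) = normc (y - x).
Proof. by rewrite -normcNE opprB. Qed.

Lemma normc_sum (I : Type) (r : seq I) (P : pred I) (F : I -> R[i]) :
  normc (\sum_(i <- r | P i) F i) <= \sum_(i <- r | P i) normc (F i).
Proof.
elim/big_rec2: _ => [|i a b _ ab]; first by rewrite normc0.
by apply: le_trans (normcD_le _ _) _; rewrite lerD2l.
Qed.

Lemma normc_Re x : `|complex.Re x| <= normc x.
Proof.
case: x => a b /=; rewrite -sqrtr_sqr ler_sqrt ?lerDl ?sqr_ge0//.
by rewrite addr_ge0 ?sqr_ge0.
Qed.

Lemma normc_Im x : `|complex.Im x| <= normc x.
Proof.
case: x => a b /=; rewrite -sqrtr_sqr ler_sqrt ?lerDr ?sqr_ge0//.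
by rewrite addr_ge0 ?sqr_ge0.
Qed.

Lemma normc_le_ReIm x : normc x <= `|complex.Re x| + `|complex.Im x|.
Proof.
case: x => a b /=; rewrite -[leRHS]ger0_norm ?addr_ge0 // -sqrtr_sqr.
rewrite ler_sqrt ?sqr_ge0 // sqrrD !real_normK ?num_real //.
by rewrite lerD2r lerDl mulrn_wge0 // mulr_ge0.
Qed.

Lemma ReD x y : complex.Re (x + y) = complex.Re x + complex.Re y.
Proof. by case: x y => [? ?] [? ?]. Qed.
Lemma ImD x y : complex.Im (x + y) = complex.Im x + complex.Im y.
Proof. by case: x y => [? ?] [? ?]. Qed.
Lemma ReN x : complex.Re (- x) = - complex.Re x.
Proof. by case: x. Qed.
Lemma ImN x : complex.Im (- x) = - complex.Im x.
Proof. by case: x. Qed.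
Lemma ReM x y : complex.Re (x * y) =
  complex.Re x * complex.Re y - complex.Im x * complex.Im y.
Proof. by case: x y => [? ?] [? ?]. Qed.
Lemma ImM x y : complex.Im (x * y) =
  complex.Re x * complex.Im y + complex.Im x * complex.Re y.
Proof. by case: x y => [? ?] [? ?]. Qed.

Lemma Re_sum (I : Type) (r : seq I) (F : I -> R[i]) :
  complex.Re (\sum_(i <- r) F i) = \sum_(i <- r) complex.Re (F i).
Proof. by elim/big_rec2: _ => // i a b _ <-; rewrite ReD. Qed.
Lemma Im_sum (I : Type) (r : seq I) (F : I -> R[i]) :
  complex.Im (\sum_(i <- r) F i) = \sum_(i <- r) complex.Im (F i).
Proof. by elim/big_rec2: _ => // i a b _ <-; rewrite ImD. Qed.

Lemma normc_eq0 x : normc x <= 0 -> x = 0.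
Proof.
by move=> h; apply: eq0_normc; apply/eqP; rewrite eq_le h normc_ge0.
Qed.

(** Passage to the limit in an estimate whose error is a fixed multiple of an
arbitrarily small number. *)
Lemma ler_archi (a b K : R) : (forall e, 0 < e -> a <= b + K * e) -> a <= b.
Proof.
move=> h; apply/ler_addgt0Pr => e e0.
have K0 : 0 < `|K| + 1 by rewrite ltr_wpDl.
apply: le_trans (h _ (divr_gt0 e0 K0)) _; rewrite lerD2l.
rewrite mulrCA ger_pMr // ler_pdivrMr // mul1r.
by apply: le_trans (ler_norm _) _; rewrite lerDl.
Qed.

End complex_modulus.

Section gronwall.
Context {R : realType}.

Lemma sinh_ge (l : R) : 0 <= l -> 2 * l <= expR l - expR (- l).
Proof.
move=> l0; pose g x : R := expR x - expR (- x) - 2 * x.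
have dg (x : R) : is_derive x 1 g (expR x + expR (- x) - 2).
  by apply: is_derive_eq; rewrite !scaler1 /GRing.scale /=; ring.
suff : g 0 <= g l by rewrite /g oppr0 expR0 subrr mulr0 subr0 subr_ge0.
apply: (@ger0_derive1_ndecr _ g 0 l) => // [x _|].
- rewrite derive1E derive_val expRN.
  have e0 : expR x != 0 by rewrite gt_eqF // expR_gt0.
  rewrite (_ : _ - _ = (expR x - 1) ^+ 2 / expR x); last by field.
  by rewrite divr_ge0 ?sqr_ge0 // expR_ge0.
- apply: continuous_subspaceT => x; apply: differentiable_continuous.
  exact/derivable1_diffP.
Qed.

(** With 1 + x = e^(2 l) and d = e^l - e^(-l) one has d^2 = x^2 / (1 + x) and
2 l <= d, and d <= t / 2 + d^2 / (2 t) is a completed square. *)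
Lemma onem_le_expR (t x : R) : 0 < t -> 0 <= x ->
  1 + x <= expR (t / 2 + x ^+ 2 / (2 * t * (1 + x))).
Proof.
move=> t0 x0; have y0 : 0 < 1 + x by rewrite ltr_pwDl.
set l := ln (1 + x) / 2.
have l0 : 0 <= l by rewrite divr_ge0 // ln_ge0 // lerDl.
have e2 : expR l * expR l = 1 + x.
  by rewrite -expRD /l -splitr lnK // posrE.
have el0 := expR_gt0 l.
rewrite -{1}e2 -expRD ler_expR.
have /(_ _ l0) := sinh_ge; rewrite expRN => hs.
have -> : x ^+ 2 / (2 * t * (1 + x)) = (expR l - (expR l)^-1) ^+ 2 / (2 * t).
  have -> : x = expR l * expR l - 1 by rewrite e2 addrC addKr.
  field; rewrite !gt_eqF //=.
  by rewrite addrCA subrr addr0 e2.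
set d := expR l - (expR l)^-1 in hs *.
apply: (le_trans (y := d)); first lra.
rewrite -subr_ge0.
have -> : t / 2 + d ^+ 2 / (2 * t) - d = (t - d) ^+ 2 / (2 * t).
  by field; rewrite gt_eqF.
by rewrite divr_ge0 ?sqr_ge0 // mulr_ge0 // ltW.
Qed.

(** The extremal sequence r solves the difference form of r'' = m r. Its
logarithmic slope rho obeys a Riccati recursion, and by the previous lemma
ln r + rho / (2 C) increases by at most C h / 2 + m / (2 C) in one step. The
exponent depends on the total mass only, not on the way it is distributed: with
mass Om per unit length it is C / 2 + Om / (2 C), which is less than C as soon as
Om < C ^ 2. *)
Lemma discrete_gronwall (C h eta : R) (m y : nat -> R) (n : nat) :
  0 < C -> 0 < h -> 0 < eta -> (forall k, 0 <= m k) ->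
  (forall j, (j <= n)%N ->
     y j <= eta + h * \sum_(k < j) (j - k)%:R * (m k * y k)) ->
  forall j, (j <= n)%N ->
    y j <= eta * expR (C * h * j%:R / 2 + (\sum_(k < j.+1) m k) / (2 * C)).
Proof.
move=> C0 h0 eta0 m0 yle.
(* r is the position and s the slope of the extremal sequence. *)
pose rs := fix rs k : R * R := if k is k'.+1
  then let: (r, s) := rs k' in (r + h * (s + m k' * r), s + m k' * r)
  else (eta, 0).
pose r k := (rs k).1; pose s k := (rs k).2.
have sS k : s k.+1 = s k + m k * r k by rewrite /s /r /=; case: (rs k).
have rS k : r k.+1 = r k + h * s k.+1 by rewrite sS /s /r /=; case: (rs k).
have rs0 k : 0 < r k /\ 0 <= s k.
  elim: k => [|k [r0 s0]]; first by [].
  have s1 : 0 <= s k.+1 by rewrite sS addr_ge0 // mulr_ge0 // ltW.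
  by split=> //; rewrite rS ltr_pwDl // mulr_ge0 // ltW.
have sE k : s k = \sum_(i < k) m i * r i.
  by elim: k => [|k IH]; rewrite ?big_ord0 // big_ord_recr /= sS IH.
have tS (a : nat -> R) k : \sum_(i < k.+1) (k.+1 - i)%:R * a i =
    \sum_(i < k) (k - i)%:R * a i + \sum_(i < k.+1) a i.
  rewrite !big_ord_recr /= subSnn mul1r addrA -big_split /=; congr (_ + _).
  apply: eq_bigr => i _; rewrite subSn; last exact: ltnW.
  by rewrite -natr1 mulrDl mul1r.
have rE k : r k = eta + h * \sum_(i < k) (k - i)%:R * (m i * r i).
  elim: k => [|k IH]; first by rewrite big_ord0 mulr0 addr0.
  by rewrite (tS (fun i => m i * r i)) rS {1}IH sE mulrDr addrA.
have yr j : (j <= n)%N -> y j <= r j.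
  elim/ltn_ind: j => j IH jn; rewrite rE; apply: le_trans (yle _ jn) _.
  rewrite lerD2l ler_pM2l //; apply: ler_sum => k _.
  apply: ler_wpM2l => //; apply: ler_wpM2l => //; apply: IH => //.
  exact: leq_trans (ltnW (ltn_ord k)) jn.
move=> j jn; apply: le_trans (yr _ jn) _.
pose rho k := s k.+1 / r k.
have rho0 k : 0 <= rho k.
  by rewrite divr_ge0 //; [case: (rs0 k.+1)|case: (rs0 k) => /ltW].
(* Exponential form of the monotone quantity ln r + rho / (2 C). *)
suff H k : r k * expR (rho k / (2 * C)) <=
    eta * expR (C * h * k%:R / 2 + (\sum_(i < k.+1) m i) / (2 * C)).
  apply: le_trans (H j); rewrite ler_peMr //; first by case: (rs0 j) => /ltW.
  by rewrite -expR0 ler_expR divr_ge0 // mulr_ge0 // ltW.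
elim: k => [|k IH].
  rewrite big_ord1 mulr0 mul0r add0r /rho sS /r /s /= add0r mulfK ?gt_eqF //.
have [r0 s0] := rs0 k.
have rn0 : r k != 0 by rewrite gt_eqF.
set x := h * rho k.
have x0 : 0 <= x by rewrite mulr_ge0 // ltW.
have xx0 : 1 + x != 0 by rewrite gt_eqF // ltr_pwDl.
have r1 : r k.+1 = r k * (1 + x) by rewrite rS /x /rho; field.
have rho1 : rho k.+1 = rho k / (1 + x) + m k.+1.
  rewrite {1}/rho (sS k.+1) r1.
  rewrite (_ : s k.+1 = rho k * r k); last by rewrite /rho divfK.
  by field; rewrite xx0 rn0.
rewrite big_ord_recr /= r1 rho1.
have := onem_le_expR (mulr_gt0 C0 h0) x0.
set A := expR _ => hA.
have Cn0 : C != 0 by rewrite gt_eqF.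
have hn0 : h != 0 by rewrite gt_eqF.
apply: (@le_trans _ _
  (r k * A * expR ((rho k / (1 + x) + m k.+1) / (2 * C)))).
  by rewrite ler_wpM2r ?expR_ge0 // ler_wpM2l // ltW.
have -> : r k * A * expR ((rho k / (1 + x) + m k.+1) / (2 * C)) =
    (r k * expR (rho k / (2 * C))) * expR (C * h / 2 + m k.+1 / (2 * C)).
  rewrite -[RHS]mulrA -[LHS]mulrA /A -!expRD; congr (_ * expR _).
  move: xx0; rewrite /x; move: (rho k) (m k.+1) => a b ab0; field.
  by rewrite hn0 ab0 Cn0.
have -> : C * h * k.+1%:R / 2 + ((\sum_(i < k.+1) m i) + m k.+1) / (2 * C)
  = (C * h * k%:R / 2 + (\sum_(i < k.+1) m i) / (2 * C))
    + (C * h / 2 + m k.+1 / (2 * C))   by rewrite -(natr1 k); field.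
by rewrite [expR (_ + _ + (_ + _))]expRD mulrA ler_wpM2r ?expR_ge0.
Qed.

End gronwall.

(** * The three-block argument for sequences *)

Section discrete_green.
Context {F : numFieldType}.
Implicit Types (w : nat -> F).

Definition second_difference w k := w k.+1 - 2 * w k + w k.-1.

(** Green function of the second difference with data prescribed at i0 and i1
(and evaluated at j). Prescribing two neighbouring values instead would give a
kernel that jumps, and such a kernel cannot be tested against the local norm; for
well separated i0 and i1 it is Lipschitz. *)
Definition green (i0 i1 j k : nat) : F :=
  if (k <= i1)%N then (k - i0)%:R * ((j - i1)%:R / (i1 - i0)%:R)
  else (j - k)%:R.

Lemma green_eq0 i0 i1 j k : (i0 <= i1 <= j)%N -> (k <= i0)%N || (j <= k)%N ->
  green i0 i1 j k = 0.
Proof.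
move=> /andP[i01 i1j]; rewrite /green => /orP[ki|jk].
  by rewrite (leq_trans ki i01) (eqP ki) mul0r.
case: leqP => [ki|_]; last by rewrite (eqP jk).
by rewrite (eqP (leq_trans jk ki)) mul0r mulr0.
Qed.

(** The partial sums have a closed form, affine in the last two values of w, on
either side of i1. *)
Lemma sum_green w i0 i1 j : (i0 < i1 < j)%N ->
  \sum_(k < j) green i0 i1 j k * second_difference w k =
  w j - w i1 - (j - i1)%:R / (i1 - i0)%:R * (w i1 - w i0).
Proof.
move=> /andP[i01 i1j]; set s := (j - i1)%:R / _.
have J0 : (i1 - i0)%:R != 0 :> F by rewrite pnatr_eq0 subn_eq0 -ltnNge.
pose S m := \sum_(k < m.+1) green i0 i1 j k * second_difference w k.
have S0 m : (m <= i0)%N -> S m = 0.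
  move=> mi; rewrite /S big1 // => k _.
  have ki : (k <= i0)%N by rewrite -ltnS (leq_trans (ltn_ord k)).
  rewrite /green (leq_trans ki (ltnW i01)) (_ : (k - i0)%N = 0%N) ?mul0r //.
  by apply/eqP; rewrite subn_eq0.
have S1 m : (i0 + m <= i1)%N ->
    S (i0 + m)%N = s * (m%:R * (w (i0 + m).+1 - w (i0 + m)%N)
                       - (w (i0 + m)%N - w i0)).
  elim: m => [|m IH] mi; first by rewrite addn0 S0 // mul0r subrr subrr mulr0.
  rewrite addnS in mi *.
  rewrite /S big_ord_recr -/(S (i0 + m)%N) IH; last exact: ltnW.
  rewrite /green mi -/s /second_difference /= -addnS addKn addnS.
  by rewrite -(natr1 m); ring.
have S2 m : (i1 + m < j)%N ->
    S (i1 + m)%N = (j - (i1 + m))%:R * (w (i1 + m).+1 - w (i1 + m)%N)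
       + w (i1 + m)%N - w i1 - s * (w i1 - w i0).
  elim: m => [|m IH] mj.
    rewrite addn0 -[in LHS](subnKC (ltnW i01)) S1 ?subnKC ?(ltnW i01) //.
    by rewrite /s; field.
  rewrite addnS in mj *.
  rewrite /S big_ord_recr -/(S (i1 + m)%N) IH; last exact: ltnW.
  rewrite /green /second_difference /= leqNgt ltnS leq_addr /=.
  have -> : (j - (i1 + m))%N = (j - (i1 + m).+1).+1 by rewrite subnSK // ltnW.
  by rewrite -(natr1 (j - _)); ring.
case: j => // j in i1j s S S0 S1 S2 *; rewrite ltnS in i1j.
rewrite -/(S j) -(subnKC i1j) S2 ?subnKC // subSnn mul1r; ring.
Qed.

End discrete_green.


Section discrete_gordon.
Context {R : realType}.
Implicit Types (c A N e : nat -> R[i]).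

Lemma normc_nat k : normc (k%:R : R[i]) = k%:R.
Proof. by rewrite -(rmorph_nat (real_complex R)) normcR ger0_norm. Qed.

Lemma green_ge0_le (i0 i1 j k : nat) : (i0 < i1 <= j)%N ->
  normc (green i0 i1 j k : R[i]) <= (j - i1)%:R.
Proof.
move=> /andP[i01 i1j]; have J0 : 0 < (i1 - i0)%:R :> R by rewrite ltr0n subn_gt0.
rewrite /green; case: leqP => ki; last first.
  by rewrite normc_nat ler_nat leq_sub2l // ltnW.
rewrite normcM normcM normcV !normc_nat mulrA ler_pdivrMr // mulrC.
by rewrite ler_wpM2l // ler_nat leq_sub2r.
Qed.

Lemma green_step (i0 i1 j k : nat) : (i0 < i1 <= j)%N ->
  normc (green i0 i1 j k.+1 - green i0 i1 j k : R[i])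
    <= 1 + (j - i1)%:R / (i1 - i0)%:R.
Proof.
move=> /andP[i01 i1j]; have J0 : 0 < (i1 - i0)%:R :> R by rewrite ltr0n subn_gt0.
have J1 : (i1 - i0)%:R != 0 :> R[i] by rewrite pnatr_eq0 subn_eq0 -ltnNge.
have s0 : 0 <= (j - i1)%:R / (i1 - i0)%:R :> R by rewrite divr_ge0.
have down l : (i1 <= l)%N -> normc (green i0 i1 j l.+1 - green i0 i1 j l : R[i]) <= 1.
  move=> il; have -> : green i0 i1 j l = (j - l)%:R :> R[i].
    rewrite /green; case: leqP => // li.
    have -> : l = i1 by apply/eqP; rewrite eqn_leq li il.
    by rewrite mulrCA divff // mulr1.
  rewrite /green ltnNge il /=; case: (ltnP l j) => lj.
    by rewrite -(subnSK lj) -natr1 opprD addrA subrr sub0r normcNE normc1.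
  by rewrite (eqP (leqW lj)) (eqP lj) subrr normc0 ler01.
case: (leqP i1 k) => ik; first by apply: le_trans (down _ ik) _; rewrite lerDl.
rewrite /green ik (ltnW ik).
case: (leqP i0 k) => i0k.
  rewrite (subSn i0k) -natr1 mulrDl mul1r addrC addKr.
  by rewrite normcM normcV !normc_nat lerDr.
rewrite (eqP i0k) (eqP (ltnW i0k)) subrr normc0.
by rewrite addr_ge0.
Qed.

Lemma telescope_window (V : zmodType) (f : nat -> V) (a k M : nat) :
  (a <= k < M)%N ->
  \sum_(l < M) (f l - f l.-1) *+ (a < l <= k)%N = f k - f a.
Proof.
move=> /andP[ak kM].
rewrite -(big_mkord xpredT (fun l => (f l - f l.-1) *+ (a < l <= k)%N)).
rewrite (@big_cat_nat _ _ _ a.+1) //=; last exact: leq_ltn_trans kM.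
rewrite big1_seq ?add0r; last first.
  by move=> l; rewrite mem_index_iota ltnS => /andP[_ /andP[_ la]]; rewrite ltnNge la.
rewrite (@big_cat_nat _ _ _ k.+1) //= [X in _ + X]big1_seq ?addr0; last first.
  move=> l; rewrite mem_index_iota => /andP[_ /andP[kl _]].
  by rewrite [(l <= k)%N]leqNgt kl andbF.
rewrite -telescope_sumr // big_add1 /=.
by apply: eq_big_nat => l /andP[al lk]; rewrite ltnS al lk.
Qed.

Lemma normc_mulB (x y x' y' : R[i]) : normc (x * y - x' * y') <=
  normc (x - x') * normc y + normc x' * normc (y - y').
Proof.
have -> : x * y - x' * y' = (x - x') * y + x' * (y - y') by ring.
by apply: le_trans (normcD_le _ _) _; rewrite !normcM.
Qed.

Lemma sum_nat_eq_le1 (a b l : nat) : \sum_(a <= k < b) (k == l)%:R <= 1 :> R.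
Proof.
rewrite -natr_sum (_ : (\sum_(a <= k < b) (k == l) = count_mem l (index_iota a b))%N).
  by rewrite count_uniq_mem ?iota_uniq // lern1 leq_b1.
by rewrite -sum1_count [RHS]big_mkcond /=; apply: eq_bigr => k _; case: eqP.
Qed.

Section core.
Context (n i0 i1 : nat) (h C Om B L c0 eps eb : R) (A N e : nat -> R[i]).
Hypotheses (h0 : 0 < h) (h1 : h <= 1) (C0 : 0 < C) (Om0 : 0 <= Om)
  (B0 : 0 <= B) (L0 : 0 <= L) (c00 : 0 < c0) (eps0 : 0 <= eps) (eb0 : 0 < eb).
Hypotheses (ni0 : (n <= i0)%N) (i01 : (i0 < i1)%N) (i1n : (i1 < n + n)%N).
Hypothesis eqA : forall k,
  second_difference A k.+1 = h%:C * (N k.+1 * A k.+1 + e k.+1).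
Hypothesis AB : forall k, normc (A k) <= B.
Hypothesis AL : forall k, normc (A k.+1 - A k) <= L * h.
Hypothesis weak : forall c M, 0 <= M ->
  (forall k, ~~ (0 < k < n + n)%N -> c k = 0) ->
  (forall k, normc (c k) <= M) ->
  (forall k, normc (c k.+1 - c k) <= M * h) ->
  normc (\sum_(k < n + n) c k * (N (n + k)%N - N k)) <= M * eps.
Hypothesis sumN : forall i j, (i <= j)%N ->
  \sum_(i <= k < j) normc (N k) <= Om * ((j - i)%:R * h + 2).
Hypothesis sume : \sum_(k < n + (n + n)) normc (e k) <= eb.
Hypothesis Ac0 : forall k, (i0 <= k <= i1)%N -> c0 <= normc (A k).
Hypothesis i01h : (i1 - i0)%:R * h <= 1.

Let E k := A k * A (n + k).+1 - A k.+1 * A (n + k)%N.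
Let q k := A (n + k)%N + A (k - n)%N.
Let b := q i0 / A i0.
Let w k := q k - b * A k.
Let g k := (A k * A k.+1)^-1.

Lemma sume_le k0 m : (k0 + m <= n + (n + n))%N ->
  \sum_(k < m) normc (e (k0 + k)%N) <= eb.
Proof.
move=> km; apply: le_trans sume.
rewrite -(subnKC km) -addnA big_split_ord /= big_split_ord /=.
rewrite -[leLHS]add0r; apply: lerD; first by apply: sumr_ge0 => *; exact: normc_ge0.
by rewrite lerDl; apply: sumr_ge0 => *; exact: normc_ge0.
Qed.

(** E is the Wronskian of A and of its translate by n; apart from the errors e, it
varies only through the difference of the two coefficients. *)
Lemma wronskian_step l : E l.+1 - E l =
  h%:C * (A l.+1 * A (n + l.+1)%N * (N (n + l.+1)%N - N l.+1)
          + A l.+1 * e (n + l.+1)%N - A (n + l.+1)%N * e l.+1).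
Proof.
have -> : E l.+1 - E l = A l.+1 * second_difference A (n + l.+1)%N
                         - A (n + l.+1)%N * second_difference A l.+1.
  by rewrite /E /second_difference !addnS /=; ring.
rewrite addnS !eqA; ring.
Qed.


Let theta i l := \sum_(i0 <= k < i) g k *+ (l <= k < n + l)%N.

(** Along an interval where A does not vanish q / A telescopes; its increments are
Wronskians of A and q, each of which is E k - E (k - n). Summing by parts, the
increments of E appear with the weight theta, which is Lipschitz whereas the
indicator of the interval is not. *)
Lemma ratioE i : (i0 <= i <= i1)%N ->
  q i / A i - b = \sum_(l < n + n) theta i l * (E l - E l.-1).
Proof.
move=> /andP[i0i ii1].
have An0 k : (i0 <= k <= i1)%N -> A k != 0.
  move=> /Ac0; apply: contraTneq => ->; rewrite normc0 -ltNge //.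
rewrite /b -(telescope_sumr (fun k => q k / A k)) //.
under [RHS]eq_bigr do rewrite /theta mulr_suml.
rewrite exchange_big /=; apply: eq_big_nat => k /andP[i0k ki].
have nk : (n <= k)%N by exact: leq_trans i0k.
have ki1 : (k < i1)%N by exact: leq_trans ii1.
have -> : q k.+1 / A k.+1 - q k / A k = g k * (E k - E (k - n)%N).
  rewrite /g /E /q subnKC // subSn // addnS; field.
  by rewrite !An0 // ?i0k ?(ltnW ki1) // (leqW i0k).
rewrite -(@telescope_window _ E (k - n)%N k (n + n)).
  rewrite mulr_sumr; apply: eq_bigr => l _.
  rewrite ltn_subLR // andbC.
  by case: (_ && _); rewrite ?mulr1n ?mulr0n ?mul0r ?mulr0.
by rewrite leq_subr (ltn_trans ki1).
Qed.

Let c2 := c0 ^- 2.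

Lemma g_le k : (i0 <= k < i1)%N -> normc (g k) <= c2.
Proof.
move=> /andP[ik ki]; rewrite normcV normcM /c2 expr2.
rewrite lef_pV2 ?posrE ?mulr_gt0 // ?(lt_le_trans c00) ?Ac0 // ?ik ?(leqW ik) ?(ltnW ki) //.
by apply: ler_pM; rewrite ?(ltW c00) // Ac0 // ?ik ?(leqW ik) ?(ltnW ki).
Qed.

Lemma theta_le i l : (i <= i1)%N -> h * normc (theta i l) <= c2.
Proof.
move=> ii1; have c20 : 0 <= c2 by rewrite invr_ge0 exprn_ge0 // ltW.
apply: (@le_trans _ _ (h * ((i1 - i0)%:R * c2))); last first.
  by rewrite mulrA ler_piMl // mulrC.
rewrite ler_pM2l //; apply: le_trans (normc_sum _ _ _) _.
apply: (@le_trans _ _ (\sum_(i0 <= k < i) c2)); last first.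
  rewrite big_const_nat iter_addr_0 -[leLHS]mulr_natl ler_wpM2r // ler_nat.
  exact: leq_sub2r.
apply: ler_sum_nat => k /andP[ik ki].
case: (_ && _); rewrite ?mulr1n ?mulr0n ?normc0 //.
by apply: g_le; rewrite ik (leq_trans ki).
Qed.

(** Shifting the window by one changes its two end points only. *)
Lemma theta_step i l : (i <= i1)%N ->
  normc (theta i l.+1 - theta i l) <= 2 * c2.
Proof.
move=> ii1; have c20 : 0 <= c2 by rewrite invr_ge0 exprn_ge0 // ltW.
rewrite /theta -sumrB; apply: le_trans (normc_sum _ _ _) _.
apply: (@le_trans _ _
  (\sum_(i0 <= k < i) (c2 * (k == l)%:R + c2 * (k == n + l)%N%:R))).
  apply: ler_sum_nat => k /andP[ik ki].
  have gk : normc (g k) <= c2 by apply: g_le; rewrite ik (leq_trans ki).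
  rewrite addnS ltnS [(k <= n + l)%N]leq_eqVlt [(l <= k)%N]leq_eqVlt [l == k]eq_sym.
  have := normc_ge0 (g k); have := normcNE (g k).
  case: eqP => _; case: eqP => _; case: ltnP => _; case: ltnP => _ /=;
    rewrite ?(mulr1n, mulr0n, subrr, subr0, sub0r, normc0, mulr1, mulr0); lra.
rewrite big_split /= -!mulr_sumr.
have := sum_nat_eq_le1 i0 i l; have := sum_nat_eq_le1 i0 i (n + l).
by nra.
Qed.

Let K1 := 2 * B ^+ 2 * (B + L + 1) * c2.

(** The discrete form of the Cayley-Hamilton identity: q = b A up to a small error
near the base interval. *)
Lemma w_small i : (i0 <= i <= i1)%N -> normc (w i) <= K1 * (eps + eb).
Proof.
move=> ii; have ii1 : (i <= i1)%N by case/andP: ii.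
have c20 : 0 <= c2 by rewrite invr_ge0 exprn_ge0 // ltW.
have -> : w i = A i * (q i / A i - b).
  have : A i != 0 by apply: contraTneq (Ac0 ii) => ->; rewrite normc0 -ltNge.
  move=> Ai; rewrite /w mulrBr mulrCA divff // mulr1.
  by rewrite [A i * b]mulrC.
rewrite normcM ratioE //.
(* The weight of the weak bound; the factor h makes it of order 1. *)
pose c l := h%:C * theta i l * (A l * A (n + l)%N).
have -> : \sum_(l < n + n) theta i l * (E l - E l.-1) =
  \sum_(l < n + n) c l * (N (n + l)%N - N l)
  + (\sum_(l < n + n) h%:C * theta i l * A l * e (n + l)%N
     - \sum_(l < n + n) h%:C * theta i l * A (n + l)%N * e l).
  rewrite -sumrB -big_split /=; apply: eq_bigr => -[[|l] ln] _ /=.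
    rewrite /c /=; have -> : theta i 0 = 0.
      rewrite /theta big1_seq // => k /andP[_]; rewrite mem_index_iota.
      by move=> /andP[ik _]; rewrite addn0 ltnNge (leq_trans ni0 ik).
    by rewrite !(mulr0, mul0r) subrr addr0.
  rewrite wronskian_step /c; ring.
have hc := ltW h0.
have t1 : normc (\sum_(l < n + n) c l * (N (n + l)%N - N l)) <=
    2 * (B ^+ 2 + B * L) * c2 * eps.
  apply: weak => [|l|l|l].
  - by rewrite !mulr_ge0 // addr_ge0 ?exprn_ge0 // mulr_ge0.
  - rewrite negb_and -leqNgt -leqNgt leqn0 => ln.
    rewrite /c /theta big1_seq ?mulr0 ?mul0r // => k /andP[_].
    rewrite mem_index_iota => /andP[ik ki]; case/orP: ln => [/eqP->|ln].
      by rewrite addn0 [(k < n)%N]ltnNge (leq_trans ni0 ik).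
    by rewrite leqNgt (leq_trans ki (leq_trans ii1 (leq_trans (ltnW i1n) ln))).
  - rewrite /c !normcM normcR ger0_norm //.
    have := theta_le l ii1; have := AB l; have := AB (n + l).
    move: (normc_ge0 (A l)) (normc_ge0 (A (n + l))) (mulr_ge0 hc (normc_ge0 (theta i l))).
    move: (normc (A l)) (normc (A (n + l))) (h * _) => x y t x0 y0 t0 yB xB tc.
    apply: (@le_trans _ _ (c2 * (B * B))).
      by apply: ler_pM => //; [exact: mulr_ge0|exact: ler_pM].
    by have := mulr_ge0 B0 L0; have := sqr_ge0 B; rewrite expr2; nra.
  - rewrite /c; apply: le_trans (normc_mulB _ _ _ _) _.
    rewrite -mulrBr !normcM normcR ger0_norm //.
    have u1 : normc (A l.+1 * A (n + l.+1)%N - A l * A (n + l)%N) <= 2 * (B * (L * h)).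
      apply: le_trans (normc_mulB _ _ _ _) _; rewrite addnS.
      have := ler_pM (normc_ge0 _) (normc_ge0 _) (AL l) (AB (n + l).+1).
      have := ler_pM (normc_ge0 _) (normc_ge0 _) (AB l) (AL (n + l)).
      by lra.
    have u2 := theta_step l ii1; have u3 := theta_le l ii1.
    have u4 := ler_pM (normc_ge0 _) (normc_ge0 _) (AB l.+1) (AB (n + l.+1)).
    apply: (@le_trans _ _ (h * (2 * c2) * (B * B) + c2 * (2 * (B * (L * h))))); last first.
      by rewrite le_eqVlt; apply/orP; left; apply/eqP; ring.
    apply: lerD; apply: ler_pM; rewrite ?mulr_ge0 ?normc_ge0 //.
    by rewrite ler_pM2l.
have err (m : nat -> nat) k0 : (k0 + (n + n) <= n + (n + n))%N ->
    normc (\sum_(l < n + n) h%:C * theta i l * A (m l) * e (k0 + l)%N) <= c2 * B * eb.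
  move=> kn; apply: le_trans (normc_sum _ _ _) _.
  apply: le_trans (ler_wpM2l (mulr_ge0 c20 B0) (sume_le kn)); rewrite mulr_sumr.
  apply: ler_sum => l _; rewrite !normcM normcR ger0_norm //.
  by rewrite ler_wpM2r ?normc_ge0 // ler_pM ?mulr_ge0 ?normc_ge0 // theta_le.
have t2 := err id n (leqnn _).
have t3 := err (addn n) 0%N (leq_addl _ _).
apply: (@le_trans _ _ (B * (2 * (B ^+ 2 + B * L) * c2 * eps + (c2 * B * eb + c2 * B * eb)))).
  apply: ler_pM => //; rewrite ?normc_ge0 //.
  apply: le_trans (normcD_le _ _) _; apply: lerD => //.
  by apply: le_trans (normcB _ _) _; exact: lerD.
rewrite /K1 -subr_ge0.
have -> : 2 * B ^+ 2 * (B + L + 1) * c2 * (eps + eb) -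
    B * (2 * (B ^+ 2 + B * L) * c2 * eps + (c2 * B * eb + c2 * B * eb)) =
    2 * B ^+ 2 * c2 * (eps + (B + L) * eb) by ring.
by rewrite !mulr_ge0 ?sqr_ge0 // addr_ge0 // mulr_ge0 ?addr_ge0 // ltW.
Qed.


Lemma second_difference_w k : (n < k)%N -> second_difference w k =
  h%:C * (N k * w k + A (n + k)%N * (N (n + k)%N - N k)
          - A (k - n)%N * (N k - N (k - n)%N)
          + (e (n + k)%N + e (k - n)%N - b * e k)).
Proof.
case: k => // k nk; rewrite ltnS in nk.
have -> : second_difference w k.+1 = second_difference A (n + k).+1
    + second_difference A (k - n).+1 - b * second_difference A k.+1.
  by rewrite /w /q /second_difference /= !addnS !subSn ?leqW //; ring.
by rewrite !eqA /w /q subSn // addnS; ring.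
Qed.

Let p := n%:R * h.
Let d := (i1 - i0)%:R * h.
Let Q := 1 + p + p / d.

Lemma normc_b : normc b <= 2 * B / c0.
Proof.
have Ai : c0 <= normc (A i0) by apply: Ac0; rewrite leqnn ltnW.
rewrite /b normcM normcV; apply: ler_pM; rewrite ?normc_ge0 ?invr_ge0 ?normc_ge0 //.
  by rewrite mulr_natl mulr2n; apply: le_trans (normcD_le _ _) _; exact: lerD.
by rewrite lef_pV2 ?posrE // (lt_le_trans c00).
Qed.

Let d0 : 0 < d. Proof. by rewrite mulr_gt0 // ltr0n subn_gt0. Qed.
Let p0 : 0 <= p. Proof. by rewrite mulr_ge0 // ltW. Qed.
Let pd0 : 0 <= p / d. Proof. by rewrite divr_ge0 // ltW. Qed.

Section target.
Variable j : nat.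
Hypotheses (i1j : (i1 <= j)%N) (jn : (j <= n + n)%N).

Lemma jp : (j - i1)%:R * h <= p.
Proof.
rewrite ler_wpM2r ?(ltW h0) // ler_nat leq_subLR (leq_trans jn) // leq_add2r.
exact: leq_trans ni0 (ltnW i01).
Qed.

Lemma slope_le : (j - i1)%:R / (i1 - i0)%:R <= p / d.
Proof.
have J0 : 0 < (i1 - i0)%:R :> R by rewrite ltr0n subn_gt0.
rewrite ler_pdivrMr // (_ : p / d * _ = p / h); last by rewrite /d; field; rewrite !gt_eqF.
by rewrite ler_pdivlMr // jp.
Qed.

(** The Green function times a Lipschitz sequence is an admissible weight for the
weak bound. *)
Lemma weak_green (k' A' : nat -> R[i]) :
  (forall k, ~~ (0 < k < n + n)%N -> k' k = 0) ->
  (forall k, normc (k' k) <= (j - i1)%:R) ->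
  (forall k, normc (k' k.+1 - k' k) <= 1 + (j - i1)%:R / (i1 - i0)%:R) ->
  (forall k, normc (A' k) <= B) -> (forall k, normc (A' k.+1 - A' k) <= L * h) ->
  normc (\sum_(k < n + n) h%:C * k' k * A' k * (N (n + k)%N - N k))
    <= Q * (B + L) * eps.
Proof.
move=> kz kb ks Ab As; have hk k : normc (h%:C * k' k) <= p.
  rewrite normcM normcR gtr0_norm // mulrC; apply: le_trans jp.
  by rewrite ler_wpM2r // ltW.
apply: (weak (c := fun k => h%:C * k' k * A' k)) => [|k|k|k].
- by rewrite mulr_ge0 // addr_ge0 // addr_ge0.
- by move=> /kz ->; rewrite mulr0 mul0r.
- rewrite normcM; apply: le_trans (ler_pM _ _ (hk k) (Ab k)) _; rewrite ?normc_ge0 //.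
  by apply: ler_pM; rewrite ?lerDl // /Q; move: pd0; lra.
apply: le_trans (normc_mulB _ _ _ _) _; rewrite -mulrBr normcM normcR gtr0_norm //.
have u1 : h * normc (k' k.+1 - k' k) * normc (A' k.+1) <= h * (1 + p / d) * B.
  apply: ler_pM; rewrite ?mulr_ge0 ?normc_ge0 ?(ltW h0) //.
  by rewrite ler_pM2l // (le_trans (ks k)) // lerD2l slope_le.
have u2 : normc (h%:C * k' k) * normc (A' k.+1 - A' k) <= p * (L * h).
  by apply: ler_pM; rewrite ?normc_ge0.
apply: le_trans (lerD u1 u2) _; rewrite -subr_ge0.
have -> : Q * (B + L) * h - (h * (1 + p / d) * B + p * (L * h)) =
  h * (p * B + (1 + p / d) * L) by rewrite /Q; ring.
by rewrite mulr_ge0 ?(ltW h0) // addr_ge0 // mulr_ge0 // addr_ge0.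
Qed.

(** Representation of w j by its values at i0 and i1 and by its second differences.
Up to i1 the sequence w is small already, the source terms are small by the
weak bound, and what remains is the sum over the indices between i1 and j. *)
Lemma w_volterra : (i1 < j)%N -> normc (w j) <=
  (1 + 2 * (p / d) + 3 * Om * p) * (K1 * (eps + eb))
  + 2 * (Q * (B + L) * eps) + p * (2 + 2 * B / c0) * eb
  + h * \sum_(k < j - i1) (j - i1 - k)%:R * (normc (N (i1 + k)%N) * normc (w (i1 + k)%N)).
Proof.
move=> i1j'.
have K10 : 0 <= K1 * (eps + eb).
  by rewrite /K1 /c2 !mulr_ge0 ?invr_ge0 ?exprn_ge0 ?addr_ge0 // ltW.
have i01j : (i0 < i1 <= j)%N by rewrite i01.
have i01j' : (i0 <= i1 <= j)%N by rewrite ltnW.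
pose kk k : R[i] := green i0 i1 j k.
have kle k : normc (kk k) <= (j - i1)%:R by exact: green_ge0_le.
have hk k : normc (h%:C * kk k) <= p.
  rewrite normcM normcR gtr0_norm // mulrC; apply: le_trans jp.
  by rewrite ler_wpM2r // ltW.
have k0 k : ~~ (i0 < k < j)%N -> kk k = 0.
  by rewrite negb_and -!leqNgt => ?; exact: green_eq0.
have wE : w j = w i1 + (j - i1)%:R / (i1 - i0)%:R * (w i1 - w i0)
    + \sum_(k < n + n) kk k * second_difference w k.
  rewrite -(subnKC jn) big_split_ord /= [X in _ + (_ + X)]big1 ?addr0; last first.
    by move=> k _; rewrite k0 ?mul0r // negb_and -!leqNgt leq_addr orbT.
  rewrite sum_green ?i01 //; ring.
have DE : \sum_(k < n + n) kk k * second_difference w k =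
   \sum_(k < j) h%:C * kk k * (N k * w k)
   + \sum_(k < n + n) h%:C * kk k * A (n + k)%N * (N (n + k)%N - N k)
   - \sum_(k < n + n) h%:C * kk (n + k)%N * A k * (N (n + k)%N - N k)
   + (\sum_(k < n + n) h%:C * kk k * e (n + k)%N
      + \sum_(k < n) h%:C * kk (n + k)%N * e (0 + k)%N
      - b * \sum_(k < n + n) h%:C * kk k * e (0 + k)%N).
  have S1 : \sum_(k < j) h%:C * kk k * (N k * w k) =
            \sum_(k < n + n) h%:C * kk k * (N k * w k).
    rewrite -(subnKC jn) [RHS]big_split_ord /= [X in _ = _ + X]big1 ?addr0 //.
    by move=> k _; rewrite k0 ?mulr0 ?mul0r // negb_and -!leqNgt leq_addr orbT.
  have S2 (f : nat -> R[i]) :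
      \sum_(k < n) h%:C * kk (n + k)%N * f k =
      \sum_(k < n + n) h%:C * kk k * f (k - n)%N.
    rewrite [RHS]big_split_ord /= [X in _ = X + _]big1 ?add0r; last first.
      move=> k _; rewrite k0 ?mulr0 ?mul0r // negb_and -!leqNgt.
      by rewrite (leq_trans (ltnW (ltn_ord k)) ni0).
    by apply: eq_bigr => k _; rewrite addKn.
  have S3 : \sum_(k < n + n) h%:C * kk (n + k)%N * A k * (N (n + k)%N - N k) =
     \sum_(k < n + n) h%:C * kk k * (A (k - n)%N * (N (n + (k - n))%N - N (k - n)%N)).
    rewrite -(S2 (fun k => A k * (N (n + k)%N - N k))) big_split_ord /=.
    rewrite [X in _ + X]big1 ?addr0; last first.
      move=> k _; rewrite k0 ?mulr0 ?mul0r // negb_and -!leqNgt.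
      by rewrite (leq_trans jn) ?orbT // addnA leq_addr.
    by apply: eq_bigr => k _; rewrite !mulrA.
  rewrite S1 S3 (S2 (fun k => e (0 + k)%N)) mulr_sumr -!big_split /= -!sumrB -!big_split /=.
  apply: eq_bigr => k _; have [nk|kn] := ltnP n k.
    by rewrite second_difference_w // !add0n subnKC ?(ltnW nk) //; ring.
  rewrite k0; first by rewrite !(mulr0, mul0r, addr0, subr0, add0r).
  by rewrite negb_and -leqNgt (leq_trans kn ni0).
have sumk m0 m (f : nat -> R[i]) : (m0 + m <= n + (n + n))%N ->
    (forall k, normc (f k) <= p) ->
    normc (\sum_(k < m) f k * e (m0 + k)%N) <= p * eb.
  move=> mn fp; apply: le_trans (normc_sum _ _ _) _.
  apply: le_trans (ler_wpM2l p0 (sume_le mn)); rewrite mulr_sumr.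
  by apply: ler_sum => k _; rewrite normcM ler_wpM2r ?normc_ge0.
have T1 : normc (\sum_(k < j) h%:C * kk k * (N k * w k)) <=
   3 * Om * p * (K1 * (eps + eb)) +
   h * \sum_(k < j - i1) (j - i1 - k)%:R * (normc (N (i1 + k)%N) * normc (w (i1 + k)%N)).
  have spl (f : nat -> R[i]) : \sum_(k < j) f k =
      \sum_(k < i1) f k + \sum_(k < j - i1) f (i1 + k)%N.
    by rewrite -[in LHS](subnKC i1j) big_split_ord.
  rewrite (spl (fun k => h%:C * kk k * (N k * w k))).
  apply: le_trans (normcD_le _ _) _.
  apply: lerD.
    have hN : \sum_(i0 <= k < i1) normc (N k) <= 3 * Om.
      apply: le_trans (sumN (ltnW i01)) _; rewrite mulrC ler_wpM2r //.
      by move: i01h; lra.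
    apply: (@le_trans _ _ (\sum_(i0 <= k < i1) normc (N k) * (p * (K1 * (eps + eb))))).
      apply: le_trans (normc_sum _ _ _) _.
      rewrite -(big_mkord xpredT (fun k => normc (h%:C * kk k * (N k * w k)))).
      rewrite (@big_cat_nat _ _ _ i0) //= ?(ltnW i01) // big1_seq ?add0r; last first.
        move=> k; rewrite mem_index_iota => /andP[_ /andP[_ ki]].
        by rewrite k0 ?mulr0 ?mul0r ?normc0 // negb_and -!leqNgt (ltnW ki).
      apply: ler_sum_nat => k /andP[ik ki]; rewrite normcM [normc (N _ * _)]normcM mulrCA.
      rewrite ler_wpM2l ?normc_ge0 // ler_pM ?normc_ge0 // w_small //.
      by rewrite ik ltnW.
    rewrite -mulr_suml -[leRHS]mulrA; apply: ler_wpM2r => //.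
    exact: (mulr_ge0 p0 K10).
  apply: le_trans (normc_sum _ _ _) _; rewrite mulr_sumr; apply: ler_sum => k _.
  rewrite !normcM normcR gtr0_norm // -mulrA ler_pM2l // ler_wpM2r ?mulr_ge0 ?normc_ge0 //.
  rewrite /kk /green; case: leqP => ik; last by rewrite normc_nat subnDA.
  have -> : nat_of_ord k = 0%N by apply/eqP; rewrite -leqn0 -(leq_add2l i1) addn0.
  rewrite addn0 subn0 mulrCA divff ?mulr1 ?normc_nat //.
  by rewrite pnatr_eq0 subn_eq0 -ltnNge.
have T2 : normc (\sum_(k < n + n) h%:C * kk k * A (n + k)%N * (N (n + k)%N - N k))
    <= Q * (B + L) * eps.
  apply: (weak_green (A' := fun k => A (n + k)%N)) => // [k kn|k|k].
  - rewrite k0 //; apply: contra kn => /andP[ik kj].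
    by rewrite (leq_ltn_trans _ ik) // (leq_trans kj).
  - exact: green_step.
  - by rewrite addnS.
have T3 : normc (\sum_(k < n + n) h%:C * kk (n + k)%N * A k * (N (n + k)%N - N k))
    <= Q * (B + L) * eps.
  apply: (weak_green (k' := fun k => kk (n + k)%N)) => // [k kn|k].
  - rewrite k0 //; apply: contra kn => /andP[ik kj].
    rewrite -(ltn_add2l n) addn0 (leq_ltn_trans ni0) //=.
    by apply: leq_trans (leq_trans kj jn); rewrite ltnS leq_addl.
  - by rewrite addnS; exact: green_step.
have T4 : normc (\sum_(k < n + n) h%:C * kk k * e (n + k)%N
      + \sum_(k < n) h%:C * kk (n + k)%N * e (0 + k)%N
      - b * \sum_(k < n + n) h%:C * kk k * e (0 + k)%N) <= p * (2 + 2 * B / c0) * eb.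
  apply: le_trans (normcB _ _) _; rewrite normcM.
  have U1 := normcD_le (\sum_(k < n + n) h%:C * kk k * e (n + k)%N)
     (\sum_(k < n) h%:C * kk (n + k)%N * e (0 + k)%N).
  have V1 := sumk n (n + n)%N (fun k => h%:C * kk k) (leqnn _) hk.
  have V2 := sumk 0%N n (fun k => h%:C * kk (n + k)%N) (leq_addr _ _) (fun k => hk _).
  have V3 := sumk 0%N (n + n)%N (fun k => h%:C * kk k) (leq_addl _ _) hk.
  have V4 := ler_pM (normc_ge0 _) (normc_ge0 _) normc_b V3.
  by lra.
rewrite wE DE.
have W0 : normc (w i0) <= K1 * (eps + eb) by apply: w_small; rewrite leqnn ltnW.
have W1 : normc (w i1) <= K1 * (eps + eb) by apply: w_small; rewrite leqnn ltnW.
have W2 : normc ((j - i1)%:R / (i1 - i0)%:R * (w i1 - w i0)) <=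
    2 * (p / d) * (K1 * (eps + eb)).
  rewrite normcM normcM normcV !normc_nat [2 * _]mulrC -[leRHS]mulrA.
  apply: ler_pM; rewrite ?normc_ge0 ?slope_le ?divr_ge0 //.
  by apply: le_trans (normcB _ _) _; lra.
apply: le_trans (normcD_le _ _) _; have := normcD_le (w i1) ((j - i1)%:R / (i1 - i0)%:R * (w i1 - w i0)).
move: W2 T1 T2 T3 T4.
set X1 := _ * (w i1 - w i0); set X2 := \sum_(k < j) _; set X3 := \sum_(k < n + n) h%:C * kk k * A _ * _.
set X4 := \sum_(k < n + n) h%:C * _ * A k * _; set X5 := _ - b * _.
move=> W2 T1 T2 T3 T4 W3.
have := normcD_le (X2 + X3 - X4) X5; have := normcB (X2 + X3) X4; have := normcD_le X2 X3.
by lra.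
Qed.

End target.

Let K2 := (2 + 3 * Om) * K1 + 2 * (B + L) + 2 + 2 * B / c0.

(** The almost vanishing initial data of w are amplified at most at the exponential
rate C / 2 + Om / (2 C). *)
Lemma gordon_growth j : (i1 <= j <= n + n)%N -> normc (w j) <=
  Q * K2 * (eps + eb) * expR (C * p / 2 + Om * (p + 3) / (2 * C)).
Proof.
move=> /andP[i1j jn].
have K10 : 0 <= K1.
  by rewrite /K1 /c2 !mulr_ge0 ?invr_ge0 ?exprn_ge0 ?addr_ge0 // ltW.
have BL0 := addr_ge0 B0 L0.
have Bc0 : 0 <= 2 * B / c0 by rewrite divr_ge0 ?mulr_ge0 // ltW.
have K20 : 2 <= K2.
  have : 0 <= (2 + 3 * Om) * K1 by rewrite mulr_ge0 // addr_ge0 // mulr_ge0.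
  by rewrite /K2; lra.
have Q1 : 1 <= Q by move: p0 pd0; rewrite /Q; lra.
have ee : 0 < eps + eb by rewrite ltr_wpDl.
set eta := Q * K2 * (eps + eb).
have eta0 : 0 < eta by rewrite !mulr_gt0 // (lt_le_trans _ K20, lt_le_trans _ Q1).
have etaE : (1 + 2 * (p / d) + 3 * Om * p) * (K1 * (eps + eb))
  + 2 * (Q * (B + L) * eps) + p * (2 + 2 * B / c0) * eb <= eta.
  rewrite -subr_ge0 /eta.
  have -> : Q * K2 * (eps + eb) - ((1 + 2 * (p / d) + 3 * Om * p) * (K1 * (eps + eb))
  + 2 * (Q * (B + L) * eps) + p * (2 + 2 * B / c0) * eb) =
   (1 + 2 * p + 3 * Om * (1 + p / d)) * (K1 * (eps + eb)) + 2 * (Q * (B + L) * eb)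
   + (2 + 2 * B / c0) * (Q * eps + (1 + p / d) * eb).
    by rewrite /K2 /Q; ring.
  have e0 := ltW eb0; have Q0 : 0 <= Q by lra.
  have c0n := ltW c00; have d0n := ltW d0.
  by rewrite !(addr_ge0, mulr_ge0, invr_ge0) // ltW.
have := @discrete_gronwall R C h eta (fun k => normc (N (i1 + k)%N))
  (fun l => normc (w (i1 + l)%N)) (n + n - i1)%N C0 h0 eta0 (fun k => normc_ge0 _).
have H : forall l, (l <= n + n - i1)%N -> normc (w (i1 + l)%N) <= eta +
  h * \sum_(k < l) (l - k)%:R * (normc (N (i1 + k)%N) * normc (w (i1 + k)%N)).
  move=> [|l] ln.
    rewrite big_ord0 mulr0 !addr0 addn0.
    apply: le_trans (w_small _) _; first by rewrite leqnn ltnW.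
    rewrite /eta ler_wpM2r ?(ltW ee) //.
    have : K1 <= K2.
      have := mulr_ge0 Om0 K10; rewrite /K2; lra.
    nra.
  have := @w_volterra (i1 + l.+1)%N; rewrite !addKn => h'.
  apply: le_trans (h' _ _ _) _; first exact: leq_addr.
  - by rewrite -leq_subRL ?(ltnW i1n).
  - by rewrite addnS ltnS leq_addr.
  - by rewrite lerD2r.
move=> /(_ H (j - i1)%N); rewrite leq_sub2r // subnKC // => /(_ isT) h'.
apply: le_trans h' _; rewrite ler_pM2l // ler_expR.
have jj := jp jn.
have -> : \sum_(k < (j - i1).+1) normc (N (i1 + k)%N) = \sum_(i1 <= k < j.+1) normc (N k).
  rewrite -[X in index_iota X _]add0n big_addn big_mkord subSn //.
  by apply: eq_bigr => k _; rewrite addnC.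
have sN : \sum_(i1 <= k < j.+1) normc (N k) <= Om * (p + 3).
  apply: le_trans (sumN (leqW i1j)) _; rewrite ler_wpM2l // subSn //.
  by rewrite -natr1 mulrDl mul1r; move: jj h1; lra.
apply: lerD.
  by rewrite ler_wpM2r ?invr_ge0 // -mulrA ler_wpM2l ?(ltW C0) // mulrC.
by rewrite ler_wpM2r // invr_ge0 mulr_ge0 // ltW.
Qed.

End core.
End discrete_gordon.

(** * Riemann sums for positive measures *)

Section riemann_sums.
Context {R : realType}.
Implicit Types (f : R -> R[i]) (g : R -> R) (a : R).

Definition node a m l : R := a + l%:R / m.+1%:R.

Definition cell a m l : set R := `]node a m l, node a m l.+1].

Definition rsum (nu : set R -> R[i]) a L m f : R[i] :=
  \sum_(l < L * m.+1) f (node a m l) * nu (cell a m l).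

Lemma node0 a m : node a m 0 = a.
Proof. by rewrite /node mul0r addr0. Qed.

Lemma node_end a m L : node a m (L * m.+1) = a + L%:R.
Proof. by rewrite /node natrM mulfK // pnatr_eq0. Qed.

Lemma node_le a m i j : (node a m i <= node a m j) = (i <= j)%N.
Proof. by rewrite /node lerD2l ler_pM2r ?invr_gt0 ?ltr0n // ler_nat. Qed.

Lemma node_lt a m i j : (node a m i < node a m j) = (i < j)%N.
Proof. by rewrite /node ltrD2l ltr_pM2r ?invr_gt0 ?ltr0n // ltr_nat. Qed.

Lemma nodeS a m l : node a m l.+1 = node a m l + m.+1%:R^-1.
Proof. by rewrite /node -(natr1 l) mulrDl mul1r addrA. Qed.

Lemma measurable_cell a m l : measurable (cell a m l).
Proof. exact: measurable_itv. Qed.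

Lemma cell_dist a m l x : cell a m l x -> `|x - node a m l| <= m.+1%:R^-1.
Proof.
rewrite /cell /= in_itv /= => /andP[x1 x2]; rewrite ger0_norm ?subr_ge0 ?(ltW x1) //.
by rewrite lerBlDl -nodeS.
Qed.

Lemma cellU a m l : `]a, node a m l.+1]%classic = `]a, node a m l]%classic `|` cell a m l.
Proof.
have h1 : a <= node a m l by rewrite -{1}(node0 a m) node_le.
have h2 : node a m l <= node a m l.+1 by rewrite node_le.
apply/seteqP; split=> x; rewrite /cell /= !in_itv /=.
  by move=> /andP[ax xl]; case: (leP x (node a m l)) => xn; [left|right]; apply/andP.
move=> [/andP[ax xl]|/andP[ax xl]]; apply/andP; split=> //.
  exact: le_trans h2.
exact: le_lt_trans ax.
Qed.

Lemma cell_disj a m l : [disjoint `]a, node a m l]%classic & cell a m l].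
Proof.
apply/disj_setPS => x [] /=; rewrite !in_itv /= => /andP[_ h1] /andP[h2 _].
by move: (lt_le_trans h2 h1); rewrite ltxx.
Qed.

Section positive_measure.
Variable lam : {measure set R -> \bar R}.

Lemma Rintegral_cell g (s t v e : R) : continuous g ->
  (lam `]s, t]%classic < +oo)%E -> (forall x, s < x <= t -> `|g x - v| <= e) ->
  `|\int[lam]_(x in `]s, t]%classic) g x - v * fine (lam `]s, t]%classic)|
    <= e * fine (lam `]s, t]%classic).
Proof.
move=> cg fl gv.
have mst : measurable `]s, t]%classic by exact: measurable_itv.
have ic (c : R) : lam.-integrable `]s, t]%classic (EFin \o cst c).
  apply: measurable_bounded_integrable => //.
  by exists `|c|; split; [exact: num_real|move=> ? /ltW ? ? _].
have ig : lam.-integrable `]s, t]%classic (EFin \o g).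
  apply: measurable_bounded_integrable => //.
    by apply: measurable_funS (continuous_measurable_fun cg).
  exists (`|v| + `|e|); split; first exact: num_real.
  move=> M /ltW vM x /= /[!in_itv] /= xst; apply: le_trans vM.
  rewrite -[g x](subrK v) addrC; apply: le_trans (ler_normD _ _) _.
  by rewrite lerD2l (le_trans (gv _ xst)) // ler_norm.
rewrite -(Rintegral_cst lam mst v) -(RintegralB mst ig (ic v)).
have igv : lam.-integrable `]s, t]%classic (EFin \o (fun x => g x - v)).
  rewrite (_ : _ \o _ = (EFin \o g) \- (EFin \o cst v))%E //.
  exact: integrableB.
apply: le_trans (le_normr_Rintegral mst igv) _.
rewrite -(Rintegral_cst lam mst e).
have ia : lam.-integrable `]s, t] (EFin \o (fun x => `|g x - v|)).
  rewrite (_ : _ \o _ = abse \o (EFin \o (fun x => g x - v))) //.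
  exact: integrable_abse.
by apply: (le_Rintegral mst ia (ic e)) => x /=; rewrite in_itv /= => /gv.
Qed.

Lemma measure_cells a m k : (lam `]a, node a m k]%classic < +oo)%E ->
  \sum_(l < k) fine (lam (cell a m l)) = fine (lam `]a, node a m k]%classic).
Proof.
elim: k => [|k IH] fl.
  by rewrite big_ord0 node0 set_itvoc0 measure0.
have h2 : node a m k <= node a m k.+1 by rewrite node_le.
have mk := @measurable_itv R `]a, node a m k].
have mc := measurable_cell a m k.
have fl1 : (lam `]a, node a m k]%classic < +oo)%E.
  apply: le_lt_trans fl; apply: le_measure; rewrite ?inE //.
  by rewrite cellU; exact: subsetUl.
have fl2 : (lam (cell a m k) < +oo)%E.
  apply: le_lt_trans fl; apply: le_measure; rewrite ?inE //.
  by rewrite cellU; exact: subsetUr.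
rewrite big_ord_recr /= IH // cellU measureU //; last exact/disj_set2P/cell_disj.
by rewrite fineD // ge0_fin_numE.
Qed.

(** Adding one cell at a time, each cell contributes at most e times its mass to the
error. *)
Lemma Rintegral_rsum g a L m e : continuous g ->
  (lam `]a, (a + L%:R)%R]%classic < +oo)%E ->
  (forall x, ~~ (a < x <= a + L%:R) -> g x = 0) ->
  (forall x y, `|x - y| <= m.+1%:R^-1 -> `|g x - g y| <= e) ->
  `|\int[lam]_x g x
    - \sum_(l < L * m.+1) g (node a m l) * fine (lam (cell a m l))|
  <= e * fine (lam `]a, a + L%:R]%classic).
Proof.
move=> cg fl g0 ge.
have -> : \int[lam]_x g x = \int[lam]_(x in `]a, a + L%:R]%classic) g x.
  rewrite [RHS]Rintegral_mkcond; apply: eq_Rintegral => x _.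
  rewrite patchE; case: ifPn => //; rewrite notin_setE /= in_itv /= => /negP.
  exact: g0.
rewrite -(node_end a m); rewrite -(node_end a m) in fl.
elim: (L * m.+1)%N fl => [|k IH] fl.
  by rewrite big_ord0 node0 set_itvoc0 Rintegral_set0 subrr normr0 measure0 mulr0.
have mk := @measurable_itv R `]a, node a m k].
have mc := measurable_cell a m k.
have mk1 := @measurable_itv R `]a, node a m k.+1].
have fl1 : (lam `]a, node a m k]%classic < +oo)%E.
  apply: le_lt_trans fl; apply: le_measure; rewrite ?inE //.
  by rewrite cellU; exact: subsetUl.
have fl2 : (lam (cell a m k) < +oo)%E.
  apply: le_lt_trans fl; apply: le_measure; rewrite ?inE //.
  by rewrite cellU; exact: subsetUr.
have ig : lam.-integrable `]a, node a m k.+1]%classic (EFin \o g).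
  apply: measurable_bounded_integrable => //.
    by apply: measurable_funS (continuous_measurable_fun cg).
  have [||c _ hc] := @EVT_max R (fun x => `|g x|) a (node a m k.+1).
    - by rewrite -{1}(node0 a m) node_le.
    - apply: continuous_subspaceT => x; apply: continuous_comp; first exact: cg.
      exact: norm_continuous.
  exists `|g c|; split; first exact: num_real.
  move=> M /ltW cM x /= /[!in_itv] /= /andP[ax xk]; apply: le_trans cM.
  by apply: hc; rewrite in_itv /= (ltW ax).
rewrite big_ord_recr /= cellU Rintegral_setU //; last 2 first.
- by rewrite -cellU.
- exact: cell_disj.
rewrite measureU //; last exact/disj_set2P/cell_disj.
rewrite fineD ?ge0_fin_numE // mulrDr opprD addrACA.
apply: le_trans (ler_normD _ _) _; apply: lerD; first exact: IH.
apply: Rintegral_cell => // x xc; apply: ge; apply: cell_dist.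
by rewrite /cell /= in_itv.
Qed.

End positive_measure.
End riemann_sums.

(** * Riemann sums for the integral of a local measure *)

Section integral_rsum.
Context {R : realType}.
Implicit Types (f : R -> R[i]) (g : R -> R) (a : R) (mu : local_measure R).

Definition modulus (d e : R) f := forall x y, `|x - y| <= d -> normc (f x - f y) <= e.

Definition supported f a (L : nat) := forall x, ~~ (a < x <= a + L%:R) -> f x = 0.

(** Heine's theorem, from the near covering property of a segment on which f is
supported. *)
Lemma exists_modulus f a L e : ccontinuous f -> supported f a L -> 0 < e ->
  exists2 d, 0 < d & modulus d e f.
Proof.
move=> [cr ci] sf e0.
pose P (d x : R) := forall y, `|x - y| <= d -> normc (f x - f y) <= e.
have cpt : compact `[a - 1, a + L%:R + 1] by exact: segment_compact.
move/compact_near_coveringP : (cpt) => /(_ R 0^'+ P) H.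
have {}H : \forall d \near 0^'+, `[a - 1, a + L%:R + 1] `<=` P d.
  apply: H => x _.
  have e40 : 0 < e / 4 by rewrite divr_gt0.
  have /cvgrPdist_le/(_ _ e40) := cr x; have /cvgrPdist_le/(_ _ e40) := ci x.
  move=> /nbhs_ballP[d1 /= d10 h1] /nbhs_ballP[d2 /= d20 h2].
  pose d := Num.min d1 d2 / 2.
  have d0 : 0 < d by rewrite divr_gt0 // lt_min d10.
  have hx y : `|x - y| < d + d -> normc (f x - f y) <= e / 2.
    rewrite -splitr lt_min => /andP[y1 y2].
    have := h1 _ y1; have := h2 _ y2; rewrite /= -ReN -ReD -ImN -ImD.
    have := normc_le_ReIm (f x - f y); lra.
  exists (ball x d, [set r : R | 0 < r < d]); rewrite /=.
    split; first exact: nbhsx_ballx.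
    near=> r; apply/andP; split; near: r; first exact: nbhs_right_gt.
    exact: nbhs_right_lt.
  move=> [y r] /= [xy /andP[r0 rd]] y' yy'.
  have -> : f y - f y' = (f x - f y') - (f x - f y).
    by ring.
  apply: le_trans (normcB _ _) _; rewrite [leRHS]splitr; apply: lerD; apply: hx.
    rewrite (_ : x - y' = (x - y) + (y - y')); last by rewrite addrA subrK.
    apply: le_lt_trans (ler_normD _ _) _; apply: ltrD; first exact: xy.
    exact: le_lt_trans rd.
  by apply: lt_trans xy _; rewrite ltrDl.
have [d [[d0 d1] Pd]] : exists d, (0 < d /\ d < 1) /\ `[a - 1, a + L%:R + 1] `<=` P d.
  apply: (@filter_ex _ (0^'+)); near=> d; split; last by near: d.
  split; near: d; [exact: nbhs_right_gt|exact: nbhs_right_lt].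
exists d => // x y xy; have := xy; rewrite ler_norml => /andP[xy1 xy2].
have [xI|xI] := boolP (a - 1 <= x <= a + L%:R + 1).
  by apply: Pd => //=; rewrite in_itv.
have fx : f x = 0.
  by apply: sf; apply: contra xI => /andP[h1 h2]; apply/andP; split; lra.
have fy : f y = 0.
  by apply: sf; apply: contra xI => /andP[h1 h2]; apply/andP; split; lra.
by rewrite fx fy subrr normc0 ltW.
Unshelve. all: by end_near. Qed.

Definition jordan_mass (c : {charge set R -> \bar R}) a L : R :=
  fine (jordan_pos (hahn c) `]a, a + L%:R]%classic)
  + fine (jordan_neg (hahn c) `]a, a + L%:R]%classic).

Lemma jordan_mass_ge0 c a L : 0 <= jordan_mass c a L.
Proof. by rewrite addr_ge0 // fine_ge0. Qed.

Lemma fine_jordan (c : {charge set R -> \bar R}) (A : set R) : measurable A ->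
  fine (c A) = fine (jordan_pos (hahn c) A) - fine (jordan_neg (hahn c) A).
Proof.
move=> mA; rewrite (jordan_decomp (hahn c) mA) /cadd /= /cscale /= EFinN mulN1e.
by rewrite fineB // fin_num_measure.
Qed.

Lemma charge_integral_rsum (c : {charge set R -> \bar R}) g a L m e :
  continuous g -> (forall x, ~~ (a < x <= a + L%:R) -> g x = 0) ->
  (forall x y, `|x - y| <= m.+1%:R^-1 -> `|g x - g y| <= e) ->
  `|charge_integral c g
    - \sum_(l < L * m.+1) g (node a m l) * fine (c (cell a m l))|
  <= e * jordan_mass c a L.
Proof.
move=> cg g0 ge.
have fl (lam : {finite_measure set R -> \bar R}) A : measurable A -> (lam A < +oo)%E.
  by move=> mA; rewrite -ge0_fin_numE // fin_num_measure.
have m1 := @measurable_itv R `]a, a + L%:R].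
have h1 := Rintegral_rsum cg (fl (jordan_pos (hahn c)) _ m1) g0 ge.
have h2 := Rintegral_rsum cg (fl (jordan_neg (hahn c)) _ m1) g0 ge.
have -> : \sum_(l < L * m.+1) g (node a m l) * fine (c (cell a m l)) =
  \sum_(l < L * m.+1) g (node a m l) * fine (jordan_pos (hahn c) (cell a m l))
  - \sum_(l < L * m.+1) g (node a m l) * fine (jordan_neg (hahn c) (cell a m l)).
  rewrite -sumrB; apply: eq_bigr => l _; rewrite -mulrBr fine_jordan //.
  exact: measurable_cell.
rewrite /charge_integral /jordan_mass mulrDr opprD addrACA -opprD.
by apply: le_trans (ler_normB _ _) _; exact: lerD.
Qed.

Definition radon_mass nu (h : complex_radon nu) a L : R :=
  2 * jordan_mass (re_charge h) a L + 2 * jordan_mass (im_charge h) a L.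

Lemma radon_mass_ge0 nu (h : complex_radon nu) a L : 0 <= radon_mass h a L.
Proof. by rewrite addr_ge0 // mulr_ge0 // jordan_mass_ge0. Qed.

Lemma cmeasure_integral_rsum nu (h : complex_radon nu) f a L m e :
  ccontinuous f -> supported f a L -> modulus m.+1%:R^-1 e f ->
  normc (cmeasure_integral h f - rsum nu a L m f) <= e * radon_mass h a L.
Proof.
move=> [cr ci] sf fe.
have r0 x : ~~ (a < x <= a + L%:R) -> complex.Re (f x) = 0 by move=> /sf ->.
have i0 x : ~~ (a < x <= a + L%:R) -> complex.Im (f x) = 0 by move=> /sf ->.
have re x y : `|x - y| <= m.+1%:R^-1 -> `|complex.Re (f x) - complex.Re (f y)| <= e.
  by move=> /fe; rewrite -ReN -ReD; apply: le_trans; exact: normc_Re.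
have ie x y : `|x - y| <= m.+1%:R^-1 -> `|complex.Im (f x) - complex.Im (f y)| <= e.
  by move=> /fe; rewrite -ImN -ImD; apply: le_trans; exact: normc_Im.
have h1 := charge_integral_rsum (re_charge h) cr r0 re.
have h2 := charge_integral_rsum (re_charge h) ci i0 ie.
have h3 := charge_integral_rsum (im_charge h) cr r0 re.
have h4 := charge_integral_rsum (im_charge h) ci i0 ie.
apply: le_trans (normc_le_ReIm _) _; rewrite ReD ImD ReN ImN /rsum Re_sum Im_sum.
under eq_bigr do rewrite ReM; under [X in _ + `|_ - X|]eq_bigr do rewrite ImM.
rewrite sumrB big_split /= /radon_mass.
move: h1 h2 h3 h4; rewrite /re_charge /im_charge /=.
set c1 := charge_integral _ _; set c2 := charge_integral _ _.
set c3 := charge_integral _ _; set c4 := charge_integral _ _.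
set s1 := \sum_(l < _) _; set s2 := \sum_(l < _) _; set s3 := \sum_(l < _) _.
set s4 := \sum_(l < _) _ => h1 h2 h3 h4.
have e1 : c1 - c4 - (s1 - s4) = (c1 - s1) - (c4 - s4) by ring.
have e2 : c2 + c3 - (s3 + s2) = (c2 - s2) + (c3 - s3) by ring.
rewrite e1 e2; have := ler_normB (c1 - s1) (c4 - s4).
by have := ler_normD (c2 - s2) (c3 - s3); lra.
Qed.

Lemma charge_cells_le (c : {charge set R -> \bar R}) (D : nat -> set R) a L m :
  (forall l, measurable (D l)) -> (forall l, D l `<=` cell a m l) ->
  \sum_(l < L * m.+1) `|fine (c (D l))| <= jordan_mass c a L.
Proof.
move=> mD Dc; have mc := measurable_cell a m.
have fl (lam : {finite_measure set R -> \bar R}) A : measurable A -> (lam A < +oo)%E.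
  by move=> mA; rewrite -ge0_fin_numE // fin_num_measure.
rewrite /jordan_mass -(node_end a m) -!measure_cells; last 2 first.
- by apply: fl; exact: measurable_itv.
- by apply: fl; exact: measurable_itv.
rewrite -big_split /=; apply: ler_sum => l _; rewrite fine_jordan //.
apply: le_trans (ler_normB _ _) _; rewrite !ger0_norm ?fine_ge0 //.
by apply: lerD; (apply: fine_le; rewrite ?fin_num_measure //);
  apply: le_measure; rewrite ?inE.
Qed.

Lemma mu_set0 mu : mu set0 = 0.
Proof. by have := cr0 (lm_radon mu (@segment_compact R 0 0)); rewrite set0I. Qed.

Lemma mu_setID mu A P (K : set R) : compact K -> measurable A -> measurable P ->
  A `<=` K -> mu A = mu (A `&` P) + mu (A `\` P).
Proof.
move=> cK mA mP AK; pose h := lm_radon mu cK.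
have mN := measurableC mP.
have IK (B : set R) : A `&` B `&` K = A `&` B by rewrite setIAC (setIidl AK).
have hr : (complex.Re (mu (A `&` K)))%:E = ((complex.Re (mu (A `&` P `&` K)))%:E
    + (complex.Re (mu (A `&` ~` P `&` K)))%:E)%E.
  exact: (charge_partition (re_charge h) mA mP mN (setUv P) (setICr P)).
have hi : (complex.Im (mu (A `&` K)))%:E = ((complex.Im (mu (A `&` P `&` K)))%:E
    + (complex.Im (mu (A `&` ~` P `&` K)))%:E)%E.
  exact: (charge_partition (im_charge h) mA mP mN (setUv P) (setICr P)).
move: hr hi; rewrite !IK (setIidl AK) setDE -!EFinD => -[hr] [hi].
by apply/eqP; rewrite eq_complex ReD ImD hr hi !eqxx.
Qed.

Lemma natSinv_le (d : R) : 0 < d ->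
  exists M, forall m, (M <= m)%N -> m.+1%:R^-1 <= d.
Proof.
move=> d0; exists (Num.truncn d^-1) => m Mm.
rewrite -[d]invrK lef_pV2 ?posrE ?invr_gt0 //.
by apply: le_trans (ltW (truncnS_gt _)) _; rewrite ler_nat ltnS.
Qed.

(** The integral is taken against the restriction of mu to the support of f, the
Riemann sum against mu itself. A cell on which the two measures differ contains a
zero of f, so that its node has a small weight; the total variation of the parts
outside the support is bounded by the Jordan decomposition on a segment. *)
Lemma lm_integral_rsum mu f a L : ccontinuous f -> supported f a L ->
  forall e, 0 < e -> exists M, forall m, (M <= m)%N ->
    normc (lm_integral mu f - rsum mu a L m f) <= e.
Proof.
move=> cf sf e e0.
have cK' : compact `[a, a + L%:R] by exact: segment_compact.
have sptK : spt f `<=` `[a, a + L%:R].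
  rewrite /spt closureE => x; apply; split; first exact: itv_closed.
  move=> y /=; apply: contraNP => /negP h; rewrite sf //.
  by apply: contra h => /andP[h1 h2]; rewrite in_itv /= ltW.
have cK : compact (spt f) by apply: (subclosed_compact _ cK') => //; exact: closed_closure.
rewrite /lm_integral; case: pselect => // {}cK.
set h := lm_radon mu cK; pose h' := lm_radon mu cK'.
pose T := radon_mass h a L + (jordan_mass (re_charge h') a L + jordan_mass (im_charge h') a L).
have T0 : 0 <= T.
  apply: addr_ge0; first exact: radon_mass_ge0.
  by apply: addr_ge0; exact: jordan_mass_ge0.
have T1 : 0 < T + 1 by rewrite ltr_wpDl.
have [d d0 dm] := exists_modulus cf sf (divr_gt0 e0 T1).
have [M dM] := natSinv_le d0.
have mspt : measurable (spt f) by rewrite /spt; apply: closed_measurable; exact: closed_closure.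
exists M => m /dM md.
have cellK (l : 'I_(L * m.+1)) : cell a m l `<=` `[a, a + L%:R].
  move=> x; rewrite /cell /= !in_itv /= => /andP[x1 x2]; apply/andP; split.
    by apply: le_trans (ltW x1); rewrite -{1}(node0 a m) node_le.
  by apply: le_trans x2 _; rewrite -(node_end a m) node_le.
have {dM}fm : modulus m.+1%:R^-1 (e / (T + 1)) f by move=> x y /le_trans/(_ md) /dm.
rewrite (_ : _ - _ = (cmeasure_integral h f - rsum (fun B => mu (B `&` spt f)) a L m f)
   - \sum_(l < L * m.+1) f (node a m l) * mu (cell a m l `\` spt f)); last first.
  have -> : rsum mu a L m f = rsum (fun B => mu (B `&` spt f)) a L m f +
     \sum_(l < L * m.+1) f (node a m l) * mu (cell a m l `\` spt f).
    rewrite -big_split /=; apply: eq_bigr => l _; rewrite -mulrDr.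
    congr (_ * _).
    have X := @mu_setID mu (cell a m l) (spt f) _ cK' (measurable_cell _ _ _) mspt (@cellK l). exact: X.
  by rewrite opprD addrA.
apply: le_trans (normcB _ _) _.
apply: (@le_trans _ _ (e / (T + 1) * T)); last first.
  rewrite -mulrA ger_pMr // mulrC ler_pdivrMr // mul1r lerDl //.
rewrite {2}/T mulrDr; apply: lerD; first exact: cmeasure_integral_rsum.
apply: le_trans (normc_sum _ _ _) _.
have eT : 0 <= e / (T + 1) by rewrite divr_ge0 // ltW.
(* The cells beyond the range are replaced by the empty set, which keeps the
   family inside the segment. *)
pose D l := if (l < L * m.+1)%N then cell a m l `\` spt f else set0.
have mD l : measurable (D l).
  by rewrite /D; case: ifP => // _; apply: measurableD => //; exact: measurable_cell.
have Dc l : D l `<=` cell a m l.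
  by rewrite /D; case: ifP => _; [exact: subDsetl|exact: sub0set].
have DK (l : 'I_(L * m.+1)) : D l `&` `[a, a + L%:R] = cell a m l `\` spt f.
  by rewrite /D ltn_ord setIidl // => x [xc _]; exact: (cellK l).
have := lerD (charge_cells_le (re_charge h') L mD Dc) (charge_cells_le (im_charge h') L mD Dc).
move=> /(ler_wpM2l eT); apply: le_trans.
rewrite -big_split /= mulr_sumr; apply: ler_sum => l _; rewrite normcM DK.
have [->|/set0P[y [yc yn]]] := eqVneq (cell a m l `\` spt f) set0.
  by rewrite mu_set0 normc0 mulr0 mulr_ge0 // addr_ge0.
apply: ler_pM; rewrite ?normc_ge0 //; last exact: normc_le_ReIm.
have fy : f y = 0.
  by apply/eqP; apply: contrapT => /negP fy; apply: yn; exact: subset_closure.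
by rewrite -[f _]subr0 -fy; apply: fm; rewrite distrC cell_dist.
Qed.

End integral_rsum.

(** * Functionals given by Riemann sums *)

Section limits.
Context {R : realType}.
Implicit Types (s t : nat -> R[i]) (x y : R[i]).

Definition tends s x := forall e, 0 < e ->
  exists M, forall m, (M <= m)%N -> normc (x - s m) <= e.

Lemma tends_ext s t x : s =1 t -> tends s x -> tends t x.
Proof. by move=> st sx e /sx[M h]; exists M => m /h; rewrite st. Qed.

Lemma tends_cst x : tends (fun=> x) x.
Proof. by move=> e e0; exists 0%N => m _; rewrite subrr normc0 ltW. Qed.

Lemma tendsD s t x y : tends s x -> tends t y -> tends (fun m => s m + t m) (x + y).
Proof.
move=> sx ty e e0; have e20 : 0 < e / 2 by rewrite divr_gt0.
have [M hM] := sx _ e20; have [N hN] := ty _ e20.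
exists (maxn M N) => m; rewrite geq_max => /andP[/hM h1 /hN h2].
rewrite opprD addrACA [e]splitr; apply: le_trans (normcD_le _ _) _.
exact: lerD.
Qed.

Lemma tendsZ c s x : tends s x -> tends (fun m => c * s m) (c * x).
Proof.
move=> sx e e0; have c0 : 0 < normc c + 1 by rewrite ltr_wpDl // normc_ge0.
have [M hM] := sx _ (divr_gt0 e0 c0); exists M => m /hM h.
rewrite -mulrBr normcM; apply: le_trans (ler_wpM2l (normc_ge0 _) h) _.
by rewrite mulrCA ger_pMr // ler_pdivrMr // mul1r lerDl.
Qed.

Lemma tends_sum (I : Type) (r : seq I) (s : I -> nat -> R[i]) (x : I -> R[i]) :
  (forall i, tends (s i) (x i)) ->
  tends (fun m => \sum_(i <- r) s i m) (\sum_(i <- r) x i).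
Proof.
move=> h; elim: r => [|i r IH].
  by rewrite big_nil; apply: tends_ext (tends_cst 0) => m; rewrite big_nil.
rewrite big_cons; apply: tends_ext (tendsD (h i) IH) => m; by rewrite big_cons.
Qed.

Lemma sum_normc_le_lim (I : finType) (s : I -> nat -> R[i]) (x : I -> R[i]) B :
  (forall i, tends (s i) (x i)) -> (forall m, \sum_i normc (s i m) <= B) ->
  \sum_i normc (x i) <= B.
Proof.
move=> h sB; apply: (@ler_archi _ _ _ (\sum_(i : I) 1)) => e e0.
have [M hM] : exists M, forall m, (M <= m)%N -> forall i, normc (x i - s i m) <= e.
  have hi i : exists M, forall m, (M <= m)%N -> normc (x i - s i m) <= e by exact: h.
  pose M i := projT1 (cid (hi i)).
  exists (\max_i M i)%N => m Mm i; apply: (projT2 (cid (hi i))).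
  by apply: leq_trans Mm; exact: (leq_bigmax i).
apply: le_trans (lerD (sB M) (lexx _)); rewrite mulr_suml -big_split /=.
apply: ler_sum => i _; rewrite mul1r.
have := normcD_le (x i - s i M) (s i M); rewrite subrK.
by have := hM M (leqnn _) i; lra.
Qed.

Lemma tends_unique s x y : tends s x -> tends s y -> x = y.
Proof.
move=> sx sy; have h := tendsD sx (tendsZ (-1) sy).
apply/eqP; rewrite -subr_eq0; apply/eqP/normc_eq0; rewrite -[y]mul1r -mulNr.
have := @sum_normc_le_lim unit _ (fun=> x + -1 * y) 0 (fun=> h).
rewrite big_const card_unit /= addr0; apply => m.
by rewrite big_const card_unit /= addr0 mulN1r subrr normc0.
Qed.

End limits.

Section representation.
Context {R : realType}.
Implicit Types (nu : set R -> R[i]) (I : (R -> R[i]) -> R[i]) (f : R -> R[i]).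

(** All integrals below are handled through this property: identities between
Riemann sums (linearity, translation, change of the measure) and bounds by the
variation of nu pass to the limit, whatever the supports of the functions. *)
Definition represents nu I := forall f a L,
  ccontinuous f -> supported f a L -> tends (fun m => rsum nu a L m f) (I f).

Definition lebc (B : set R) : R[i] := (fine (lebesgue_measure B))%:C.

Lemma represents_lm (mu : local_measure R) : represents mu (lm_integral mu).
Proof. by move=> f a L cf sf; exact: lm_integral_rsum. Qed.

(** Lebesgue measure lives on a copy of R whose Borel structure is declared
separately; it is carried over to R so that it can be handled like the other
measures. *)
Definition of_measurableTypeR (x : measurableTypeR R) : R := x.

Lemma measurable_of_measurableTypeR :
  measurable_fun [set: measurableTypeR R] of_measurableTypeR.
Proof. by move=> _ B mB; rewrite setTI. Qed.

Lemma exists_lebesgue : exists2 lam : {measure set R -> \bar R},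
  lam = (@lebesgue_measure R) :> (set R -> \bar R) &
  forall g a b, continuous g -> (forall x, ~~ (a < x <= b) -> g x = 0) ->
    \int[lam]_x g x = \int[lebesgue_measure]_x g x.
Proof.
pose lam := measure_function_pushforward__canonical__measure_function_Measure
  lebesgue_measure measurable_of_measurableTypeR.
exists lam; first by [].
move=> g a b cg g0; rewrite /Rintegral; congr fine.
have ig : lebesgue_measure.-integrable [set: measurableTypeR R] (EFin \o g).
  have mab : measurable (`[a, b]%classic : set (measurableTypeR R)).
    exact: measurable_itv.
  have : lebesgue_measure.-integrable `[a, b] (EFin \o g).
    apply: continuous_compact_integrable; first exact: segment_compact.
    exact: continuous_subspaceT.
  move/(integrable_mkcond _ mab); apply: eq_integrable => // x _.
  rewrite patchE; case: ifPn => //; rewrite notin_setE /= in_itv /= => /negP h.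
  by rewrite g0 //; apply: contra h => /andP[h1 h2]; rewrite ltW.
have mg : measurable_fun [set: R] (EFin \o g).
  by apply/measurable_EFinP; exact: continuous_measurable_fun.
have := @integral_pushforward _ _ _ _ R _ measurable_of_measurableTypeR
  lebesgue_measure setT _ mg ig measurableT.
by [].
Qed.

Lemma lebc_cell a m l : lebc (cell a m l) = (m.+1%:R^-1)%:C.
Proof.
rewrite /lebc /cell lebesgue_measure_itv /= lte_fin node_lt ltnSn.
by rewrite -EFinD /= nodeS addrAC subrr add0r.
Qed.

Lemma represents_leb : represents lebc leb_integral.
Proof.
move=> f a L cf sf e e0; have [cr ci] := cf.
have [lam lamE lamI] := exists_lebesgue.
have T0 : 0 < 2 * L%:R + 1 :> R by rewrite ltr_wpDl // mulr_ge0.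
have [d d0 dm] := exists_modulus cf sf (divr_gt0 e0 T0).
have [M dM] := natSinv_le d0.
exists M => m /dM md.
have {dM}fe : modulus m.+1%:R^-1 (e / (2 * L%:R + 1)) f.
  by move=> x y /le_trans/(_ md) /dm.
have r0 x : ~~ (a < x <= a + L%:R) -> complex.Re (f x) = 0 by move=> /sf ->.
have i0 x : ~~ (a < x <= a + L%:R) -> complex.Im (f x) = 0 by move=> /sf ->.
have re x y : `|x - y| <= m.+1%:R^-1 ->
    `|complex.Re (f x) - complex.Re (f y)| <= e / (2 * L%:R + 1).
  by move=> /fe; rewrite -ReN -ReD; apply: le_trans; exact: normc_Re.
have ie x y : `|x - y| <= m.+1%:R^-1 ->
    `|complex.Im (f x) - complex.Im (f y)| <= e / (2 * L%:R + 1).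
  by move=> /fe; rewrite -ImN -ImD; apply: le_trans; exact: normc_Im.
have lE : lam `]a, (a + L%:R)%R]%classic = L%:R%:E :> \bar R.
  rewrite lamE lebesgue_measure_itv /= lte_fin ltrDl ltr0n.
  by case: L {sf T0 dm fe r0 i0 re ie} => //= L; rewrite -EFinD addrAC subrr add0r.
have fl : (lam `]a, (a + L%:R)%R]%classic < +oo :> \bar R)%E.
  by rewrite lE ltry.
have h1 := Rintegral_rsum cr fl r0 re.
have h2 := Rintegral_rsum ci fl i0 ie.
move: h1 h2; rewrite lE /= (lamI _ a (a + L%:R)) // (lamI _ a (a + L%:R)) //.
move=> h1 h2; apply: le_trans (normc_le_ReIm _) _.
rewrite ReD ImD ReN ImN /rsum Re_sum Im_sum /=.
under eq_bigr do rewrite ReM; under [X in _ + `|_ - X|]eq_bigr do rewrite ImM.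
have -> : \sum_(l < L * m.+1) (complex.Re (f (node a m l)) * complex.Re (lebc (cell a m l))
   - complex.Im (f (node a m l)) * complex.Im (lebc (cell a m l))) =
   \sum_(l < L * m.+1) complex.Re (f (node a m l)) * fine (lam (cell a m l)).
  by apply: eq_bigr => l _; rewrite /lebc /= mulr0 subr0 lamE.
have -> : \sum_(l < L * m.+1) (complex.Re (f (node a m l)) * complex.Im (lebc (cell a m l))
   + complex.Im (f (node a m l)) * complex.Re (lebc (cell a m l))) =
   \sum_(l < L * m.+1) complex.Im (f (node a m l)) * fine (lam (cell a m l)).
  by apply: eq_bigr => l _; rewrite /lebc /= mulr0 add0r lamE.
apply: le_trans (lerD h1 h2) _.
rewrite -mulrDr -mulrA ger_pMr // mulrC ler_pdivrMr // mul1r; lra.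
Qed.

Lemma represents_sub nu1 nu2 I1 I2 (c : R[i]) : represents nu1 I1 ->
  represents nu2 I2 ->
  represents (fun B => nu1 B - c * nu2 B) (fun f => I1 f - c * I2 f).
Proof.
move=> r1 r2 f a L cf sf.
have := tendsD (r1 _ _ _ cf sf) (tendsZ (- c) (r2 _ _ _ cf sf)).
rewrite mulNr; apply: tends_ext => m; rewrite /rsum mulr_sumr -big_split /=.
by apply: eq_bigr => l _; ring.
Qed.

Lemma ccontinuousD f g : ccontinuous f -> ccontinuous g ->
  ccontinuous (fun x => f x + g x).
Proof.
move=> [fr fi] [gr gi]; split=> x.
  rewrite (_ : _ \o _ = (fun x => complex.Re (f x) + complex.Re (g x))).
    by apply: cvgD; [exact: fr|exact: gr].
  by apply/funext => y /=; rewrite ReD.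
rewrite (_ : _ \o _ = (fun x => complex.Im (f x) + complex.Im (g x))).
  by apply: cvgD; [exact: fi|exact: gi].
by apply/funext => y /=; rewrite ImD.
Qed.

Lemma ccontinuousM f g : ccontinuous f -> ccontinuous g ->
  ccontinuous (fun x => f x * g x).
Proof.
move=> [fr fi] [gr gi]; split=> x.
  rewrite (_ : _ \o _ = (fun x => complex.Re (f x) * complex.Re (g x)
                                - complex.Im (f x) * complex.Im (g x))).
    by apply: cvgB; apply: cvgM; [exact: fr|exact: gr|exact: fi|exact: gi].
  by apply/funext => y /=; rewrite ReM.
rewrite (_ : _ \o _ = (fun x => complex.Re (f x) * complex.Im (g x)
                                + complex.Im (f x) * complex.Re (g x))).
  by apply: cvgD; apply: cvgM; [exact: fr|exact: gi|exact: fi|exact: gr].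
by apply/funext => y /=; rewrite ImM.
Qed.

Lemma ccontinuous_cst c : ccontinuous (fun _ : R => c).
Proof. by split=> x; exact: cvg_cst. Qed.

Lemma ccontinuous_real (g : R -> R) : continuous g -> ccontinuous (fun x => (g x)%:C).
Proof. by move=> cg; split=> x; [exact: cg|exact: cvg_cst]. Qed.

Lemma ccontinuous_sum (T : Type) (r : seq T) (F : T -> R -> R[i]) :
  (forall i, ccontinuous (F i)) -> ccontinuous (fun x => \sum_(i <- r) F i x).
Proof.
move=> h; elim: r => [|i r IH].
  rewrite (_ : (fun x => _) = fun=> 0); first exact: ccontinuous_cst.
  by apply/funext => x; rewrite big_nil.
rewrite (_ : (fun x => _) = fun x => F i x + \sum_(i <- r) F i x).
  exact: ccontinuousD.
by apply/funext => x; rewrite big_cons.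
Qed.

Lemma ccontinuous_shift f p : ccontinuous f -> ccontinuous (fun x => f (x + p)).
Proof.
have sh (x : R) : {for x, continuous (fun y : R => y + p)}.
  by apply: cvgD; [exact: cvg_id|exact: cvg_cst].
move=> [fr fi]; split=> x.
  exact: (@continuous_comp _ _ _ _ (@complex.Re R \o f) x (sh x) (fr _)).
exact: (@continuous_comp _ _ _ _ (@complex.Im R \o f) x (sh x) (fi _)).
Qed.

Lemma supported_sum (T : Type) (r : seq T) (F : T -> R -> R[i]) a L :
  (forall i, supported (F i) a L) -> supported (fun x => \sum_(i <- r) F i x) a L.
Proof. by move=> h x xa; rewrite /= big1 // => i _; exact: h. Qed.

Lemma supportedMl f g a L : supported f a L -> supported (fun x => f x * g x) a L.
Proof. by move=> h x /h ->; rewrite mul0r. Qed.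

Lemma supportedMr f g a L : supported g a L -> supported (fun x => f x * g x) a L.
Proof. by move=> h x /h ->; rewrite mulr0. Qed.

Section represented.
Variables (nu : set R -> R[i]) (I : (R -> R[i]) -> R[i]).
Hypothesis rI : represents nu I.

Lemma represented_sum (T : Type) (r : seq T) (c : T -> R[i]) (F : T -> R -> R[i]) a L :
  (forall i, ccontinuous (F i)) -> (forall i, supported (F i) a L) ->
  I (fun x => \sum_(i <- r) c i * F i x) = \sum_(i <- r) c i * I (F i).
Proof.
move=> cF sF; have cs i : ccontinuous (fun x => c i * F i x).
  by apply: ccontinuousM => //; exact: ccontinuous_cst.
have ss i : supported (fun x => c i * F i x) a L by exact: supportedMr.
apply: (tends_unique (rI (ccontinuous_sum r cs) (supported_sum r ss))).
have := tends_sum r (fun i => tendsZ (c i) (rI (cF i) (sF i))).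
apply: tends_ext => m; rewrite /rsum; under eq_bigr do rewrite mulr_sumr.
rewrite exchange_big /=; apply: eq_bigr => l _; rewrite mulr_suml.
by apply: eq_bigr => i _; rewrite mulrA.
Qed.

Lemma representedZ c f a L : ccontinuous f -> supported f a L ->
  I (fun x => c * f x) = c * I f.
Proof.
move=> cf sf; have := @represented_sum unit [:: tt] (fun=> c) (fun=> f) a L.
rewrite big_seq1 => <- //; congr I; apply/funext => x; by rewrite big_seq1.
Qed.

Lemma representedB f g a L : ccontinuous f -> supported f a L ->
  ccontinuous g -> supported g a L -> I (fun x => f x - g x) = I f - I g.
Proof.
move=> cf sf cg sg.
have := @represented_sum bool [:: true; false] (fun b => if b then 1 else -1)
  (fun b => if b then f else g) a L.
rewrite !big_cons big_nil !mul1r !mulN1r addr0 => <-; do 2? [by case].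
by congr I; apply/funext => x; rewrite !big_cons big_nil !mul1r !mulN1r addr0.
Qed.

(** The family is summed inside the Riemann sums, so that the variation of nu is
paid only once. *)
Lemma represented_le (T : finType) (F : T -> R -> R[i]) a L V S :
  (forall m, \sum_(l < L * m.+1) normc (nu (cell a m l)) <= V) -> 0 <= S ->
  (forall i, ccontinuous (F i)) -> (forall i, supported (F i) a L) ->
  (forall x, \sum_i normc (F i x) <= S) ->
  \sum_i normc (I (F i)) <= S * V.
Proof.
move=> hV S0 cF sF FS.
apply: (sum_normc_le_lim (fun i => rI (cF i) (sF i))) => m.
apply: le_trans (ler_wpM2l S0 (hV m)); rewrite mulr_sumr /rsum.
apply: le_trans (ler_sum _ (fun i _ => normc_sum _ _ _)) _.
rewrite exchange_big /=; apply: ler_sum => l _.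
under eq_bigr do rewrite normcM; rewrite -mulr_suml.
by rewrite ler_wpM2r ?normc_ge0.
Qed.

Lemma represented_normc_le f a L V S :
  (forall m, \sum_(l < L * m.+1) normc (nu (cell a m l)) <= V) -> 0 <= S ->
  ccontinuous f -> supported f a L -> (forall x, normc (f x) <= S) ->
  normc (I f) <= S * V.
Proof.
move=> hV S0 cf sf fS.
have := @represented_le unit (fun=> f) a L V S hV S0 (fun=> cf) (fun=> sf).
by rewrite big_const card_unit /= addr0; apply => x; rewrite big_const card_unit /= addr0.
Qed.

Lemma translate_cell (a p : R) m l : translate p (cell a m l) = cell (a + p) m l.
Proof.
have E k : node (a + p) m k = node a m k + p by rewrite /node addrAC.
rewrite translateE; apply/seteqP; split=> x; rewrite /cell /= !in_itv /= !E.
  by move=> /andP[h1 h2]; apply/andP; split; lra.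
by move=> /andP[h1 h2]; apply/andP; split; lra.
Qed.

Lemma represented_translate p I' f a L :
  represents (fun B => nu (translate p B)) I' ->
  ccontinuous f -> supported f a L -> I' f = I (fun x => f (x - p)).
Proof.
move=> rI' cf sf; apply: (tends_unique (rI' _ _ _ cf sf)).
have sf' : supported (fun x => f (x - p)) (a + p) L.
  by move=> x h; apply: sf; apply: contra h => /andP[h1 h2]; apply/andP; split; lra.
have := rI (ccontinuous_shift (- p) cf) sf'; apply: tends_ext => m.
apply: eq_bigr => l _; rewrite translate_cell; congr (f _ * _).
by rewrite /node addrAC addrK.
Qed.

End represented.

Lemma bounded_set0 : bounded_set (set0 : set R).
Proof. by exists 0; split; [exact: num_real|move=> ? ? ? []]. Qed.

Lemma bounded_cell (a : R) m l : bounded_set (cell a m l).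
Proof.
have [M [Mr hM]] := compact_bounded (@segment_compact R (node a m l) (node a m l.+1)).
exists M; split=> // x Mx y /= yc; apply: hM Mx _ _; move: yc.
by rewrite /cell /= !in_itv /= => /andP[h1 h2]; rewrite ltW.
Qed.

Lemma unif_norm_fin_num (mu : local_measure R) : loc_unif mu ->
  unif_norm mu \is a fin_num.
Proof.
rewrite /loc_unif /= => mufin; rewrite ge0_fin_numE //.
apply: (@le_trans _ _ (Defs.total_variation mu `]0%R, (0 + 1)%R]%classic)); last first.
  by apply: ereal_sup_ubound; exists 0.
apply: ereal_sup_ubound; exists 0%N, (fun=> set0); split.
- by move=> k; split; [exact: measurable0|exact: bounded_set0].
- by move=> k; exact: sub0set.
- by apply/trivIsetP => i j _ _ _; rewrite setI0.
- by rewrite big_ord0.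
Qed.

(** On each unit interval the cells are one of the families in the definition of the
total variation. *)
Lemma variation_lm (mu : local_measure R) a L m : loc_unif mu ->
  \sum_(l < L * m.+1) normc (mu (cell a m l)) <= L%:R * fine (unif_norm mu).
Proof.
move=> mufin; have ufin := unif_norm_fin_num mufin.
have ub (b : R) : (Defs.total_variation mu `]b, (b + 1)%R]%classic <= unif_norm mu)%E.
  by apply: ereal_sup_ubound; exists b.
have unit (b : R) : \sum_(l < m.+1) normc (mu (cell b m l)) <= fine (unif_norm mu).
  rewrite -lee_fin fineK //; apply: le_trans (ub b); apply: ereal_sup_ubound.
  exists m.+1, (fun l => if (l < m.+1)%N then cell b m l else set0); split.
  - move=> k; case: ifP => _; split; first exact: measurable_cell.
    + exact: bounded_cell.
    + exact: measurable0.
    + exact: bounded_set0.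
  - move=> k; case: ifP => [km|_]; last exact: sub0set.
    move=> x; rewrite /cell /= !in_itv /= => /andP[h1 h2]; apply/andP; split.
      by apply: le_lt_trans h1; rewrite -{1}(node0 b m) node_le.
    apply: le_trans h2 _; rewrite -[1]/(1%:R) -(node_end b m 1) mul1n node_le //.
  - apply/trivIsetP => i j _ _ ij; case: ifP => _; rewrite ?set0I //.
    case: ifP => _; rewrite ?setI0 //; apply/seteqP; split=> // x [].
    rewrite /cell /= !in_itv /= => /andP[h1 h2] /andP[h3 h4].
    have := lt_le_trans h1 h4; have := lt_le_trans h3 h2.
    by rewrite !node_lt !ltnS => ji ij'; move/eqP: ij; apply; apply/eqP; rewrite eqn_leq ij' ji.
  - by congr _%:E; apply: eq_bigr => l _; rewrite ltn_ord.
elim: L a => [|L IH] a; first by rewrite mul0n big_ord0 mul0r.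
rewrite mulSn big_split_ord /= -natr1 mulrDl mul1r addrC; apply: lerD => //.
apply: le_trans (IH (a + 1)); rewrite le_eqVlt; apply/orP; left; apply/eqP.
apply: eq_bigr => l _; congr (normc (mu _)); rewrite /cell.
have E k : node a m (m.+1 + k) = node (a + 1) m k.
  by rewrite /node natrD mulrDl divff ?addrA // pnatr_eq0.
by rewrite -addnS !E.
Qed.

End representation.

(** * Smooth bumps *)

Section smooth_bump.
Context {R : realType}.
Implicit Types (x s t c : R) (k n : nat).

(** For k = 0 this is the usual flat function; the powers of 1 / x make the family
stable under differentiation. *)
Definition flat k x : R := if 0 < x then x^-1 ^+ k * expR (- x^-1) else 0.

Lemma flat_le k x : `|flat k x| <= k.+1`!%:R * `|x|.
Proof.
rewrite /flat; case: ltP => x0; last by rewrite normr0 mulr_ge0.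
have y0 : 0 < x^-1 by rewrite invr_gt0.
rewrite ger0_norm ?mulr_ge0 ?expR_ge0 ?exprn_ge0 ?(ltW y0) // gtr0_norm //.
have f0 : 0 < k.+1`!%:R :> R by rewrite ltr0n fact_gt0.
rewrite expRN ler_pdivrMr ?expR_gt0 //.
have := expR_ge1Dxn k (ltW y0); move/(le_trans (ler_wpDl ler01 (lexx _))).
rewrite ler_pdivrMr // exprS => h.
rewrite -(ler_pM2l y0) (le_trans h) // mulrC -[_ * _ * expR _]mulrA mulrCA.
by rewrite [x^-1 * _]mulrA mulVf ?mul1r // gt_eqF.
Qed.

(** At 0 the difference quotient of the function of index k is the one of index
k + 1, which tends to 0. *)
Lemma is_derive_flat k x :
  is_derive x 1 (flat k) (flat k.+2 x - k%:R * flat k.+1 x).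
Proof.
have [x0|x0|->] := ltgtP x 0.
- rewrite /flat !ltNge (ltW x0) /= mulr0 subr0.
  apply: (@near_eq_is_derive _ _ _ (cst 0)) => //.
  by near=> y; rewrite ltNge ltW //; near: y; exact: lt_nbhsl.
- have xn0 : x != 0 by rewrite gt_eqF.
  pose h (z : R) : R := z ^+ k * expR (- z).
  have dh (z : R) : is_derive z 1 h ((k%:R * z ^+ k.-1 - z ^+ k) * expR (- z)).
    have := is_deriveM (is_deriveX k (is_derive_id z (1 : R)))
      (is_derive1_comp (is_derive_expR (- z)) (is_deriveN (is_derive_id z (1 : R)))).
    have -> : (id ^+ k) * (expR \o (- id)) = h.
      by apply/funext => y; rewrite fctE exprfctE.
    by move/is_derive_eq; apply; rewrite exprfctE /GRing.scale /=; ring.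
  have di : is_derive x 1 (fun y : R => y^-1) (- x ^- 2).
    have := @is_deriveV R id x 1 1 xn0 (is_derive_id _ _).
    by rewrite /GRing.scale /= mulr1.
  apply: (@near_eq_is_derive _ _ _ (h \o (fun y : R => y^-1))).
    near=> y; rewrite /flat /h /= ifT //; near: y; exact: lt_nbhsr.
  have := is_derive1_comp (dh x^-1) di; move/is_derive_eq; apply.
  rewrite /flat x0; rewrite -exprVn; move: (x^-1) => y {di}.
  by case: k {h dh} => [|k] /=; rewrite !exprS !expr0; ring.
- have -> : flat k.+2 0 - k%:R * flat k.+1 0 = 0 :> R.
    by rewrite /flat ltxx mulr0 subr0.
  suff H : h^-1 *: ((flat k \o shift 0) (h *: (1:R)) - flat k 0) @[h --> 0^'] --> (0:R).
    apply: DeriveDef; first by apply/cvg_ex; exists 0.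
    by apply: cvg_lim H; exact: Rhausdorff.
  apply/cvgr0Pnorm_le => e e0.
  have K0 : 0 < k.+2`!%:R :> R by rewrite ltr0n fact_gt0.
  near=> y.
  have y0 : y != 0 by near: y; exact: nbhs_dnbhs_neq.
  have -> : y^-1 *: ((flat k \o shift 0) (y *: (1:R)) - flat k 0) = flat k.+1 y.
    rewrite /flat /= ltxx subr0 addr0 /GRing.scale /= mulr1.
    by case: ifP => // _; rewrite ?mulr0 // exprS mulrA.
  apply: le_trans (flat_le _ _) _; rewrite mulrC -ler_pdivlMr //.
  near: y; apply: dnbhs0_le; exact: divr_gt0.
Unshelve. all: by end_near. Qed.

Definition smooth_closed (P : (R -> R) -> Prop) := forall f, P f ->
  exists2 df, P df & forall x, is_derive x 1 f (df x).

Lemma is_derive_derive1 (f df : R -> R) :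
  (forall x, is_derive x 1 f (df x)) -> f^`()%classic = df.
Proof. by move=> h; apply/funext => x; rewrite derive1E; have [_ ->] := h x. Qed.

Lemma smooth_closedP P f : smooth_closed P -> P f -> smooth f.
Proof.
move=> cP Pf n; have : P (derive1n n f).
  elim: n => [//|n IH]; have [df Pdf /is_derive_derive1 h] := cP _ IH.
  by rewrite derive1nS h.
move: (derive1n n f) => g Pg x; have [dg _ h] := cP _ Pg.
by have [] := h x.
Qed.

Lemma smooth_primitive (f g : R -> R) :
  (forall x, is_derive x 1 f (g x)) -> smooth g -> smooth f.
Proof.
move=> fg sg [|n] x; first by have [] := fg x.
by rewrite derive1Sn (is_derive_derive1 fg); exact: sg.
Qed.

Lemma smooth_cst c : smooth (cst c : R -> R).
Proof.
apply: (@smooth_closedP (fun f => exists c, f = cst c)); last by exists c.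
by move=> _ [d ->]; exists (cst 0); [exists 0|move=> x; exact: is_derive_cst].
Qed.

(** Stable under differentiation, translation and linear combination, which gives at
once the smoothness of bumps and of the combinations of their translates. *)
Inductive flat_span : (R -> R) -> Prop :=
| flat_term j k s t : flat_span (fun x => flat j (x - s) * flat k (t - x))
| flat_lin c f g : flat_span f -> flat_span g -> flat_span (fun x => c * f x + g x).

Lemma smooth_closed_flat_span : smooth_closed flat_span.
Proof.
move=> f; elim=> [j k s t|c {}f g _ [df Pf hf] _ [dg Pg hg]]; last first.
  exists (fun x => c * df x + dg x); first exact: flat_lin.
  move=> x; have := is_deriveD (is_deriveZ c (hf x)) (hg x).
  by [].
exists (fun x => 1 * (flat j.+2 (x - s) * flat k (t - x)) +
  ((- j%:R) * (flat j.+1 (x - s) * flat k (t - x)) +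
  ((- 1) * (flat j (x - s) * flat k.+2 (t - x)) +
  ((k%:R - 1) * (flat j (x - s) * flat k.+1 (t - x)) +
   (flat j (x - s) * flat k.+1 (t - x)))))).
  by do 4 (apply: flat_lin; [exact: flat_term|]); exact: flat_term.
move=> x.
have d1 : is_derive x 1 (fun x => x - s) 1.
  by have := is_deriveB (is_derive_id x (1:R)) (is_derive_cst s x (1:R)); rewrite subr0.
have d2 : is_derive x 1 (fun x => t - x) (- 1).
  by have := is_deriveB (is_derive_cst t x (1:R)) (is_derive_id x (1:R)); rewrite sub0r.
have := is_deriveM
  (@is_derive1_comp R (flat j) (fun y => y - s) x _ _ (is_derive_flat j (x - s)) d1)
  (@is_derive1_comp R (flat k) (fun y => t - y) x _ _ (is_derive_flat k (t - x)) d2).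
by move/is_derive_eq; apply; rewrite /GRing.scale /=; ring.
Qed.

Definition bump s t x := flat 0 (x - s) * flat 0 (t - x).

Lemma flat_ge0 k x : 0 <= flat k x.
Proof.
rewrite /flat; case: ltP => // x0; rewrite mulr_ge0 ?expR_ge0 // exprn_ge0 //.
by rewrite invr_ge0 ltW.
Qed.

Lemma flat_eq0 k x : x <= 0 -> flat k x = 0.
Proof. by rewrite /flat ltNge => ->. Qed.

Lemma bump_ge0 s t x : 0 <= bump s t x.
Proof. by rewrite mulr_ge0 // flat_ge0. Qed.

Lemma bump_gt0 s t x : s < x < t -> 0 < bump s t x.
Proof.
move=> /andP[sx xt]; rewrite /bump /flat !subr_gt0 sx xt !expr0 !mul1r.
by rewrite mulr_gt0 // expR_gt0.
Qed.

Lemma bump_eq0 s t x : ~~ (s < x < t) -> bump s t x = 0.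
Proof.
rewrite negb_and -!leNgt /bump => /orP[h|h].
  by rewrite flat_eq0 ?mul0r // subr_le0.
by rewrite mulrC flat_eq0 ?mul0r // subr_le0.
Qed.

Lemma is_derive_continuous (f df : R -> R) :
  (forall x, is_derive x 1 f (df x)) -> continuous f.
Proof.
move=> h x; apply: differentiable_continuous; apply/derivable1_diffP.
by have [] := h x.
Qed.

Lemma continuous_bump s t : continuous (bump s t).
Proof.
have [df _ h] := smooth_closed_flat_span (flat_term 0 0 s t).
exact: is_derive_continuous h.
Qed.

Definition primitive (f : R -> R) x : R :=
  \int[lebesgue_measure]_(y in `]-oo, x]) f y.

Lemma integrable_left (f : R -> R) s x : continuous f ->
  (forall y, y <= s -> f y = 0) ->
  lebesgue_measure.-integrable `]-oo, x] (EFin \o f).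
Proof.
move=> cf f0.
have ms : measurable (`[s, x]%classic : set (measurableTypeR R)) by exact: measurable_itv.
have mi : measurable (`]-oo, x]%classic : set (measurableTypeR R)) by exact: measurable_itv.
have : lebesgue_measure.-integrable `[s, x] (EFin \o f).
  apply: continuous_compact_integrable; first exact: segment_compact.
  exact: continuous_subspaceT.
move/(integrable_mkcond _ ms) => h; apply/(integrable_mkcond _ mi).
apply: eq_integrable h => // y _; rewrite !patchE.
rewrite (_ : (y \in `]-oo, x]%classic) = (y <= x)); last first.
  by apply/idP/idP; rewrite inE /= in_itv.
rewrite (_ : (y \in `[s, x]%classic) = (s <= y <= x)); last first.
  by apply/idP/idP; rewrite inE /= in_itv.
case: (leP s y) => //= ys; case: ifP => // _.
by rewrite f0 // ltW.
Qed.

Lemma is_derive_primitive (f : R -> R) s : continuous f ->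
  (forall y, y <= s -> f y = 0) -> forall x, is_derive x 1 (primitive f) (f x).
Proof.
move=> cf f0 x; have x1 : x < x + 1 by rewrite ltrDl.
have [h1 h2] := continuous_FTC1 x1 (integrable_left (x + 1) cf f0) (ltNyr _) (cf x).
by apply: DeriveDef => //; rewrite -derive1E.
Qed.

Lemma primitive_eq0 (f : R -> R) s x : (forall y, y <= s -> f y = 0) -> x <= s ->
  primitive f x = 0.
Proof.
move=> f0 xs; rewrite /primitive (eq_Rintegral _ (g := cst 0)); last first.
  by move=> y; rewrite inE /= in_itv /= => yx; rewrite f0 // (le_trans yx).
by rewrite Rintegral_cst ?mul0r.
Qed.

End smooth_bump.

(** * Smooth ramps, tents and the form of the equation *)

Section ramp.
Context {R : realType}.
Implicit Types (x s t r e : R).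

Lemma derive_mvt (f df : R -> R) (x y : R) : (forall x, is_derive x 1 f (df x)) ->
  x < y -> exists2 c, x < c < y & f y - f x = df c * (y - x).
Proof.
move=> h xy; have cf : {within `[x, y], continuous f}.
  exact/continuous_subspaceT/(is_derive_continuous h).
have [c] := @MVT R f df x y xy (fun z _ => h z) cf.
by rewrite in_itv /=; exists c.
Qed.

Lemma is_derive_le (f df : R -> R) (x y : R) : (forall x, is_derive x 1 f (df x)) ->
  (forall x, 0 <= df x) -> x <= y -> f x <= f y.
Proof.
move=> h d0; rewrite le_eqVlt => /orP[/eqP->//|xy].
have [c _ E] := derive_mvt h xy.
by rewrite -subr_ge0 E mulr_ge0 // subr_ge0 ltW.
Qed.

(** A smooth approximation beta of the ramp max(0, x): beta'' = rho is a normalized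
bump on [0, e], and beta is affine of slope 1 beyond e. A combination of three
translates with vanishing moments of order 0 and 1 then has compact support. *)
Lemma exists_smooth_ramp e : 0 < e -> exists rho F beta : R -> R,
  [/\ flat_span rho, (forall x, 0 <= rho x), (forall x, ~~ (0 < x < e) -> rho x = 0)
    & \int[lebesgue_measure]_x rho x = 1] /\
  [/\ (forall x, is_derive x 1 F (rho x)), (forall x, is_derive x 1 beta (F x)),
    (forall x, 0 <= Num.max 0 x - beta x <= e), (forall x, x <= 0 -> beta x = 0)
    & exists K, forall x, e <= x -> beta x = x + K].
Proof.
move=> e0; pose b : R -> R := bump 0 e.
have bl y : y <= 0 -> b y = 0 by move=> y0; apply: bump_eq0; rewrite ltNge y0.
have cb : continuous b by exact: continuous_bump.
have dP := is_derive_primitive cb bl.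
have P0 : primitive b 0 = 0 by exact: primitive_eq0 bl (lexx _).
pose k := primitive b e.
have k0 : 0 < k.
  have [c] := derive_mvt dP e0; rewrite P0 !subr0 -/k => ce ->.
  by rewrite mulr_gt0 // bump_gt0.
pose rho x := (k^-1 - 1) * b x + b x.
have sr : flat_span rho by apply: flat_lin; exact: flat_term.
have rhoE x : rho x = k^-1 * b x by rewrite /rho; ring.
have rho0 x : 0 <= rho x by rewrite rhoE mulr_ge0 ?invr_ge0 ?(ltW k0) // bump_ge0.
have rhoz x : ~~ (0 < x < e) -> rho x = 0 by move=> h; rewrite rhoE /b bump_eq0 // mulr0.
have rl y : y <= 0 -> rho y = 0 by move=> y0; apply: rhoz; rewrite ltNge y0.
have cr : continuous rho.
  by have [df _ h] := smooth_closed_flat_span sr; exact: is_derive_continuous h.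
have dF := is_derive_primitive cr rl; set F := primitive rho in dF.
have F0 : F 0 = 0 by exact: primitive_eq0 rl (lexx _).
have full (g : R -> R) x : (forall y, ~~ (0 < y < e) -> g y = 0) -> e <= x ->
    \int[lebesgue_measure]_y g y = primitive g x.
  move=> gz ex; rewrite /primitive [RHS]Rintegral_mkcond; congr Rintegral.
  apply/funext => y; rewrite patchE; case: ifPn => //.
  rewrite notin_setE /= in_itv /= => /negP; rewrite -ltNge => xy.
  by rewrite gz // negb_and -!leNgt (le_trans ex (ltW xy)) orbT.
have intr : \int[lebesgue_measure]_x rho x = 1.
  have ib : lebesgue_measure.-integrable setT (EFin \o b).
    have := integrable_left e cb bl.
    have mi : measurable (`]-oo, e]%classic : set (measurableTypeR R)) by exact: measurable_itv.
    move/(integrable_mkcond _ mi); apply: eq_integrable => // y _.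
    rewrite patchE; case: ifPn => //; rewrite notin_setE /= in_itv /= => /negP.
    rewrite -ltNge => ey; rewrite /b bump_eq0 //.
    by rewrite negb_and -!leNgt (ltW ey) orbT.
  rewrite (_ : rho = fun x => k^-1 * b x); last exact/funext.
  rewrite RintegralZl // (full b e) ?mulVf ?gt_eqF // => y yn; exact: bump_eq0.
have F1 x : e <= x -> F x = 1 by move=> ex; rewrite /F -full.
have Fge x : 0 <= F x.
  have [x0|x0] := leP x 0; first by rewrite /F (primitive_eq0 rl x0).
  by rewrite -F0; apply: is_derive_le dF rho0 (ltW x0).
have Fle x : F x <= 1.
  have [ex|xe] := leP e x; first by rewrite F1.
  by rewrite -(F1 e) //; apply: is_derive_le dF rho0 (ltW xe).
have cF : continuous F by exact: is_derive_continuous dF.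
have Fl y : y <= 0 -> F y = 0 by move=> y0; exact: primitive_eq0 rl y0.
have dB := is_derive_primitive cF Fl; set beta := primitive F in dB.
have B0 x : x <= 0 -> beta x = 0 by exact: primitive_eq0 Fl.
have dD x : is_derive x 1 (fun x => x - beta x) (1 - F x).
  exact: (is_deriveB (is_derive_id x (1:R)) (dB x)).
have D0 x : 0 <= 1 - F x by rewrite subr_ge0.
have Bge x : 0 <= x -> 0 <= beta x.
  by move=> x0; rewrite -(B0 0) //; apply: is_derive_le dB Fge x0.
have BK x : e <= x -> beta x = x + (beta e - e).
  rewrite le_eqVlt => /orP[/eqP<-|ex]; first by rewrite addrC subrK.
  have [c /andP[ec _]] := derive_mvt dD ex; rewrite F1 ?(ltW ec) // subrr mul0r.
  by lra.
exists rho, F, beta; split; first by split.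
split=> //; last by exists (beta e - e).
move=> x; have [x0|x0] := leP x 0.
  by rewrite B0 // subrr lexx ltW.
apply/andP; split.
  have := is_derive_le dD D0 (ltW x0); by rewrite B0 // subrr.
have [xe|ex] := leP x e; first by have := Bge _ (ltW x0); lra.
by rewrite BK ?(ltW ex) //; have := Bge _ (ltW e0); lra.
Qed.

Definition tent s t r x : R :=
  Num.max 0 (Num.min ((x - s) / (t - s)) ((r - x) / (r - t))).

(** A tent is the combination of three ramps with the divided-difference
coefficients. *)
Lemma tentE s t r x : s < t < r -> tent s t r x =
  (t - s)^-1 * Num.max 0 (x - s)
  - ((t - s)^-1 + (r - t)^-1) * Num.max 0 (x - t)
  + (r - t)^-1 * Num.max 0 (x - r).
Proof.
move=> /andP[st tr]; have ts0 : 0 < t - s by rewrite subr_gt0.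
have rt0 : 0 < r - t by rewrite subr_gt0.
have tsn : t - s != 0 by rewrite gt_eqF.
have rtn : r - t != 0 by rewrite gt_eqF.
rewrite /tent; have [xs|sx] := leP x s.
  rewrite !max_l ?subr_le0 ?(le_trans xs) ?(ltW st) ?(ltW (lt_trans st tr)) //; last first.
    by rewrite ge_min pmulr_lle0 ?invr_gt0 // subr_le0 xs.
  by rewrite !mulr0 subrr addr0.
rewrite (max_r (y := x - s)) ?subr_ge0 ?(ltW sx) //.
have [xt|tx] := leP x t.
  rewrite !(max_l (y := x - _)) ?subr_le0 ?(le_trans xt (ltW tr)) // !mulr0 subr0 addr0.
  have h1 : (x - s) / (t - s) <= 1 by rewrite ler_pdivrMr // mul1r; lra.
  have h2 : 1 <= (r - x) / (r - t) by rewrite ler_pdivlMr // mul1r; lra.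
  rewrite min_l ?(le_trans h1) // max_r; first by rewrite mulrC.
  by rewrite divr_ge0 ?subr_ge0 ?(ltW sx) ?(ltW st).
rewrite (max_r (y := x - t)) ?subr_ge0 ?(ltW tx) //.
have h1 : 1 <= (x - s) / (t - s) by rewrite ler_pdivlMr // mul1r; lra.
have h2 : (r - x) / (r - t) <= 1 by rewrite ler_pdivrMr // mul1r; lra.
rewrite min_r ?(le_trans h2) //.
have [xr|rx] := leP x r.
  rewrite max_r ?divr_ge0 ?subr_ge0 ?(ltW tr) // max_l ?subr_le0 //.
  by field; rewrite rtn tsn.
rewrite max_l; last by rewrite pmulr_lle0 ?invr_gt0 // subr_le0 ltW.
rewrite max_r ?subr_ge0 ?(ltW rx) //.
by field; rewrite rtn tsn.
Qed.

Lemma tent_ge0 s t r x : 0 <= tent s t r x.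
Proof. by rewrite /tent le_max lexx. Qed.

Lemma tent_le1 s t r x : s < t < r -> tent s t r x <= 1.
Proof.
move=> /andP[st tr]; rewrite /tent ge_max ler01 ge_min.
by rewrite !ler_pdivrMr ?subr_gt0 // !mul1r; case: (leP x t) => xt; apply/orP; [left|right]; lra.
Qed.

Lemma tent_eq0 s t r x : s < t < r -> ~~ (s < x < r) -> tent s t r x = 0.
Proof.
move=> /andP[st tr]; rewrite negb_and -!leNgt => h; rewrite /tent max_l // ge_min.
by case/orP: h => h; apply/orP; [left|right];
  rewrite pmulr_lle0 ?invr_gt0 ?subr_gt0 // subr_le0.
Qed.

Lemma tent_lipschitz s t r d x y : s < t < r -> d <= t - s -> d <= r - t -> 0 < d ->
  `|tent s t r x - tent s t r y| <= d^-1 * `|x - y|.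
Proof.
move=> /andP[st tr] ds dr d0.
have lin c D : d <= D -> `|(x - c) / D - (y - c) / D| <= d^-1 * `|x - y|.
  move=> dD; rewrite -mulrBl opprB addrA subrK normrM mulrC ler_wpM2r //.
  have D0 : 0 < D by exact: lt_le_trans dD.
  by rewrite gtr0_norm ?invr_gt0 // lef_pV2 ?posrE.
have h1 := lin s _ ds.
have h2 : `|(r - x) / (r - t) - (r - y) / (r - t)| <= d^-1 * `|x - y|.
  apply: le_trans (lin r _ dr); rewrite -normrN le_eqVlt; apply/orP; left.
  by apply/eqP; congr `|_|; ring.
set D := d^-1 * _ in h1 h2 *; have D0 : 0 <= D by exact: le_trans h1.
rewrite /tent; set a := (x - s) / _ in h1 *; set b := (r - x) / _ in h2 *.
set a' := (y - s) / _ in h1 *; set b' := (r - y) / _ in h2 *.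
have hmax p q : `|p - q| <= D -> `|Num.max 0 p - Num.max 0 q| <= D.
  rewrite !ler_norml => /andP[? ?].
  by case: (leP 0 p) => ?; case: (leP 0 q) => ?; apply/andP; split; lra.
apply: hmax; move: h1 h2; rewrite !ler_norml => /andP[? ?] /andP[? ?].
by case: (leP a b) => ?; case: (leP a' b') => ?; apply/andP; split; lra.
Qed.

Lemma lipschitz_continuous (f : R -> R) (K : R) :
  (forall x y, `|f x - f y| <= K * `|x - y|) -> continuous f.
Proof.
move=> fK x; apply/cvgrPdist_le => e e0.
have K0 : 0 < `|K| + 1 by rewrite ltr_wpDl.
apply/nbhs_ballP; exists (e / (`|K| + 1)); first exact: divr_gt0.
move=> y /ltW xy; apply: le_trans (fK x y) _.
apply: (@le_trans _ _ ((`|K| + 1) * `|x - y|)).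
  by rewrite ler_wpM2r // (le_trans (ler_norm K)) // lerDl.
by rewrite mulrC -ler_pdivlMr.
Qed.

Lemma continuous_tent s t r : s < t < r -> continuous (tent s t r).
Proof.
move=> str; have /andP[st tr] := str.
pose d := Num.min (t - s) (r - t).
have d0 : 0 < d by rewrite lt_min !subr_gt0 st.
apply: (@lipschitz_continuous _ d^-1) => x y.
by apply: tent_lipschitz => //; rewrite ge_min lexx ?orbT.
Qed.

End ramp.

Section weak_form.
Context {R : realType}.
Implicit Types (u f : R -> R[i]).

Lemma ccontinuous_bounded u (a b : R) : ccontinuous u ->
  exists2 B, 0 <= B & forall x, a <= x <= b -> normc (u x) <= B.
Proof.
move=> [cr ci]; have [ab|ba] := leP a b; last first.
  by exists 0 => // x /andP[ax xb]; have := lt_le_trans ba (le_trans ax xb); rewrite ltxx.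
have h (g : R -> R) : continuous g -> exists2 B, 0 <= B & forall x, a <= x <= b -> `|g x| <= B.
  move=> cg; have [|c _ hc] := @EVT_max R (fun x => `|g x|) a b ab.
    apply: continuous_subspaceT => x; apply: continuous_comp; first exact: cg.
    exact: norm_continuous.
  by exists `|g c| => // x xab; apply: hc; rewrite in_itv.
have [A A0 hA] := h _ cr; have [B B0 hB] := h _ ci.
exists (A + B); first exact: addr_ge0.
by move=> x xab; apply: le_trans (normc_le_ReIm _) _; apply: lerD; [exact: hA|exact: hB].
Qed.

Lemma ccontinuous_modulus u x e : ccontinuous u -> 0 < e ->
  exists2 d, 0 < d & forall y, `|x - y| <= d -> normc (u y - u x) <= e.
Proof.
move=> [cr ci] e0; have e20 : 0 < e / 2 by rewrite divr_gt0.
have /cvgrPdist_le/(_ _ e20) := cr x; have /cvgrPdist_le/(_ _ e20) := ci x.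
move=> /nbhs_ballP[d1 /= d10 h1] /nbhs_ballP[d2 /= d20 h2].
have d0 : 0 < Num.min d1 d2 by rewrite lt_min d10.
exists (Num.min d1 d2 / 2); first by rewrite divr_gt0.
move=> y xy; have : `|x - y| < Num.min d1 d2.
  by apply: le_lt_trans xy _; rewrite ltr_pdivrMr // ltr_pMr // ltr1n.
rewrite lt_min => /andP[y1 y2].
have := h1 _ y1; have := h2 _ y2; rewrite /= -ReN -ReD -ImN -ImD normc_distC.
have := normc_le_ReIm (u x - u y); lra.
Qed.

Lemma window (a b : R) : exists L : nat, b <= a + L%:R.
Proof.
exists (Num.truncn `|b - a|).+1; have := truncnS_gt `|b - a|.
have := ler_norm (b - a); lra.
Qed.

Lemma leb_translate f (p : R) a L : ccontinuous f -> supported f a L ->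
  leb_integral (fun x => f (x - p)) = leb_integral f.
Proof.
move=> cf sf; symmetry.
apply: (represented_translate represents_leb _ cf sf) => g b K cg sg.
apply: tends_ext (represents_leb cg sg) => m; apply: eq_bigr => l _.
by rewrite translate_cell !lebc_cell.
Qed.

(** An average against a density is bounded by the values of the function where the
density does not vanish. *)
Lemma leb_weighted_le (g : R -> R[i]) (rho : R -> R) a L S : continuous rho ->
  (forall x, 0 <= rho x) -> (forall x, ~~ (a < x <= a + L%:R) -> rho x = 0) ->
  ccontinuous g -> (forall x, rho x != 0 -> normc (g x) <= S) -> 0 <= S ->
  normc (leb_integral (fun x => g x * (rho x)%:C)) <=
    S * normc (leb_integral (fun x => (rho x)%:C)).
Proof.
move=> cr r0 rz cg gS S0.
have crc : ccontinuous (fun x => (rho x)%:C) by exact: ccontinuous_real.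
have src : supported (fun x => (rho x)%:C) a L by move=> x /rz ->.
have t1 := represents_leb crc src.
have t2 := represents_leb (ccontinuousM cg crc) (supportedMr g src).
apply: (@ler_archi _ _ _ (S + 1)) => e e0.
have [M hM] := t1 _ e0; have [N hN] := t2 _ e0.
have := hM _ (leq_maxl M N); have := hN _ (leq_maxr M N); set m := maxn M N.
set X := leb_integral _; set Y := leb_integral _ => hX hY.
set rX := rsum _ _ _ _ _ in hX; set rY := rsum _ _ _ _ _ in hY.
have le1 : normc rX <= S * normc rY.
  have -> : normc rY = \sum_(l < L * m.+1) rho (node a m l) * m.+1%:R^-1.
    rewrite -[RHS]ger0_norm; last by apply: sumr_ge0 => l _; rewrite mulr_ge0 // invr_ge0.
    rewrite -normcR /rY /rsum rmorph_sum /=; congr normc; apply: eq_bigr => l _.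
    by rewrite lebc_cell -rmorphM.
  rewrite mulr_sumr; apply: le_trans (normc_sum _ _ _) _; apply: ler_sum => l _.
  rewrite lebc_cell !normcM !normcR !ger0_norm ?invr_ge0 // -mulrA.
  have [->|rn] := eqVneq (rho (node a m l)) 0; first by rewrite !mul0r !mulr0.
  by rewrite ler_wpM2r ?mulr_ge0 ?invr_ge0 // gS.
have hX' : normc X <= normc rX + e.
  by have := normcD_le (X - rX) rX; rewrite subrK; lra.
have hY' : normc rY <= normc Y + e.
  by have := normcD_le (rY - Y) Y; rewrite subrK normc_distC; lra.
have := ler_wpM2l S0 hY'; lra.
Qed.

(** The integral of f against mu - z dx. *)
Definition schroedinger_form (mu : local_measure R) (z : R[i]) f : R[i] :=
  lm_integral mu f - z * leb_integral f.

Definition shifted_measure (mu : local_measure R) (z : R[i]) (B : set R) : R[i] :=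
  mu B - z * lebc B.

Lemma represents_form mu z :
  represents (shifted_measure mu z) (schroedinger_form mu z).
Proof. exact: represents_sub (represents_lm mu) represents_leb. Qed.

Lemma variation_form mu z (a : R) L m : loc_unif mu ->
  \sum_(l < L * m.+1) normc (shifted_measure mu z (cell a m l)) <=
    L%:R * (fine (unif_norm mu) + normc z).
Proof.
move=> h; rewrite mulrDr.
apply: (@le_trans _ _ (\sum_(l < L * m.+1) (normc (mu (cell a m l)) + normc z * m.+1%:R^-1))).
  apply: ler_sum => l _; apply: le_trans (normcB _ _) _; rewrite lerD2l normcM lebc_cell normcR.
  by rewrite ger0_norm // invr_ge0.
rewrite big_split /=; apply: lerD; first exact: variation_lm.
rewrite sumr_const card_ord -[leLHS]mulr_natr natrM le_eqVlt; apply/orP; left.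
have : m.+1%:R != 0 :> R by rewrite pnatr_eq0.
by move: (m.+1%:R) => k k0; apply/eqP; field.
Qed.

End weak_form.

(** * The three-point identity *)

Section tent_identity.
Context {R : realType}.
Implicit Types (u f : R -> R[i]) (rho : R -> R).

Lemma flat_span_shift (f : R -> R) (p : R) : flat_span f -> flat_span (fun x => f (x - p)).
Proof.
elim=> [j k s t|c {}f g _ hf _ hg]; last exact: flat_lin hf hg.
have -> : (fun x : R => flat j (x - p - s) * flat k (t - (x - p))) =
          (fun x => flat j (x - (p + s)) * flat k ((t + p) - x)).
  by apply/funext => x; congr (flat _ _ * flat _ _); ring.
exact: flat_term.
Qed.

Lemma flat_span_continuous (f : R -> R) : flat_span f -> continuous f.
Proof.
by move=> /smooth_closed_flat_span[df _ h]; exact: is_derive_continuous h.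
Qed.

Lemma is_derive_shift (f df : R -> R) (p x : R) :
  (forall y : R, is_derive y 1 f (df y)) ->
  is_derive x 1 (fun y => f (y - p)) (df (x - p)).
Proof.
move=> h; have d1 : is_derive x 1 (fun y : R => y - p) 1.
  by have := is_deriveB (is_derive_id x (1:R)) (is_derive_cst p x (1:R)); rewrite subr0.
by have := @is_derive1_comp R f (fun y => y - p) x _ _ (h (x - p)) d1; rewrite mulr1.
Qed.

Lemma mollified_value u rho (x0 e eta : R) : ccontinuous u -> continuous rho ->
  (forall x, 0 <= rho x) -> (forall x, ~~ (0 < x < e) -> rho x = 0) ->
  \int[lebesgue_measure]_x rho x = 1 -> 0 <= eta ->
  (forall y, `|x0 - y| <= e -> normc (u y - u x0) <= eta) ->
  normc (leb_integral (fun x => u x * (rho (x - x0))%:C) - u x0) <= eta.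
Proof.
move=> cu cr r0 rz r1 eta0 ue.
have [L eL] := window 0 e; rewrite add0r in eL.
have rz' x : ~~ (0 < x <= 0 + L%:R) -> rho x = 0.
  move=> h; apply: rz; apply: contra h => /andP[x1 x2]; rewrite x1 add0r /=.
  exact: le_trans (ltW x2) eL.
have crc : ccontinuous (fun x => (rho x)%:C) by exact: ccontinuous_real.
have src : supported (fun x => (rho x)%:C) 0 L by move=> x /rz' ->.
have lr : leb_integral (fun x => (rho x)%:C) = 1.
  rewrite /leb_integral /= r1 /Rintegral (_ : (\int[_]_x _)%E = 0%E) //.
  by apply: integral0_eq.
have lr0 := leb_translate x0 crc src; rewrite lr in lr0.
have cr0 : ccontinuous (fun x => (rho (x - x0))%:C) := ccontinuous_shift (- x0) crc.
have sr0 : supported (fun x => (rho (x - x0))%:C) x0 L.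
  move=> x h; rewrite rz' // add0r; apply: contra h => /andP[h1 h2].
  by apply/andP; split; lra.
have cc := @ccontinuous_cst R (u x0).
have -> : leb_integral (fun x => u x * (rho (x - x0))%:C) - u x0 =
    leb_integral (fun x => (u x - u x0) * (rho (x - x0))%:C).
  rewrite -[X in _ - X]mulr1 -lr0.
  rewrite -(representedZ represents_leb (u x0) cr0 sr0).
  rewrite -(representedB represents_leb (ccontinuousM cu cr0) (supportedMr u sr0)
     (ccontinuousM cc cr0) (supportedMr _ sr0)).
  by congr leb_integral; apply/funext => x; rewrite mulrBl.
have cd : ccontinuous (fun x => u x - u x0).
  by apply: ccontinuousD => //; exact: ccontinuous_cst.
have := @leb_weighted_le R (fun x => u x - u x0) (fun x => rho (x - x0)) x0 L eta.
rewrite lr0 normc1 mulr1; apply=> //.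
- move=> x; apply: continuous_comp; last exact: cr.
  by apply: cvgB; [exact: cvg_id|exact: cvg_cst].
- by move=> x /sr0 [].
- move=> x rn; apply: ue; have : 0 < x - x0 < e.
    by apply: contraNT rn => /rz ->.
  by move=> /andP[x1 x2]; rewrite distrC gtr0_norm // ltW.
Qed.

Lemma cderive_real (g dg : R -> R) : (forall x : R, is_derive x 1 g (dg x)) ->
  cderive (fun x => (g x)%:C) = fun x => (dg x)%:C.
Proof.
move=> h; apply/funext => x; rewrite /cderive.
rewrite (_ : _ \o _ = g); last by [].
rewrite (is_derive_derive1 h) (_ : @complex.Im R \o _ = cst 0); last by [].
by rewrite derive1_cst.
Qed.

(** The weak equation with a tent as test function: the second derivative of a tent
is the second divided difference at s, t, r. Tents are not smooth, so they are
approximated by combinations of smooth ramps; the second derivatives of these are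
combinations of bumps, against which u is averaged near s, t and r. *)
Lemma tent_identity (mu : local_measure R) u z (s t r : R) : loc_unif mu ->
  schroedinger mu u (fun x => z * u x) -> s < t < r ->
  schroedinger_form mu z (fun x => (tent s t r x)%:C * u x) =
  ((t - s)^-1)%:C * u s - ((t - s)^-1 + (r - t)^-1)%:C * u t + ((r - t)^-1)%:C * u r.
Proof.
move=> muf [_ _ cu weak] str; have /andP[st tr] := str.
set c1 := (t - s)^-1; set c3 := (r - t)^-1.
have c10 : 0 <= c1 by rewrite invr_ge0 subr_ge0 ltW.
have c30 : 0 <= c3 by rewrite invr_ge0 subr_ge0 ltW.
have k1 : c1 * (t - s) = 1 by rewrite mulVf // gt_eqF // subr_gt0.
have k3 : c3 * (r - t) = 1 by rewrite mulVf // gt_eqF // subr_gt0.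
pose a := s - 1; have [L hL] := window a (r + 2).
have [U U0 hU] := ccontinuous_bounded a (a + L%:R) cu.
pose V := L%:R * (fine (unif_norm mu) + normc z).
have hV m := variation_form z a L m muf.
have V0 : 0 <= V by apply: le_trans (hV 0%N); apply: sumr_ge0 => *; exact: normc_ge0.
set T := _ + _; apply/eqP; rewrite -subr_eq0; apply/eqP/normc_eq0.
pose c := c1 + (c1 + c3) + c3.
apply: (@ler_archi _ _ _ (c * U * V + c)) => eta eta0; rewrite add0r.
have [ds ds0 hs] := ccontinuous_modulus s cu eta0.
have [dt dt0 ht] := ccontinuous_modulus t cu eta0.
have [dr dr0 hr] := ccontinuous_modulus r cu eta0.
pose e := Num.min (Num.min 1 eta) (Num.min ds (Num.min dt dr)).
have e0 : 0 < e by rewrite !lt_min ltr01 eta0 ds0 dt0.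
have e1 : e <= 1 by rewrite !ge_min lexx.
have eeta : e <= eta by rewrite !ge_min lexx orbT.
have es : e <= ds by rewrite !ge_min lexx !orbT.
have et : e <= dt by rewrite !ge_min lexx !orbT.
have er : e <= dr by rewrite !ge_min lexx !orbT.
have [rho [F [beta [[sr r0 rz r1] [dF dB Bm Bl [K BK]]]]]] := exists_smooth_ramp e0.
pose phi x := c1 * beta (x - s) + (- (c1 + c3) * beta (x - t) + c3 * beta (x - r)).
pose phi1 x := c1 * F (x - s) + (- (c1 + c3) * F (x - t) + c3 * F (x - r)).
pose phi2 x := c1 * rho (x - s) + (- (c1 + c3) * rho (x - t)
                + ((c3 - 1) * rho (x - r) + rho (x - r))).
have dcomb (f df : R -> R) : (forall x : R, is_derive x 1 f (df x)) -> forall x : R,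
   is_derive x 1 (fun x => c1 * f (x - s) + (- (c1 + c3) * f (x - t) + c3 * f (x - r)))
     (c1 * df (x - s) + (- (c1 + c3) * df (x - t) + c3 * df (x - r))).
  move=> h x; exact: (is_deriveD (is_deriveZ c1 (is_derive_shift s x h))
    (is_deriveD (is_deriveZ (- (c1 + c3)) (is_derive_shift t x h))
                (is_deriveZ c3 (is_derive_shift r x h)))).
have dphi : forall x : R, is_derive x 1 phi (phi1 x) by exact: dcomb dB.
have dphi1 (x : R) : is_derive x 1 phi1 (phi2 x).
  have := dcomb _ _ dF x; move/is_derive_eq; apply; rewrite /phi2; ring.
have sp2 : flat_span phi2.
  by do 3 (apply: flat_lin; [exact: flat_span_shift|]); exact: flat_span_shift.
have sphi : smooth phi.
  apply: smooth_primitive dphi _; apply: smooth_primitive dphi1 _.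
  exact: smooth_closedP smooth_closed_flat_span sp2.
have cphi : continuous phi by exact: is_derive_continuous dphi.
have phil x : x <= s -> phi x = 0.
  by move=> xs; rewrite /phi !Bl ?mulr0 ?addr0 //; lra.
have phir x : r + 1 <= x -> phi x = 0.
  move=> rx; have [h1 [h2 h3]] : 1 <= x - s /\ 1 <= x - t /\ 1 <= x - r by lra.
  rewrite /phi !BK ?(le_trans e1) //.
  transitivity (c1 * (t - s) - c3 * (r - t)); first by ring.
  by rewrite k1 k3 subrr.
have phiz : supported (fun x => (phi x)%:C) a L.
  move=> x; rewrite negb_and -leNgt -ltNge /a => /orP[h|h].
    by rewrite phil //; lra.
  by rewrite phir //; move: hL; rewrite /a; lra.
have tentz : supported (fun x => (tent s t r x)%:C) a L.
  move=> x h; rewrite tent_eq0 //; apply: contra h => /andP[h1 h2].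
  by apply/andP; split; move: hL; rewrite /a; lra.
have cpC : ccontinuous (fun x => (phi x)%:C) by exact: ccontinuous_real.
have ctC : ccontinuous (fun x => (tent s t r x)%:C).
  by apply: ccontinuous_real; exact: continuous_tent.
have phit x : `|tent s t r x - phi x| <= c * e.
  rewrite tentE // -/c1 -/c3 /phi.
  have := Bm (x - s); have := Bm (x - t); have := Bm (x - r).
  set m1 := Num.max _ _; set m2 := Num.max _ _; set m3 := Num.max _ _.
  move=> /andP[p1 p2] /andP[p3 p4] /andP[p5 p6].
  have -> : c1 * m3 - (c1 + c3) * m2 + c3 * m1 -
    (c1 * beta (x - s) + (- (c1 + c3) * beta (x - t) + c3 * beta (x - r))) =
    c1 * (m3 - beta (x - s)) - (c1 + c3) * (m2 - beta (x - t)) + c3 * (m1 - beta (x - r)) by ring.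
  have q1 := ler_wpM2l c10 p6; have q2 := ler_wpM2l c30 p2.
  have q3 := ler_wpM2l (addr_ge0 c10 c30) p4.
  have q4 := mulr_ge0 c10 p5; have q5 := mulr_ge0 c30 p1.
  have q6 := mulr_ge0 (addr_ge0 c10 c30) p3.
  by rewrite ler_norml /c; apply/andP; split; lra.
have tphi : test_function (fun x => (phi x)%:C).
  split; [exact: sphi|exact: smooth_cst|].
  apply: (subclosed_compact _ (@segment_compact _ s (r + 1))); first exact: closed_closure.
  rewrite /spt closureE => x; apply; split; first exact: itv_closed.
  move=> y /=; apply: contraNP => /negP; rewrite in_itv /= negb_and -!ltNge => /orP[h|h].
    by rewrite phil // ltW.
  by rewrite phir // ltW.
have Jphi : schroedinger_form mu z (fun x => (phi x)%:C * u x) =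
    leb_integral (fun x => u x * (phi2 x)%:C).
  have := weak _ tphi; rewrite (cderive_real dphi) (cderive_real dphi1).
  have -> : (fun x => z * u x * (phi x)%:C) = (fun x => z * ((phi x)%:C * u x)).
    by apply/funext => x; rewrite mulrAC -mulrA.
  have -> : (fun x => u x * (phi x)%:C) = (fun x => (phi x)%:C * u x).
    by apply/funext => x; rewrite mulrC.
  rewrite (representedZ represents_leb z (ccontinuousM cpC cu) (supportedMl u phiz)).
  by rewrite /schroedinger_form => ->; ring.
have crho : continuous rho := flat_span_continuous sr.
have M1 := mollified_value cu crho r0 rz r1 (ltW eta0) (fun y h => hs y (le_trans h es)).
have M2 := mollified_value cu crho r0 rz r1 (ltW eta0) (fun y h => ht y (le_trans h et)).
have M3 := mollified_value cu crho r0 rz r1 (ltW eta0) (fun y h => hr y (le_trans h er)).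
have crx x0 : ccontinuous (fun x => u x * (rho (x - x0))%:C).
  apply: ccontinuousM => //; apply: (@ccontinuous_shift R (fun x => (rho x)%:C) (- x0)).
  exact: ccontinuous_real.
have srx x0 : s <= x0 -> x0 <= r -> supported (fun x => u x * (rho (x - x0))%:C) a L.
  move=> sx xr; apply: supportedMr => x h; rewrite rz //.
  apply: contra h => /andP[h1 h2]; apply/andP; split; move: hL; rewrite /a; lra.
have Lphi2 : leb_integral (fun x => u x * (phi2 x)%:C) =
   c1%:C * leb_integral (fun x => u x * (rho (x - s))%:C)
   - (c1 + c3)%:C * leb_integral (fun x => u x * (rho (x - t))%:C)
   + c3%:C * leb_integral (fun x => u x * (rho (x - r))%:C).
  pose x0 (i : 'I_3) := [:: s; t; r]`_i.
  pose cc (i : 'I_3) := [:: c1%:C; - (c1 + c3)%:C; c3%:C]`_i.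
  have := @represented_sum R _ _ represents_leb 'I_3 (index_enum _) cc
    (fun i x => u x * (rho (x - x0 i))%:C) a L (fun i => crx _).
  rewrite !big_ord_recl !big_ord0 /cc /x0 /= addr0 mulNr addrA => <-.
    congr leb_integral; apply/funext => x; rewrite !big_ord_recl !big_ord0 /= /phi2.
    rewrite !rmorphD !rmorphM !rmorphN !rmorphB /= !rmorphD rmorph1; ring.
  by case=> -[|[|[|//]]] h; apply: srx => /=; lra.
have D1 : normc (schroedinger_form mu z (fun x => (tent s t r x)%:C * u x)
     - schroedinger_form mu z (fun x => (phi x)%:C * u x)) <= c * e * U * V.
  have rf := represents_form mu z.
  rewrite -(representedB rf (ccontinuousM ctC cu) (supportedMl u tentz)
     (ccontinuousM cpC cu) (supportedMl u phiz)).
  have c0 : 0 <= c by rewrite /c !addr_ge0.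
  apply: (represented_normc_le rf hV).
  - exact: mulr_ge0 (mulr_ge0 c0 (ltW e0)) U0.
  - apply: ccontinuousD; first exact: ccontinuousM.
    rewrite (_ : (fun x => - _) = fun x => (-1) * ((phi x)%:C * u x)); last first.
      by apply/funext => x; rewrite mulN1r.
    by apply: ccontinuousM; [exact: ccontinuous_cst|exact: ccontinuousM].
  - by move=> x h; rewrite /= tentz // phiz // !mul0r subrr.
  - move=> x; rewrite -mulrBl -rmorphB normcM normcR.
    have [h|h] := boolP (a < x <= a + L%:R); last first.
      have [[->] [->]] := (tentz _ h, phiz _ h).
      by rewrite subrr normr0 mul0r; exact: mulr_ge0 (mulr_ge0 c0 (ltW e0)) U0.
    apply: ler_pM; rewrite ?normc_ge0 //; apply: hU.
    by case/andP: h => h1 ->; rewrite ltW.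
rewrite Jphi Lphi2 in D1.
set J := schroedinger_form mu z _ in D1 *.
set Is := leb_integral _ in M1 D1; set It := leb_integral _ in M2 D1.
set Ir := leb_integral _ in M3 D1.
have -> : J - T = (J - (c1%:C * Is - (c1 + c3)%:C * It + c3%:C * Ir))
   + (c1%:C * (Is - u s) - (c1 + c3)%:C * (It - u t) + c3%:C * (Ir - u r)).
  by rewrite /T; ring.
apply: le_trans (normcD_le _ _) _.
have N1 := ler_wpM2l c10 M1; have N3 := ler_wpM2l c30 M3.
have N2 := ler_wpM2l (addr_ge0 c10 c30) M2.
have P1 : normc (c1%:C * (Is - u s) - (c1 + c3)%:C * (It - u t) + c3%:C * (Ir - u r)) <= c * eta.
  apply: le_trans (normcD_le _ _) _; have := normcB (c1%:C * (Is - u s)) ((c1 + c3)%:C * (It - u t)).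
  by rewrite !normcM !normcR !ger0_norm ?addr_ge0 // /c; lra.
have P2 : c * e * U * V <= c * U * V * eta.
  have -> : c * e * U * V = c * U * V * e by ring.
  have c0 : 0 <= c by rewrite /c !addr_ge0.
  by rewrite ler_wpM2l // (mulr_ge0 (mulr_ge0 c0 U0) V0).
by rewrite mulrDl; apply: lerD => //; exact: le_trans D1 P2.
Qed.

End tent_identity.

(** * Eigenfunctions: decay, Lipschitz bound, unique continuation *)

Section halving.
Context {R : realType}.

(** Absorption: a bound B for g improves to A + B / 2, and iterating it leads to
2 A. *)
Lemma halving (T : Type) (D : T -> Prop) (g : T -> R) (A B0 : R) : 0 <= A ->
  0 <= B0 -> (forall t, D t -> g t <= B0) ->
  (forall B, 0 <= B -> (forall t, D t -> g t <= B) -> forall t, D t -> g t <= A + B / 2) ->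
  forall t, D t -> g t <= 2 * A.
Proof.
move=> A0 B00 h0 step t Dt.
have H n : forall t, D t -> g t <= 2 * A + B0 / n.+1%:R.
  elim: n => [|n IH].
    move=> x Dx; apply: le_trans (h0 _ Dx) _; rewrite divr1 lerDr mulr_ge0 //.
  move=> x Dx; have p0 : 0 <= 2 * A + B0 / n.+1%:R.
    by rewrite addr_ge0 ?mulr_ge0 // divr_ge0.
  apply: le_trans (step _ p0 IH _ Dx) _.
  have -> : A + (2 * A + B0 / n.+1%:R) / 2 = 2 * A + B0 * (n.+1%:R^-1 / 2) by move: (_^-1) => v; field.
  rewrite lerD2l ler_wpM2l // -invfM lef_pV2 ?posrE ?mulr_gt0 //.
  by rewrite -natrM ler_nat muln2 -addnn addSn addnS ltnS leq_addr.
apply: (@ler_archi _ _ _ B0) => e e0.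
have [M hM] := natSinv_le e0; apply: le_trans (H M _ Dt) _.
by rewrite lerD2l ler_wpM2l // hM.
Qed.

End halving.

Section solution.
Context {R : realType} (mu : local_measure R) (z : R[i]) (u : R -> R[i]).
Hypotheses (muf : loc_unif mu) (su : schroedinger mu u (fun x => z * u x)).
Implicit Types (s t r x y a b : R).

Let Om := fine (unif_norm mu) + normc z.
Let J := schroedinger_form mu z.

Lemma Om_ge0 : 0 <= Om.
Proof.
have := variation_form z 0 1 0 muf; rewrite mul1r; apply: le_trans.
by apply: sumr_ge0 => *; exact: normc_ge0.
Qed.

Lemma solution_continuous : ccontinuous u.
Proof. by case: su. Qed.

Lemma tent_supported s t r L : s < t < r -> r <= s + L%:R ->
  supported (fun x => (tent s t r x)%:C : R[i]) s L.
Proof.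
move=> str rL x h; rewrite tent_eq0 //; apply: contra h => /andP[-> /ltW h2].
exact: le_trans h2 rL.
Qed.

Lemma ccontinuous_tent s t r : s < t < r -> ccontinuous (fun x => (tent s t r x)%:C : R[i]).
Proof. by move=> str; apply: ccontinuous_real; exact: continuous_tent. Qed.

Lemma form_tent_le s t r L B : s < t < r -> r <= s + L%:R -> 0 <= B ->
  (forall x, s <= x <= r -> normc (u x) <= B) ->
  normc (J (fun x => (tent s t r x)%:C * u x)) <= B * (L%:R * Om).
Proof.
move=> str rL B0 uB.
apply: (represented_normc_le (represents_form mu z) (fun m => variation_form z s L m muf) B0).
- by apply: ccontinuousM; [exact: ccontinuous_tent|exact: solution_continuous].
- by apply: supportedMl; exact: tent_supported.
move=> x; rewrite normcM normcR ger0_norm ?tent_ge0 //.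
have [h|h] := boolP (s < x < r); last by rewrite tent_eq0 // mul0r.
rewrite -[B]mul1r; apply: ler_pM; rewrite ?tent_ge0 ?normc_ge0 ?tent_le1 //.
by apply: uB; case/andP: h => /ltW -> /ltW ->.
Qed.

Let d := (2 * (Om + 1))^-1.

Let Om1 : 0 < Om + 1. Proof. by rewrite ltr_wpDl // Om_ge0. Qed.
Let d0 : 0 < d. Proof. by rewrite invr_gt0 mulr_gt0. Qed.
Let d12 : d <= 2^-1.
Proof.
rewrite /d lef_pV2 ?posrE ?mulr_gt0 // -[leLHS]mulr1 ler_pM2l // lerDr.
exact: Om_ge0.
Qed.
Let dOm : d * Om <= 2^-1.
Proof.
rewrite /d mulrC ler_pdivrMr ?mulr_gt0 // mulrA mulVf ?mul1r ?lerDl //.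
Qed.

Lemma solution_interpolation s t r : s < t < r ->
  (r - s)%:C * u t = (r - t)%:C * u s + (t - s)%:C * u r
    - ((t - s) * (r - t))%:C * J (fun x => (tent s t r x)%:C * u x).
Proof.
move=> str; have /andP[st tr] := str; rewrite /J tent_identity //.
have n1 : (t - s)%:C != 0 :> R[i] by rewrite eq_complex /= eqxx andbT gt_eqF // subr_gt0.
have n2 : (r - t)%:C != 0 :> R[i] by rewrite eq_complex /= eqxx andbT gt_eqF // subr_gt0.
rewrite (_ : r - s = (r - t) + (t - s)); last by ring.
move: n1 n2; move: (t - s) (r - t) => p q p0 q0.
rewrite !(rmorphD (real_complex R)) !(rmorphM (real_complex R)) !fmorphV /=.
by field; rewrite p0 q0.
Qed.

(** On a short interval the integral term of the interpolation formula is at most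
half the supremum of u, which is absorbed. *)
Lemma solution_between s r A : s <= r <= s + d ->
  normc (u s) <= A -> normc (u r) <= A ->
  forall t, s <= t <= r -> normc (u t) <= 2 * A.
Proof.
move=> /andP[sr rd] us ur; have A0 : 0 <= A by apply: le_trans us; exact: normc_ge0.
have [B0 B00 hB] := ccontinuous_bounded s r solution_continuous.
apply: (halving (D := fun t => s <= t <= r) A0 B00 hB) => B Bge hu t /andP[].
have B20 : 0 <= B / 2 by rewrite divr_ge0.
rewrite le_eqVlt => /orP[/eqP<- _|st]; first by rewrite (le_trans us) // lerDl.
rewrite le_eqVlt => /orP[/eqP->|tr]; first by rewrite (le_trans ur) // lerDl.
have str : s < t < r by rewrite st.
have rs0 : 0 < r - s by rewrite subr_gt0 (lt_trans st).
have r1 : r <= s + 1%:R.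
  by apply: le_trans rd _; rewrite lerD2l (le_trans d12) // invf_le1 // ler1n.
have hJ := form_tent_le str r1 Bge hu; rewrite mul1r in hJ.
rewrite -(ler_pM2l rs0) -{1}(gtr0_norm rs0) -normcR -normcM solution_interpolation //.
apply: le_trans (normcB _ _) _; rewrite normcM normcR.
have h1 : normc ((r - t)%:C * u s + (t - s)%:C * u r) <= (r - s) * A.
  apply: le_trans (normcD_le _ _) _; rewrite !normcM !normcR !gtr0_norm ?subr_gt0 //.
  have -> : (r - s) * A = (r - t) * A + (t - s) * A by ring.
  by apply: lerD; rewrite ler_pM2l // subr_gt0.
have h2 : `|(t - s) * (r - t)| * normc (J (fun x => (tent s t r x)%:C * u x)) <= (r - s) * (B / 2).
  apply: (@le_trans _ _ ((r - s) * d * (B * Om))).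
    apply: ler_pM; rewrite ?normc_ge0 //.
    rewrite ger0_norm; last by rewrite mulr_ge0 // subr_ge0 ltW.
    by apply: ler_pM; rewrite ?subr_ge0 ?(ltW st) ?(ltW tr) //; lra.
  by rewrite -mulrA ler_pM2l // mulrCA ler_wpM2l.
by rewrite [leRHS]mulrDr; apply: lerD.
Qed.

(** By the interpolation formula with two nodes where u vanishes, a bound of u to
the right of b improves by a factor 2. *)
Lemma solution_extend_right a b : a < b -> (forall x, a <= x <= b -> u x = 0) ->
  forall x, a <= x <= b + d -> u x = 0.
Proof.
move=> ab uz x xI; apply: normc_eq0; rewrite -[0](mulr0 2).
have [B0 B00 hB] := ccontinuous_bounded a (b + d) solution_continuous.
apply: (halving (D := fun t => a <= t <= b + d) (lexx 0) B00 hB) xI => B Bge hu t.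
move=> /andP[at_ tb]; rewrite add0r.
have [tb'|bt] := leP t b; first by rewrite uz ?at_ // normc0 divr_ge0.
pose s := Num.max a (b - 2^-1).
have sb : s < b by rewrite gt_max ab ltrBlDr ltrDl invr_gt0 ltr0n.
have as_ : a <= s by rewrite le_max lexx.
have sb2 : b - 2^-1 <= s by rewrite le_max lexx orbT.
have sbt : s < b < t by rewrite sb.
have t1 : t <= s + 1%:R by move: d12; lra.
have hJ : normc (J (fun x => (tent s b t x)%:C * u x)) <= B * (1%:R * Om).
  apply: form_tent_le => // y /andP[y1 y2]; apply: hu.
  by rewrite (le_trans as_ y1) (le_trans y2 tb).
have := solution_interpolation sbt; rewrite (uz b) ?(ltW ab) ?lexx //.
rewrite (uz s) ?as_ ?(ltW sb) // !mulr0 add0r => /esym/eqP; rewrite subr_eq0 => /eqP E.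
have bs0 : 0 < b - s by rewrite subr_gt0.
rewrite -(ler_pM2l bs0) -{1}(gtr0_norm bs0) -normcR -normcM E normcM normcR.
rewrite ger0_norm; last by rewrite mulr_ge0 // subr_ge0 ltW.
rewrite -mulrA ler_pM2l //; apply: (@le_trans _ _ (d * (B * (1 * Om)))).
  by apply: ler_pM; rewrite ?normc_ge0 ?subr_ge0 ?(ltW bt) //; lra.
by rewrite mul1r mulrCA ler_wpM2l.
Qed.

Lemma solution_extend_left a b : a < b -> (forall x, a <= x <= b -> u x = 0) ->
  forall x, a - d <= x <= b -> u x = 0.
Proof.
move=> ab uz x xI; apply: normc_eq0; rewrite -[0](mulr0 2).
have [B0 B00 hB] := ccontinuous_bounded (a - d) b solution_continuous.
apply: (halving (D := fun t => a - d <= t <= b) (lexx 0) B00 hB) xI => B Bge hu t.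
move=> /andP[at_ tb]; rewrite add0r.
have [ta'|ta] := leP a t; first by rewrite uz ?ta' // normc0 divr_ge0.
pose r := Num.min b (a + 2^-1).
have ar : a < r by rewrite lt_min ab ltrDl invr_gt0 ltr0n.
have rb : r <= b by rewrite ge_min lexx.
have ra2 : r <= a + 2^-1 by rewrite ge_min lexx orbT.
have tar : t < a < r by rewrite ta.
have t1 : r <= t + 1%:R by move: d12; lra.
have hJ : normc (J (fun x => (tent t a r x)%:C * u x)) <= B * (1%:R * Om).
  apply: form_tent_le => // y /andP[y1 y2]; apply: hu.
  by rewrite (le_trans at_ y1) (le_trans y2 rb).
have := solution_interpolation tar; rewrite (uz a) ?(ltW ab) ?lexx //.
rewrite (uz r) ?rb ?(ltW ar) // !mulr0 addr0 => /esym/eqP; rewrite subr_eq0 => /eqP E.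
have bs0 : 0 < r - a by rewrite subr_gt0.
rewrite -(ler_pM2l bs0) -{1}(gtr0_norm bs0) -normcR -normcM E normcM normcR.
rewrite ger0_norm; last by rewrite mulr_ge0 // subr_ge0 ltW.
rewrite [(a - t) * _]mulrC -mulrA ler_pM2l //; apply: (@le_trans _ _ (d * (B * (1 * Om)))).
  by apply: ler_pM; rewrite ?normc_ge0 ?subr_ge0 ?(ltW ta) //; lra.
by rewrite mul1r mulrCA ler_wpM2l.
Qed.

Lemma solution_unique_continuation a b : a < b ->
  (forall x, a <= x <= b -> u x = 0) -> forall x, u x = 0.
Proof.
move=> ab uz x.
have H n : forall y, a - n%:R * d <= y <= b + n%:R * d -> u y = 0.
  elim: n => [|n IH]; first by rewrite mul0r subr0 addr0.
  have nd0 : 0 <= n%:R * d by rewrite mulr_ge0 // ltW.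
  have l1 : a - n%:R * d < b + n%:R * d by lra.
  have h1 := solution_extend_right l1 IH.
  have l2 : a - n%:R * d < b + n%:R * d + d by move: d0; lra.
  have h2 := solution_extend_left l2 h1.
  move=> y; rewrite -(natr1 n) mulrDl mul1r => /andP[y1 y2]; apply: h2.
  by apply/andP; split; lra.
have [L hL] := window 0 ((`|x| + `|a| + `|b|) / d).
apply: (H L); move: hL; rewrite add0r ler_pdivrMr // => hL.
have := ler_norm x; have := ler_norm (- x); have := ler_norm a; have := ler_norm (- a).
have := ler_norm b; have := ler_norm (- b); rewrite !normrN.
by move=> ? ? ? ? ? ?; apply/andP; split; lra.
Qed.


(** Chebyshev's inequality. *)
Lemma L2_superlevel (c : R) : 0 < c ->
  let E := [set x | c <= normc (u x)] : set (measurableTypeR R) in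
  measurable E /\ (lebesgue_measure E < +oo)%E.
Proof.
move=> c0 E; have [[mr mi fin] _ [cr ci] _] := su.
pose g x := (normc (u x)) ^+ 2.
have mg : measurable_fun [set: measurableTypeR R] g.
  rewrite (_ : g = fun x => (complex.Re (u x)) ^+ 2 + (complex.Im (u x)) ^+ 2); last first.
    apply/funext => x; rewrite /g; case: (u x) => a b; rewrite /normc sqr_sqrtr //.
    by rewrite addr_ge0 ?sqr_ge0.
  by apply: measurable_funD; exact: measurable_funX.
have EE : E = g @^-1` `[c ^+ 2, +oo[.
  apply/seteqP; split=> x; rewrite /E /= in_itv /= andbT /g;
  by rewrite ler_sqr ?nnegrE ?normc_ge0 ?(ltW c0).
have mE : measurable E.
  by rewrite EE -[X in measurable X]setTI; apply: mg => //; exact: measurable_itv.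
split=> //; have c20 : 0 < c ^+ 2 by rewrite exprn_gt0.
have : ((c ^+ 2)%:E * lebesgue_measure E <= \int[lebesgue_measure]_x (g x)%:E)%E.
  have mgE : measurable_fun [set: measurableTypeR R] (EFin \o g) by exact/measurable_EFinP.
  have mgE' : measurable_fun E (EFin \o g) by exact: measurable_funS mgE.
  have g0 x : [set: measurableTypeR R] x -> (0 <= (g x)%:E)%E.
    by move=> _; rewrite lee_fin sqr_ge0.
  have h1 := ge0_subset_integral lebesgue_measure mE measurableT mgE g0 (@subsetT _ E).
  apply: le_trans h1; rewrite -(integral_cst _ mE); apply: ge0_le_integral => //.
  - by move=> x _; rewrite lee_fin ltW.
  - by move=> x Ex; rewrite lee_fin ler_sqr ?nnegrE ?normc_ge0 ?(ltW c0).
move=> h; have := le_lt_trans h fin; case: (lebesgue_measure E) => [r _||_ //].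
  exact: ltry.
by rewrite gt0_muley ?lte_fin.
Qed.

(** Far out, the set where |u| exceeds eta / 2 has small measure and contains no
interval of length d / 2. Every point lies therefore between two close points
where |u| <= eta / 2. *)
Lemma solution_decay eta : 0 < eta ->
  exists X, forall x, X <= `|x| -> normc (u x) <= eta.
Proof.
move=> eta0; have c0 : 0 < eta / 2 by rewrite divr_gt0.
have [] := L2_superlevel c0; set E := [set x | _] => mE fE.
pose A (n : nat) : set (measurableTypeR R) := E `&` [set x | n%:R <= `|x|].
have mA n : measurable (A n).
  apply: measurableI => //.
  rewrite (_ : [set x | _] = `[n%:R, +oo[%classic `|` `]-oo, (- n%:R)]%classic); last first.
    apply/seteqP; split=> x /=; rewrite !in_itv /= andbT lerNr ler_normr.
      by case/orP; [left|right].
    by case=> ->; rewrite ?orbT.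
  by apply: measurableU; exact: measurable_itv.
have hA : lebesgue_measure (A n) @[n --> \oo] --> lebesgue_measure (\bigcap_n A n).
  apply: nonincreasing_cvg_mu => //.
  - apply: le_lt_trans fE; apply: le_measure; rewrite ?inE //; exact: subIsetl.
  - exact: bigcapT_measurable.
  - move=> m n mn; apply/subsetPset => x [Ex /= xn]; split=> //=.
    by apply: le_trans xn; rewrite ler_nat.
have I0 : \bigcap_n A n = set0.
  apply/seteqP; split=> // x /(_ (Num.truncn `|x|).+1 I) [_ /=].
  by rewrite leNgt truncnS_gt.
rewrite I0 measure0 in hA.
have d20 : 0 < d / 2 by rewrite divr_gt0.
have [N hN] : exists N, (lebesgue_measure (A N) < (d / 2)%:E)%E.
  have : \forall n \near \oo, (lebesgue_measure (A n) < (d / 2)%:E)%E.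
    apply: (hA [set y | (y < (d / 2)%:E)%E]); apply: open_nbhs_nbhs; split.
      exact: open_ereal_lt_ereal.
    by rewrite /= lte_fin.
  by move=> /filter_ex[N]; exists N.
have point x : N%:R + d <= `|x| -> exists2 s, x <= s <= x + d / 2 & normc (u s) <= eta / 2.
  move=> xN; apply: contrapT => h; move: hN; apply/negP; rewrite -leNgt.
  have <- : lebesgue_measure (`[x, x + d / 2]%classic : set (measurableTypeR R)) = (d / 2)%:E.
    by rewrite lebesgue_measure_itv /= lte_fin ltrDl d20 -EFinD addrAC subrr add0r.
  apply: le_measure; rewrite ?inE //.
  move=> s /=; rewrite in_itv /= => /andP[s1 s2]; split.
    rewrite /E /= leNgt; apply/negP => /ltW us; apply: h; exists s => //.
    by rewrite s1.
  have : `|x| <= `|s| + `|x - s| by rewrite addrC -[x in leLHS](subrK s) ler_normD.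
  have : `|x - s| <= d / 2 by rewrite distrC ger0_norm ?subr_ge0 //; lra.
  by rewrite /=; lra.
exists (N%:R + 2 * d) => x xX.
have [r /andP[r1 r2] ur] : exists2 s, x <= s <= x + d / 2 & normc (u s) <= eta / 2.
  by apply: point; move: d0 xX; lra.
have [s /andP[s1 s2] us] : exists2 s, x - d / 2 <= s <= x - d / 2 + d / 2 & normc (u s) <= eta / 2.
  apply: point; have := ler_normD (x - d / 2) (d / 2); rewrite subrK [`|d / 2|]ger0_norm ?(ltW d20) //.
  by move: d0 xX; lra.
rewrite subrK in s2.
have -> : eta = 2 * (eta / 2) by rewrite mulrC divfK.
apply: (@solution_between s r) => //; apply/andP; split=> //; lra.
Qed.

Lemma solution_bounded : exists2 B, 0 <= B & forall x, normc (u x) <= B.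
Proof.
have [X hX] := solution_decay ltr01.
have [B B0 hB] := ccontinuous_bounded (- X) X solution_continuous.
exists (B + 1) => [|x]; first by rewrite addr_ge0.
have [xX|/ltW xX] := leP X `|x|; first by apply: le_trans (hX _ xX) _; rewrite lerDr.
by apply: (@le_trans _ _ B); [apply: hB; rewrite -ler_norml|rewrite lerDl].
Qed.

(** The slope of u on [x, y] differs from its slope on [y, x + 2] by the integral in
the three-point identity, and the latter slope is bounded because its interval is
long. *)
Lemma solution_lipschitz B : 0 <= B -> (forall x, normc (u x) <= B) ->
  forall x y, normc (u x - u y) <= 2 * B * (1 + Om) * `|x - y|.
Proof.
move=> B0 uB; have O0 := Om_ge0.
suff H x y : x < y -> normc (u x - u y) <= 2 * B * (1 + Om) * (y - x).
  move=> x y; have [xy|yx|->] := ltgtP x y.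
  - by rewrite distrC gtr0_norm ?subr_gt0 // H.
  - by rewrite normc_distC gtr0_norm ?subr_gt0 // H.
  - by rewrite !subrr normc0 normr0 mulr0.
move=> xy; have K0 : 0 <= 2 * B * (1 + Om) by rewrite !mulr_ge0 // addr_ge0.
have B20 : 0 <= 2 * B * Om by rewrite !mulr_ge0.
have nxy : normc (u x - u y) <= 2 * B.
  by apply: le_trans (normcB _ _) _; have := uB x; have := uB y; lra.
have [big|small] := leP 1 (y - x).
  apply: le_trans nxy _; apply: (@le_trans _ _ (2 * B * (1 + Om) * 1)); first by lra.
  by rewrite ler_wpM2l.
have str : x < y < x + 2 by rewrite xy /=; lra.
have hJ := @form_tent_le x y (x + 2) 2 B str (lexx _) B0 (fun y _ => uB y).
have := tent_identity muf su str; rewrite -/J; set Jt := J _ in hJ * => E.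
set r := x + 2 in str hJ E *.
have yx0 : 0 < y - x by rewrite subr_gt0.
have ry1 : 1 <= r - y by rewrite /r; lra.
have ry0 : 0 < r - y by apply: lt_le_trans ry1.
have E' : u x - u y = (y - x)%:C * (Jt - ((r - y)^-1)%:C * (u r - u y)).
  rewrite E (rmorphD (real_complex R) (y - x)^-1) /=.
  have k : (y - x)%:C * ((y - x)^-1)%:C = 1 :> R[i].
    by rewrite -(rmorphM (real_complex R)) /= mulfV ?gt_eqF.
  move: ((y - x)%:C) ((y - x)^-1%:C) ((r - y)^-1%:C) k => p q v pq.
  have -> : p * (q * u x - (q + v) * u y + v * u r - v * (u r - u y)) = p * q * (u x - u y) by ring.
  by rewrite pq mul1r.
rewrite E' normcM normcR gtr0_norm // mulrC ler_pM2r //.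
apply: le_trans (normcB _ _) _; rewrite normcM normcR gtr0_norm ?invr_gt0 //.
have : (r - y)^-1 * normc (u r - u y) <= 1 * (2 * B).
  apply: ler_pM; rewrite ?normc_ge0 ?invr_ge0 ?(ltW ry0) ?invf_le1 //.
  by apply: le_trans (normcB _ _) _; have := uB r; have := uB y; lra.
by lra.
Qed.

End solution.

(** * The local norm and interpolation on a grid *)

Section local_norm.
Context {R : realType}.
Implicit Types (f : R -> R[i]) (x y : R).

(** Where g is not differentiable, its derivative takes the value 0 by convention. *)
Lemma derive1_lipschitz (g : R -> R) (K x : R) :
  (forall x y, `|g x - g y| <= K * `|x - y|) -> `|g^`()%classic x| <= K.
Proof.
move=> gK; have K0 : 0 <= K.
  by have := gK 1 0; rewrite subr0 normr1 mulr1; apply: le_trans.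
rewrite /derive1; set F := (X in lim X).
have [cF|/dvgP ->] := pselect (cvg F); last by rewrite /point /= normr0.
have q (h : R) : h != 0 -> `|h^-1 *: (g (h + x) - g x)| <= K.
  move=> h0; rewrite /GRing.scale /= normrM normfV mulrC.
  rewrite ler_pdivrMr ?normr_gt0 //; apply: le_trans (gK _ _) _.
  by rewrite addrK.
rewrite ler_norml; apply/andP; split.
  apply: limr_ge => //; near=> h.
  have /q : h != 0 by near: h; exact: nbhs_dnbhs_neq.
  by rewrite ler_norml => /andP[].
apply: limr_le => //; near=> h.
have /q : h != 0 by near: h; exact: nbhs_dnbhs_neq.
by rewrite ler_norml => /andP[].
Unshelve. all: by end_near. Qed.

Lemma sup_norm_deriv_le1 f : (forall x y, normc (f x - f y) <= 2^-1 * `|x - y|) ->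
  (sup_norm_deriv f <= 1)%E.
Proof.
move=> fL; apply: ess_sup_ler => x; rewrite lee_fin.
apply: le_trans (normc_le_ReIm _) _; rewrite /cderive /=.
have h1 : `|(@complex.Re R \o f)^`()%classic x| <= 2^-1.
  apply: derive1_lipschitz => a b; apply: le_trans (fL a b).
  by rewrite /= -ReN -ReD; exact: normc_Re.
have h2 : `|(@complex.Im R \o f)^`()%classic x| <= 2^-1.
  apply: derive1_lipschitz => a b; apply: le_trans (fL a b).
  by rewrite /= -ImN -ImD; exact: normc_Im.
lra.
Qed.

Lemma lipschitz_ccontinuous f M :
  (forall x y, normc (f x - f y) <= M * `|x - y|) -> ccontinuous f.
Proof.
move=> fM; split; apply: (@lipschitz_continuous R _ M) => a b.
  by rewrite /= -ReN -ReD; apply: le_trans (normc_Re _) (fM a b).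
by rewrite /= -ImN -ImD; apply: le_trans (normc_Im _) (fM a b).
Qed.

(** Sum of the tents centred at the nodes k, k + 1, ... of the grid. *)
Definition clamp (h a : R) (k : nat) x : R :=
  h^-1 * (Num.max 0 (x - (a + k%:R * h - h)) - Num.max 0 (x - (a + k%:R * h))).

Definition grid_tent (h a : R) (k : nat) x : R :=
  tent (a + k%:R * h - h) (a + k%:R * h) (a + k%:R * h + h) x.

Section grid.
Variables (h a : R).
Hypothesis h0 : 0 < h.

Lemma grid_tent_lt k : a + k%:R * h - h < a + k%:R * h < a + k%:R * h + h.
Proof. by rewrite ltrBlDr ltrDl h0. Qed.

Lemma grid_tentE k x : grid_tent h a k x = clamp h a k x - clamp h a k.+1 x.
Proof.
rewrite /grid_tent tentE ?grid_tent_lt // /clamp -(natr1 k).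
have -> : a + (k%:R + 1) * h - h = a + k%:R * h by ring.
have -> : a + (k%:R + 1) * h = a + k%:R * h + h by ring.
have -> : a + k%:R * h - (a + k%:R * h - h) = h by ring.
have -> : a + k%:R * h + h - (a + k%:R * h) = h by ring.
by ring.
Qed.

Lemma clamp_eq1 k x : a + k%:R * h <= x -> clamp h a k x = 1.
Proof.
move=> kx; rewrite /clamp !max_r ?subr_ge0 //; last by move: h0; lra.
by move: (k%:R * h) => v; field; rewrite gt_eqF.
Qed.

Lemma clamp_eq0 k x : x <= a + k%:R * h - h -> clamp h a k x = 0.
Proof.
move=> kx; rewrite /clamp !max_l ?subr_le0 ?subrr ?mulr0 //.
by move: h0; lra.
Qed.

Lemma clamp_mono k x y : x <= y -> clamp h a k x <= clamp h a k y.
Proof.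
move=> xy; rewrite /clamp ler_pM2l ?invr_gt0 //.
move: (a + k%:R * h) => v.
by case: (leP 0 (x - (v - h))) => ?; case: (leP 0 (x - v)) => ?;
  case: (leP 0 (y - (v - h))) => ?; case: (leP 0 (y - v)) => ?; move: h0; lra.
Qed.

Lemma clamp_ge0_le1 k x : 0 <= clamp h a k x <= 1.
Proof.
have [h1|h1] := leP (a + k%:R * h) x; first by rewrite clamp_eq1 // ler01 lexx.
have [h2|h2] := leP x (a + k%:R * h - h); first by rewrite clamp_eq0 // ler01 lexx.
rewrite -{1}(@clamp_eq0 k (a + k%:R * h - h)) // -{2}(@clamp_eq1 k (a + k%:R * h)) //.
by rewrite !clamp_mono ?ltW.
Qed.

Lemma sum_grid_tent i j x : (i <= j)%N ->
  \sum_(i <= k < j) grid_tent h a k x = clamp h a i x - clamp h a j x.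
Proof.
move=> ij; rewrite -opprB -(telescope_sumr (fun k => clamp h a k x) ij) -sumrN.
by apply: eq_bigr => k _; rewrite grid_tentE opprB.
Qed.

Lemma sum_grid_tent_le1 i j x : \sum_(i <= k < j) grid_tent h a k x <= 1.
Proof.
have [ij|ji] := leqP i j; last by rewrite big_geq // ltnW.
rewrite sum_grid_tent //; have /andP[_ h1] := clamp_ge0_le1 i x.
by have /andP[h2 _] := clamp_ge0_le1 j x; lra.
Qed.

Lemma grid_tent_ge0 k x : 0 <= grid_tent h a k x.
Proof. exact: tent_ge0. Qed.

Lemma grid_tent_eq0 k x :
  ~~ (a + k%:R * h - h < x < a + k%:R * h + h) -> grid_tent h a k x = 0.
Proof. by move=> hx; rewrite /grid_tent tent_eq0 ?grid_tent_lt. Qed.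

Lemma ccontinuous_grid_tent k : ccontinuous (fun x => (grid_tent h a k x)%:C : R[i]).
Proof. by apply: ccontinuous_tent; exact: grid_tent_lt. Qed.

(** Summation by parts writes the interpolation in terms of the functions clamp,
which are nondecreasing and add up to a function of slope at most 1 / h. *)
Lemma interpolation_lipschitz (c : nat -> R[i]) m M x y :
  c 0%N = 0 -> c m = 0 -> (forall k, normc (c k.+1 - c k) <= M * h) ->
  normc (\sum_(k < m) c k * (grid_tent h a k x)%:C
         - \sum_(k < m) c k * (grid_tent h a k y)%:C) <= M * `|x - y|.
Proof.
move=> c0 cm cs; wlog xy : x y / x <= y.
  move=> H; have [xy|/ltW yx] := leP x y; first exact: H.
  by rewrite normc_distC distrC H.
have M0 : 0 <= M by rewrite -(pmulr_lge0 _ h0); apply: le_trans (cs 0%N); exact: normc_ge0.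
have E w : \sum_(k < m) c k * (grid_tent h a k w)%:C =
    \sum_(k < m) (c k.+1 - c k) * (clamp h a k.+1 w)%:C.
  have -> : \sum_(k < m) (c k.+1 - c k) * (clamp h a k.+1 w)%:C =
    \sum_(k < m) c k.+1 * (clamp h a k.+1 w)%:C - \sum_(k < m) c k * (clamp h a k.+1 w)%:C.
    by rewrite -sumrB; apply: eq_bigr => k _; rewrite mulrBl.
  have -> : \sum_(k < m) c k.+1 * (clamp h a k.+1 w)%:C = \sum_(k < m) c k * (clamp h a k w)%:C.
    pose F k := c k * (clamp h a k w)%:C.
    have : \sum_(k < m) F k.+1 + F 0%N = \sum_(k < m) F k + F m.
      elim: m {cm} => [|l IH]; first by rewrite !big_ord0.
      by rewrite !big_ord_recr /= addrAC IH addrAC.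
    by rewrite /F c0 cm !mul0r !addr0.
  by rewrite -sumrB; apply: eq_bigr => k _; rewrite -mulrBr grid_tentE (rmorphB (real_complex R)).
rewrite !E -sumrB; apply: le_trans (normc_sum _ _ _) _.
apply: (@le_trans _ _ (\sum_(k < m) M * h * (clamp h a k.+1 y - clamp h a k.+1 x))).
  apply: ler_sum => k _; rewrite -mulrBr -(rmorphB (real_complex R)) normcM normcR.
  by rewrite distrC ger0_norm ?subr_ge0 ?clamp_mono // ler_wpM2r ?subr_ge0 ?clamp_mono.
rewrite -mulr_sumr -mulrA ler_wpM2l // distrC ger0_norm ?subr_ge0 //.
have -> : \sum_(k < m) (clamp h a k.+1 y - clamp h a k.+1 x) =
  h^-1 * ((Num.max 0 (y - a) - Num.max 0 (y - (a + m%:R * h)))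
         - (Num.max 0 (x - a) - Num.max 0 (x - (a + m%:R * h)))).
  elim: m {E cm} => [|l IH]; first by rewrite big_ord0 mul0r addr0 !subrr mulr0.
  rewrite big_ord_recr /= IH /clamp -(natr1 l).
  have -> : a + (l%:R + 1) * h - h = a + l%:R * h by ring.
  by ring.
have av : a <= a + m%:R * h by rewrite lerDl mulr_ge0 // ltW.
rewrite mulVKf ?gt_eqF //; move: (a + m%:R * h) av => v av.
by case: (leP 0 (x - a)) => ?; case: (leP 0 (x - v)) => ?;
  case: (leP 0 (y - a)) => ?; case: (leP 0 (y - v)) => ?; lra.
Qed.

End grid.

Lemma mul_lipschitz f (g : R -> R[i]) M K x y :
  (forall x y, normc (f x - f y) <= K * `|x - y|) -> (forall x, normc (f x) <= 1) ->
  (forall x y, normc (g x - g y) <= M * `|x - y|) -> (forall x, normc (g x) <= M) ->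
  normc (f x * g x - f y * g y) <= (K * M + M) * `|x - y|.
Proof.
move=> fL f1 gL gM; apply: le_trans (normc_mulB _ _ _ _) _.
have h1 := ler_pM (normc_ge0 _) (normc_ge0 _) (fL x y) (gM x).
have h2 := ler_pM (normc_ge0 _) (normc_ge0 _) (f1 y) (gL x y).
by lra.
Qed.

(** A Lipschitz function on [-p, p] is cut by a partition of unity into about 2 p
pieces, each a multiple of a test function of the local norm. *)
Lemma lm_integral_le_local_norm (nu : local_measure R) (p eps M : R) f :
  0 < p -> 0 < M -> (local_norm nu `[(- p)%R, p] <= eps%:E)%E ->
  (forall x y, normc (f x - f y) <= M * `|x - y|) ->
  (forall x, normc (f x) <= M) -> (forall x, ~~ (- p <= x <= p) -> f x = 0) ->
  normc (lm_integral nu f) <= M * (8 * (p + 1) * eps).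
Proof.
move=> p0 M0 le fL fM fz.
have rI := represents_lm nu.
pose K := (Num.truncn (2 * p)).+1.
have pK : 2 * p < K%:R by exact: truncnS_gt.
have Kp : K%:R <= 2 * p + 1.
  by rewrite /K -natr1 lerD2r truncn_le mulr_ge0 // ltW.
pose chi k x : R := grid_tent 1 (- p) k x.
pose piece k x := (4 * M)^-1%:C * ((chi k x)%:C * f x).
have cf := lipschitz_ccontinuous fL.
have ff x : f x = \sum_(k < K.+1) (4 * M)%:C * piece k x.
  have -> : \sum_(k < K.+1) (4 * M)%:C * piece k x = (\sum_(0 <= k < K.+1) chi k x)%:C * f x.
    rewrite big_mkord (rmorph_sum (real_complex R)) mulr_suml; apply: eq_bigr => k _.
    rewrite /piece mulrA -(rmorphM (real_complex R)) mulfV ?mul1r // gt_eqF //.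
    by rewrite mulr_gt0.
  have [xp|xp] := boolP (- p <= x <= p); last by rewrite fz // mulr0.
  move/andP: xp => [x1 x2]; rewrite sum_grid_tent // clamp_eq1 // ?clamp_eq0 //.
  - by rewrite subr0 mul1r.
  - by rewrite -(natr1 K); lra.
  - by rewrite mul0r addr0.
have cchi k : ccontinuous (fun x => (chi k x)%:C : R[i]) by exact: ccontinuous_grid_tent.
have cp k : ccontinuous (piece k).
  apply: ccontinuousM; first exact: ccontinuous_cst.
  exact: ccontinuousM.
have [L hL] := window (- p - 1) p.
have sf : supported f (- p - 1) L.
  by move=> x hx; apply: fz; apply: contra hx => /andP[x1 x2]; apply/andP; split; lra.
have sp k : supported (piece k) (- p - 1) L by do 2 apply: supportedMr.
have -> : lm_integral nu f = \sum_(k < K.+1) (4 * M)%:C * lm_integral nu (piece k).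
  rewrite -(represented_sum rI (index_enum 'I_K.+1) (fun _ => (4 * M)%:C) (fun k => cp k) (fun k => sp k)).
  by congr lm_integral; apply/funext => x; exact: ff.
have piece_le k : normc (lm_integral nu (piece k)) <= eps.
  rewrite -lee_fin; apply: le_trans le; apply: ereal_sup_ubound; exists (piece k) => //.
  have chiL x y : normc ((chi k x)%:C - (chi k y)%:C : R[i]) <= 1 * `|x - y|.
    rewrite -(rmorphB (real_complex R)) normcR -{1}[1]invr1.
    by apply: tent_lipschitz; rewrite ?grid_tent_lt //; lra.
  have chi1 x : normc ((chi k x)%:C : R[i]) <= 1.
    rewrite normcR ger0_norm ?grid_tent_ge0 //; apply: tent_le1; exact: grid_tent_lt.
  have pL x y : normc (piece k x - piece k y) <= 2^-1 * `|x - y|.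
    rewrite /piece -mulrBr normcM normcR gtr0_norm ?invr_gt0 ?mulr_gt0 //.
    have := mul_lipschitz x y chiL chi1 fL fM.
    rewrite mul1r => h; rewrite mulrC ler_pdivrMr ?mulr_gt0 //.
    by apply: le_trans h _; rewrite le_eqVlt; apply/orP; left; apply/eqP; field.
  have sub1 : spt (piece k) `<=` `[- p, p].
    rewrite /spt closureE => x; apply; split; first exact: itv_closed.
    by move=> y /=; apply: contraNP => /negP; rewrite in_itv /= => /fz fy; rewrite /piece fy !mulr0.
  have sub2 : spt (piece k) `<=` `[- p + k%:R * 1 - 1, - p + k%:R * 1 + 1].
    rewrite /spt closureE => x; apply; split; first exact: itv_closed.
    move=> y /=; apply: contraNP => /negP; rewrite in_itv /= => h.
    rewrite /piece /chi grid_tent_eq0 // ?mul0r ?mulr0 //.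
    by apply: contra h => /andP[/ltW -> /ltW ->].
  split=> //.
  - by exists 2^-1.
  - move=> x y /sub2 /= hx /sub2 /= hy; move: hx hy; rewrite !in_itv /= => /andP[x1 x2] /andP[y1 y2].
    by rewrite ler_norml; apply/andP; split; lra.
  - exact: sup_norm_deriv_le1.
have eps0 : 0 <= eps by apply: le_trans (piece_le 0%N); exact: normc_ge0.
apply: le_trans (normc_sum _ _ _) _.
apply: (@le_trans _ _ (\sum_(k < K.+1) 4 * M * eps)).
  apply: ler_sum => k _; rewrite normcM normcR gtr0_norm ?mulr_gt0 //.
  by rewrite ler_wpM2l // mulr_ge0 // ltW.
rewrite sumr_const card_ord -[leLHS]mulr_natr.
have -> : M * (8 * (p + 1) * eps) = 4 * M * eps * (2 * p + 1 + 1) by ring.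
by rewrite ler_wpM2l ?mulr_ge0 ?(ltW M0) // -natr1 lerD2r.
Qed.
End local_norm.

(** * An eigenfunction sampled on a grid *)

Section grid_constant.
Context {R : realType}.

(** The factor of the growth estimate that does not depend on p. *)
Definition gordon_constant (Om B L c0 : R) : R :=
  (2 + 3 * Om) * (2 * B ^+ 2 * (B + L + 1) * c0 ^- 2) + 2 * (B + L) + 2 + 2 * B / c0.

Lemma gordon_constant_ge0 (Om B L c0 : R) : 0 <= Om -> 0 <= B -> 0 <= L -> 0 < c0 ->
  0 <= gordon_constant Om B L c0.
Proof.
move=> Om0 B0 L0 /ltW c00.
by rewrite !addr_ge0 ?mulr_ge0 ?invr_ge0 ?exprn_ge0 ?addr_ge0 ?mulr_ge0.
Qed.

End grid_constant.

Section grid_solution.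
Context {R : realType} (mu : local_measure R) (z : R[i]) (u : R -> R[i]).
Hypotheses (muf : loc_unif mu) (su : schroedinger mu u (fun x => z * u x)).

Let Om := fine (unif_norm mu) + normc z.
Let J := schroedinger_form mu z.
Let rJ := represents_form mu z.
Let cu := solution_continuous su.

Lemma tight_window (l : R) : 0 <= l -> exists L : nat, l <= L%:R <= l + 1.
Proof.
move=> l0; exists (Num.truncn l).+1; have /andP[h1 h2] := truncn_itv l0.
by rewrite ltW // -natr1 lerD2r h1.
Qed.

(** The Lebesgue part of the form is invariant under translation. *)
Lemma form_translate f (p a : R) L : ccontinuous f -> supported f a L ->
  J (fun x => f (x - p)) - J f = - lm_integral (lm_sub mu (lm_translate mu p)) f.
Proof.
move=> cf sf; rewrite /J /schroedinger_form (leb_translate p cf sf).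
have -> : lm_integral (lm_sub mu (lm_translate mu p)) f =
    lm_integral mu f - lm_integral (lm_translate mu p) f.
  apply: (tends_unique (represents_lm _ cf sf)).
  have := @represents_sub R _ _ _ _ 1 (represents_lm mu) (represents_lm (lm_translate mu p))
    _ _ _ cf sf.
  rewrite mul1r; apply: tends_ext => m; apply: eq_bigr => l _.
  by rewrite mul1r.
rewrite (represented_translate (represents_lm mu)
  (represents_lm (lm_translate mu p) : represents (fun B => mu (translate p B)) _) cf sf).
by ring.
Qed.

Section fixed_grid.
Variables (C p eps al be c0 B Lc : R) (n : nat).
Let h := p / n%:R.
Hypotheses (n0 : (0 < n)%N) (C0 : 0 < C) (c00 : 0 < c0) (B0 : 0 <= B) (Lc0 : 0 <= Lc).
Hypotheses (uB : forall x, normc (u x) <= B)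
  (uL : forall x y, normc (u x - u y) <= Lc * `|x - y|).
Hypotheses (al0 : 0 <= al) (albe : al < be) (be1 : be <= al + 1) (bep : be + 1 <= p).
Hypothesis uc : forall x, al <= x <= be -> c0 <= normc (u x).
Hypotheses (h1 : h <= 1) (hab : 4 * h <= be - al) (eps0 : 0 <= eps).
Hypothesis le_eps :
  (local_norm (lm_sub mu (lm_translate mu p)) `[(- p)%R, p] <= eps%:E)%E.

Let p0 : 0 < p. Proof. by move: al0 albe bep; lra. Qed.
Let nr0 : 0 < n%:R :> R. Proof. by rewrite ltr0n. Qed.
Let h0 : 0 < h. Proof. by rewrite divr_gt0. Qed.
Let nh : n%:R * h = p. Proof. by rewrite mulrC divfK // gt_eqF. Qed.
Let O0 : 0 <= Om. Proof. exact: Om_ge0. Qed.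

Let y k : R := - p + k%:R * h.
Let A k := u (y k).
Let T k x : R[i] := (grid_tent h (- p) k x)%:C.
Let N k := J (T k).
Let e k := J (fun x => T k x * u x) - A k * N k.

Let cT k : ccontinuous (T k). Proof. exact: ccontinuous_grid_tent. Qed.

Lemma T_supported k (a : R) L : a <= y k - h -> y k + h <= a + L%:R -> supported (T k) a L.
Proof.
move=> ak ka x hx; rewrite /T grid_tent_eq0 //; apply: contra hx => /andP[h2 h3].
by rewrite (le_lt_trans ak) //= (le_trans (ltW h3)).
Qed.

Lemma grid_equation k : second_difference A k.+1 = h%:C * (N k.+1 * A k.+1 + e k.+1).
Proof.
have lt := grid_tent_lt (- p) h0 k.+1.
have yp : - p + k.+1%:R * h + h = y k.+2 by rewrite /y -(natr1 k.+1); ring.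
have ym : - p + k.+1%:R * h - h = y k by rewrite /y -(natr1 k); ring.
have E := tent_identity muf su lt.
have E' : J (fun x => T k.+1 x * u x) =
  (h^-1)%:C * A k - (h^-1 + h^-1)%:C * A k.+1 + (h^-1)%:C * A k.+2.
  rewrite /J /T /grid_tent E /A yp ym /y.
  have -> : - p + k.+1%:R * h - (- p + k%:R * h) = h by rewrite -(natr1 k); ring.
  have -> : - p + k.+2%:R * h - (- p + k.+1%:R * h) = h by rewrite -(natr1 k.+1); ring.
  by [].
rewrite /e [X in X + _]mulrC addrC subrK E' /second_difference /=.
rewrite (rmorphD (real_complex R)) /=.
have k1 : h%:C * (h^-1)%:C = 1 :> R[i].
  by rewrite -(rmorphM (real_complex R)) /= mulfV // gt_eqF.
move: (h%:C) (h^-1%:C) (A k) (A k.+1) (A k.+2) k1 => q v a b c qv.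
have -> : q * (v * a - (v + v) * b + v * c) = q * v * (a - (b + b) + c) by ring.
by rewrite qv; ring.
Qed.

Lemma sum_N i j : (i <= j)%N ->
  \sum_(i <= k < j) normc (N k) <= Om * ((j - i)%:R * h + 2).
Proof.
move=> ij; have [L /andP[L1 L2]] : exists L : nat, (j - i)%:R * h + h <= L%:R <= (j - i)%:R * h + h + 1.
  by apply: tight_window; rewrite addr_ge0 ?mulr_ge0 // ltW.
have := @represented_le R _ _ rJ 'I_(j - i) (fun k => T (i + k)) (y i - h) L (L%:R * Om) 1.
have hE : \sum_(k < j - i) normc (J (T (i + k)%N)) = \sum_(i <= k < j) normc (N k).
  rewrite -[X in index_iota X _]add0n big_addn big_mkord.
  by apply: eq_bigr => k _; rewrite addnC.
rewrite hE => H; apply: le_trans (H _ _ _ _ _) _ => //.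
- by move=> m; exact: variation_form.
- move=> k; apply: T_supported; rewrite /y.
    by rewrite lerD2r lerD2l ler_wpM2r ?ler_nat ?leq_addr // ltW.
  have : (i + k)%:R * h + h <= j%:R * h.
    rewrite -[X in _ + X]mul1r -mulrDl natr1 ler_wpM2r ?(ltW h0) // ler_nat.
    by rewrite -ltn_subRL ltn_ord.
  by move: L1; rewrite natrB // mulrBl; lra.
- move=> x; under eq_bigr do rewrite normcR ger0_norm ?grid_tent_ge0 //.
  have := @sum_grid_tent_le1 R h (- p) h0 i j x.
  rewrite -[X in index_iota X _]add0n big_addn big_mkord; apply: le_trans.
  by apply: ler_sum => k _; rewrite addnC.
by rewrite mul1r mulrC ler_wpM2l //; move: h1; lra.
Qed.

Let eb := h * (Lc * (3 * p + 2) * Om + 1).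

(** The errors are of the order of h, because u is Lipschitz and the tents add up to
at most 1. *)
Lemma sum_e : \sum_(k < n + (n + n)) normc (e k) <= eb.
Proof.
have [L /andP[L1 L2]] : exists L : nat, 3 * p + 1 <= L%:R <= 3 * p + 1 + 1.
  by apply: tight_window; move: p0; lra.
have sT k : (k < n + (n + n))%N -> supported (T k) (- p - 1) L.
  move=> kn; apply: T_supported; rewrite /y.
    have : 0 <= k%:R * h by rewrite mulr_ge0 // ltW.
    by move: h1; lra.
  have : k%:R * h + h <= 3 * p.
    rewrite -[X in _ + X]mul1r -mulrDl natr1 -nh mulrA ler_wpM2r ?(ltW h0) //.
    by rewrite -natrM ler_nat !mulSn mul0n addn0.
  by move: L1; lra.
have eE (k : 'I_(n + (n + n))) : e k = J (fun x => T k x * (u x - A k)).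
  have sTu := supportedMl u (sT k (ltn_ord k)).
  have sTc := supportedMr (fun=> A k) (sT k (ltn_ord k)).
  have cTc := ccontinuousM (ccontinuous_cst (A k)) (cT k).
  rewrite /e /N -(representedZ rJ (A k) (cT k) (sT k (ltn_ord k))).
  rewrite -(representedB rJ (ccontinuousM (cT k) cu) sTu cTc sTc).
  by congr J; apply/funext => x; rewrite mulrBr [A k * _]mulrC.
under eq_bigr do rewrite eE.
have Lh : 0 <= Lc * h by rewrite mulr_ge0 // ltW.
have := @represented_le R _ _ rJ 'I_(n + (n + n)) (fun k x => T k x * (u x - A k))
  (- p - 1) L (L%:R * Om) (Lc * h).
move=> H; apply: le_trans (H _ Lh _ _ _) _.
- by move=> m; exact: variation_form.
- move=> k; apply: ccontinuousM => //; apply: ccontinuousD => //.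
  exact: ccontinuous_cst.
- by move=> k; apply: supportedMl; exact: sT.
- move=> x; apply: (@le_trans _ _ (\sum_(k < n + (n + n)) Lc * h * grid_tent h (- p) k x)).
    apply: ler_sum => k _; rewrite normcM normcR ger0_norm ?grid_tent_ge0 // mulrC.
    have [hx|hx] := boolP (y k - h < x < y k + h); last by rewrite grid_tent_eq0 // !mulr0.
    rewrite ler_wpM2r ?grid_tent_ge0 //; apply: le_trans (uL _ _) _.
    rewrite ler_wpM2l // ler_norml; move: hx => /andP[/ltW x1 /ltW x2].
    by apply/andP; split; lra.
  rewrite -mulr_sumr ler_piMr //.
  by rewrite -(big_mkord xpredT (fun k => grid_tent h (- p) k x)) sum_grid_tent_le1.
rewrite /eb.
have -> : Lc * h * (L%:R * Om) = h * (Lc * L%:R * Om) by ring.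
rewrite ler_pM2l //; have : Lc * L%:R * Om <= Lc * (3 * p + 2) * Om.
  by rewrite ler_wpM2r // ler_wpM2l //; lra.
by lra.
Qed.

Lemma T_shift k x : T (n + k) x = T k (x - p).
Proof.
rewrite /T /grid_tent natrD mulrDl nh; congr (_%:C).
by rewrite /tent; congr (Num.max 0 (Num.min (_ / _) (_ / _))); ring.
Qed.

(** The sum is the integral of a piecewise linear function against the difference of
mu and its translate. *)
Lemma weak_N (c : nat -> R[i]) M : 0 <= M ->
  (forall k, ~~ (0 < k < n + n)%N -> c k = 0) ->
  (forall k, normc (c k) <= M) ->
  (forall k, normc (c k.+1 - c k) <= M * h) ->
  normc (\sum_(k < n + n) c k * (N (n + k)%N - N k)) <= M * (8 * (p + 1) * eps).
Proof.
rewrite le_eqVlt => /orP[/eqP<-|M0] cz cM cs.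
  rewrite mul0r big1 ?normc0 // => k _.
  by have /normc_eq0 -> := cM k; rewrite mul0r.
have [L hL] := window (- p - 1) (p + 1).
have y2n : y (n + n) = p by rewrite /y natrD mulrDl nh; ring.
have sT k : (k < n + n)%N -> supported (T k) (- p - 1) L.
  move=> kn; apply: T_supported.
    have : 0 <= k%:R * h by rewrite mulr_ge0 // ltW.
    by move: h1; rewrite /y; lra.
  have : y k + h <= y (n + n).
    rewrite /y -addrA lerD2l -[X in _ + X]mul1r -mulrDl natr1.
    by rewrite ler_wpM2r ?(ltW h0) // ler_nat.
  by rewrite y2n; lra.
pose nu := lm_sub mu (lm_translate mu p).
have -> : \sum_(k < n + n) c k * (N (n + k)%N - N k) =
   - lm_integral nu (fun x => \sum_(k < n + n) c k * T k x).
  rewrite (represented_sum (represents_lm nu) (index_enum 'I_(n + n)) (fun k => c k)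
     (fun k => cT k) (fun k => sT k (ltn_ord k))) -sumrN.
  apply: eq_bigr => k _; rewrite -mulrN -(form_translate p (cT k) (sT k (ltn_ord k))).
  by congr (_ * (_ - _)); rewrite /N; congr J; apply/funext => x; exact: T_shift.
rewrite normcNE; apply: (lm_integral_le_local_norm p0 M0 le_eps).
- move=> x1 x2; apply: (interpolation_lipschitz (- p) h0 x1 x2 _ _ cs).
    by rewrite cz.
  by rewrite cz // ltnn andbF.
- move=> x; apply: le_trans (normc_sum _ _ _) _.
  apply: (@le_trans _ _ (\sum_(k < n + n) M * grid_tent h (- p) k x)).
    apply: ler_sum => k _; rewrite normcM normcR ger0_norm ?grid_tent_ge0 //.
    by rewrite ler_wpM2r ?grid_tent_ge0.
  rewrite -mulr_sumr ler_piMr ?(ltW M0) //.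
  by rewrite -(big_mkord xpredT (fun k => grid_tent h (- p) k x)) sum_grid_tent_le1.
- move=> x hx; rewrite big1 // => k _.
  have [kn|kn] := boolP (0 < k < n + n)%N; last by rewrite cz // mul0r.
  rewrite /T grid_tent_eq0 ?mulr0 //; apply: contra hx.
  move/andP: kn => [k1 k2] /andP[/ltW h2 /ltW h3]; apply/andP; split.
    apply: le_trans h2; rewrite -addrA lerDl subr_ge0.
    by rewrite -[leLHS]mul1r ler_wpM2r ?(ltW h0) // ler1n.
  apply: le_trans h3 _; rewrite -[leRHS]y2n /y -addrA lerD2l -[X in _ + X]mul1r -mulrDl natr1.
  by rewrite ler_wpM2r ?(ltW h0) // ler_nat.
Qed.

(** The growth estimate at the index n + (n - m), which stands for the point p - s
with s close to t. The points of the grid ia and ib approximate al from above and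
be from below. *)
Lemma reflection_grid_estimate t : 0 <= t <= 1 -> exists b s,
  [/\ normc b <= 2 * B / c0, 0 <= s <= 1, `|t - s| <= h
    & normc (u (2 * p - s) + u (- s) - b * u (p - s)) <=
      (1 + p + 2 * p / (be - al)) * gordon_constant Om B Lc c0
        * (8 * (p + 1) * eps + eb) * expR (C * p / 2 + Om * (p + 3) / (2 * C))].
Proof.
move=> /andP[t0 t1].
pose ia := (Num.truncn (al / h)).+1; pose ib := Num.truncn (be / h).
pose m := Num.truncn (t / h).
have tr (x : R) : 0 <= x -> (Num.truncn (x / h))%:R * h <= x < (Num.truncn (x / h))%:R * h + h.
  move=> x0; have /truncn_itv/andP[h2 h3] : 0 <= x / h by rewrite divr_ge0 // ltW.
  rewrite -ler_pdivlMr // h2 /= -[X in _ + X]mul1r -mulrDl natr1.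
  by rewrite -ltr_pdivrMr.
have /andP[a1 a2] := tr _ al0.
have be0 : 0 <= be by apply: le_trans al0 (ltW albe).
have /andP[b1 b2] := tr _ be0.
have /andP[m1 m2] := tr _ t0; rewrite -/m in m1 m2; rewrite -/ib in b1 b2.
have iaE : ia%:R * h = (Num.truncn (al / h))%:R * h + h by rewrite /ia -natr1 mulrDl mul1r.
have le_nat (i j : nat) : (i%:R * h <= j%:R * h) = (i <= j)%N by rewrite ler_pM2r // ler_nat.
have lt_nat (i j : nat) : (i%:R * h < j%:R * h) = (i < j)%N by rewrite ltr_pM2r // ltr_nat.
have iab : (ia < ib)%N by rewrite -lt_nat iaE; move: hab h0; lra.
have ibn : (ib < n)%N by rewrite -lt_nat nh; move: bep; lra.
have mib : (m + ib <= n)%N by rewrite -le_nat nh natrD mulrDl; move: bep; lra.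
have yn k : y (n + k) = k%:R * h by rewrite /y natrD mulrDl nh; ring.
have dE : (n + ib - (n + ia))%:R * h = ib%:R * h - ia%:R * h.
  by rewrite subnDl natrB ?(ltnW iab) // mulrBl.
have dge : (be - al) / 2 <= ib%:R * h - ia%:R * h by rewrite iaE; move: hab; lra.
have AL k : normc (A k.+1 - A k) <= Lc * h.
  apply: le_trans (uL _ _) _; rewrite (_ : y k.+1 - y k = h); last first.
    by rewrite /y -(natr1 k); ring.
  by rewrite gtr0_norm.
have Ac k : (n + ia <= k <= n + ib)%N -> c0 <= normc (A k).
  move=> /andP[k1 k2]; have nk : (n <= k)%N by apply: leq_trans k1; exact: leq_addr.
  apply: uc; rewrite -(subnKC nk) yn; move: k1 k2.
  rewrite -{1 2}(subnKC nk) !leq_add2l -!le_nat iaE => k1 k2.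
  by apply/andP; split; lra.
have d1 : (n + ib - (n + ia))%:R * h <= 1 by rewrite dE iaE; move: be1; lra.
have eps'0 : 0 <= 8 * (p + 1) * eps by rewrite !mulr_ge0 // addr_ge0 // ltW.
have eb0 : 0 < eb by rewrite mulr_gt0 // ltr_wpDl // !mulr_ge0 // addr_ge0 // mulr_ge0 // ltW.
have i1n : (n + ib < n + n)%N by rewrite ltn_add2l.
have i01 : (n + ia < n + ib)%N by rewrite ltn_add2l.
have mn : (m <= n)%N by apply: leq_trans mib; exact: leq_addr.
have jI : (n + ib <= n + (n - m) <= n + n)%N.
  by rewrite !leq_add2l leq_subr andbT leq_subRL.
have W := gordon_growth h0 h1 C0 O0 B0 Lc0 c00 eps'0 eb0 (leq_addr ia n) i01 i1n
  grid_equation (fun k => uB (y k)) AL weak_N sum_N sum_e Ac d1 jI.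
have jE : (n + (n - m))%:R * h = 2 * p - m%:R * h.
  by rewrite natrD mulrDl natrB // mulrBl nh; ring.
have E1 : y (n + (n + (n - m))) = 2 * p - m%:R * h by rewrite yn jE.
have E2 : y (n + (n - m) - n) = - (m%:R * h).
  by rewrite addKn /y natrB // mulrBl nh; ring.
have E3 : y (n + (n - m)) = p - m%:R * h by rewrite yn natrB // mulrBl nh.
exists ((A (n + (n + ia))%N + A (n + ia - n)%N) / A (n + ia)%N), (m%:R * h).
split.
- have Ai : c0 <= normc (A (n + ia)%N) by apply: Ac; rewrite leqnn ltnW.
  rewrite normcM normcV; apply: ler_pM; rewrite ?normc_ge0 ?invr_ge0 ?normc_ge0 //.
    rewrite mulr_natl mulr2n; apply: le_trans (normcD_le _ _) _; apply: lerD; exact: uB.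
  by rewrite lef_pV2 ?posrE // (lt_le_trans c00).
- by rewrite mulr_ge0 ?(ltW h0) //= (le_trans m1).
- by rewrite ger0_norm ?subr_ge0 // lerBlDl ltW.
move: W; rewrite /A E1 E2 E3 dE nh => W; apply: le_trans W _.
have G0 : 0 <= gordon_constant Om B Lc c0 by exact: gordon_constant_ge0.
rewrite ler_wpM2r ?expR_ge0 // ler_wpM2r ?addr_ge0 ?(ltW eb0) //.
rewrite ler_wpM2r // lerD2l.
have be_al : 0 < be - al by rewrite subr_gt0.
have d20 : 0 < ib%:R * h - ia%:R * h by apply: lt_le_trans dge; rewrite divr_gt0.
rewrite [2 * p]mulrC -mulrA ler_pM2l // -[2]invrK -invfM lef_pV2 ?posrE //.
  by rewrite mulrC.
by rewrite mulr_gt0 // invr_gt0.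
Qed.

End fixed_grid.
End grid_solution.

(** * Absence of eigenvalues *)

Section absence.
Context {R : realType}.

Lemma polynomial_le_expR (tau p : R) : 0 < tau -> 0 <= p ->
  (1 + p) ^+ 2 * expR (- (tau * p)) <= 2 + 4 / tau ^+ 2.
Proof.
move=> t0 p0; rewrite expRN ler_pdivrMr ?expR_gt0 //.
have tp0 : 0 <= tau * p by rewrite mulr_ge0 // ltW.
have h1 : 1 <= expR (tau * p) by rewrite -expR0 ler_expR.
have h2 := expR_ge1Dxn 1 tp0.
have h3 : p ^+ 2 <= 2 / tau ^+ 2 * expR (tau * p).
  apply: (@le_trans _ _ (2 / tau ^+ 2 * ((tau * p) ^+ 2 / 2))).
    by rewrite le_eqVlt; apply/orP; left; apply/eqP; field; rewrite gt_eqF.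
  rewrite ler_wpM2l ?divr_ge0 ?exprn_ge0 ?(ltW t0) //.
  by apply: le_trans h2; rewrite (_ : 2`!%:R = 2) // lerDr.
have h4 : 0 <= (1 - p) ^+ 2 by exact: sqr_ge0.
have -> : (2 + 4 / tau ^+ 2) * expR (tau * p) = 2 * expR (tau * p) + 2 * (2 / tau ^+ 2 * expR (tau * p)).
  by field; rewrite gt_eqF.
nra.
Qed.

Lemma lee_mul_expR (a eta : R) (x : \bar R) :
  ((expR a)%:E * x < eta%:E)%E -> (x <= (eta * expR (- a))%:E)%E.
Proof.
have e0 := expR_gt0 a; case: x => [r||] //; last by rewrite leNye.
  by rewrite -EFinM lte_fin lee_fin expRN ler_pdivlMr // mulrC => /ltW.
by rewrite gt0_muley ?lte_fin.
Qed.

(** For an eigenfunction the estimate above bounds u (- t) by the values of u near p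
and 2 p, which tend to 0, and by the local norm times a polynomial in p and the
exponential of (C - tau) p, which tends to 0 as well. Hence u vanishes on [-1, 0]. *)
Lemma solution_eq0 (mu : local_measure R) (C : R) (z : R[i]) (u : R -> R[i]) :
  loc_unif mu -> 0 < C -> weak_gordon mu C ->
  fine (unif_norm mu) + normc z < C ^+ 2 ->
  schroedinger mu u (fun x => z * u x) -> forall x, u x = 0.
Proof.
move=> muf C0 [p [pp pinf wg]]; set Om := _ + _ => OmC su.
have O0 : 0 <= Om := Om_ge0 z muf.
have [B B0 uB] := solution_bounded muf su.
have uL := solution_lipschitz muf su B0 uB; rewrite -/Om in uL.
set Lc := 2 * B * (1 + Om) in uL.
have Lc0 : 0 <= Lc by rewrite !mulr_ge0 // addr_ge0.
have [[x0 x00 ux0]|none] := pselect (exists2 x, 0 <= x & u x != 0); last first.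
  apply: (solution_unique_continuation muf su ltr01) => x /andP[x0 _].
  by apply: contrapT => /eqP ux; apply: none; exists x.
(* An interval to the right of x0 on which |u| >= c0, by the Lipschitz bound. *)
pose c0 := normc (u x0) / 2.
have c00 : 0 < c0.
  rewrite divr_gt0 // lt_neqAle normc_ge0 andbT eq_sym; apply: contra ux0 => /eqP h.
  by apply/eqP/eq0_normc.
pose be := x0 + Num.min 1 (c0 / (Lc + 1)).
have L1 : 0 < Lc + 1 by rewrite ltr_wpDl.
have abe : x0 < be by rewrite ltrDl lt_min ltr01 divr_gt0.
have be1 : be <= x0 + 1 by rewrite lerD2l ge_min lexx.
have uc x : x0 <= x <= be -> c0 <= normc (u x).
  move=> /andP[h1 h2]; have h3 : x - x0 <= c0 / (Lc + 1).
    by move: h2; rewrite /be -lerBlDl => h2; apply: le_trans h2 _; rewrite ge_min lexx orbT.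
  have := uL x x0; rewrite (ger0_norm (_ : 0 <= x - x0)) ?subr_ge0 // => h4.
  have h5 : Lc * (x - x0) <= c0.
    apply: (@le_trans _ _ ((Lc + 1) * (x - x0))).
      by rewrite ler_wpM2r ?subr_ge0 // lerDl.
    by rewrite mulrC -ler_pdivlMr.
  have := normcD_le (u x0 - u x) (u x); rewrite subrK normc_distC.
  have : normc (u x0) = 2 * c0 by rewrite /c0 mulrC divfK.
  by lra.
(* The gap between C and the growth rate. *)
pose tau := C / 2 - Om / (2 * C).
have tau0 : 0 < tau.
  rewrite /tau subr_gt0 ltr_pdivrMr ?mulr_gt0 //.
  by rewrite (_ : C / 2 * (2 * C) = C ^+ 2) //; field.
pose D := 1 + 2 / (be - x0).
have D0 : 0 <= D by rewrite addr_ge0 // divr_ge0 // subr_ge0 ltW.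
pose K2 := gordon_constant Om B Lc c0.
have K20 : 0 <= K2 by exact: gordon_constant_ge0.
pose kap := K2 * 8 * D * expR (3 * Om / (2 * C)) * (2 + 4 / tau ^+ 2).
have bc0 : 0 <= 2 * B / c0 by exact: divr_ge0 (mulr_ge0 _ B0) (ltW c00).
suff H t : 0 <= t <= 1 -> u (- t) = 0.
  apply: (solution_unique_continuation muf su (_ : -1 < 0)) => [|x /andP[x1 x2]].
    by rewrite ltrN10.
  by rewrite -[x]opprK; apply: H; apply/andP; split; lra.
move=> t01; apply: normc_eq0; apply: (@ler_archi _ _ _ (1 + 2 * B / c0 + kap)) => eta eta0.
rewrite add0r.
have [X hX] := solution_decay muf su eta0.
have [m [pb [pX wgm]]] : exists m, be + 1 <= p m /\ X + 2 <= p m /\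
    ((expR (C * p m))%:E *
      local_norm (lm_sub mu (lm_translate mu (p m))) `[(- p m)%R, p m] < eta%:E)%E.
  have n1 : \forall m \near \oo, be + 1 <= p m by move/cvgryPge : pinf; apply.
  have n2 : \forall m \near \oo, X + 2 <= p m by move/cvgryPge : pinf; apply.
  have n3 : \forall m \near \oo, ((expR (C * p m))%:E *
      local_norm (lm_sub mu (lm_translate mu (p m))) `[(- p m)%R, p m] < eta%:E)%E.
    apply: (wg [set y | (y < eta%:E)%E]); apply: open_nbhs_nbhs; split.
      exact: open_ereal_lt_ereal.
    by rewrite /= lte_fin.
  apply: (@filter_ex _ \oo); near=> m; split; first by near: m.
  by split; near: m.
have {wgm}le_eps := lee_mul_expR wgm.
set q := p m in pb pX le_eps.
set eps := eta * _ in le_eps.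
have eps0 : 0 <= eps by rewrite mulr_ge0 ?expR_ge0 // ltW.
have q0 : 0 < q by move: x00 abe pb; lra.
set G := expR (C * q / 2 + Om * (q + 3) / (2 * C)).
pose Q := 1 + q + 2 * q / (be - x0).
pose E := Lc * (3 * q + 2) * Om + 1.
(* The weight exp (C q) of the local norm beats the growth of w. *)
have key : Q * K2 * (8 * (q + 1) * eps) * G <= kap * eta.
  have QD : Q <= D * (1 + q).
    rewrite /Q /D -subr_ge0.
    have -> : (1 + 2 / (be - x0)) * (1 + q) - (1 + q + 2 * q / (be - x0)) = 2 / (be - x0) by ring.
    by rewrite divr_ge0 // subr_ge0 ltW.
  have eG : eps * G = eta * expR (3 * Om / (2 * C)) * expR (- (tau * q)).
    rewrite /eps /G -!mulrA -!expRD; congr (_ * expR _); rewrite /tau; field.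
    by rewrite gt_eqF.
  have P := polynomial_le_expR tau0 (ltW q0).
  have -> : Q * K2 * (8 * (q + 1) * eps) * G = K2 * 8 * (q + 1) * Q * (eps * G) by ring.
  rewrite eG.
  have e30 := expR_ge0 (3 * Om / (2 * C)).
  have et0 := expR_ge0 (- (tau * q)).
  apply: (@le_trans _ _ (K2 * 8 * (q + 1) * (D * (1 + q)) *
       (eta * expR (3 * Om / (2 * C)) * expR (- (tau * q))))).
    have q1 : 0 <= q + 1 by rewrite addr_ge0 // ltW.
    apply: ler_wpM2r; first exact: mulr_ge0 (mulr_ge0 (ltW eta0) e30) et0.
    by apply: ler_wpM2l => //; apply: mulr_ge0 q1; exact: mulr_ge0.
  have -> : K2 * 8 * (q + 1) * (D * (1 + q)) *
       (eta * expR (3 * Om / (2 * C)) * expR (- (tau * q))) =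
     K2 * 8 * D * expR (3 * Om / (2 * C)) * eta * ((1 + q) ^+ 2 * expR (- (tau * q))) by ring.
  rewrite /kap [leRHS]mulrAC; apply: ler_wpM2l => //.
  apply: mulr_ge0 (ltW eta0); apply: mulr_ge0 e30; apply: mulr_ge0 D0.
  exact: mulr_ge0.
(* The length q is fixed now and the mesh of the grid tends to 0. *)
apply: (@ler_archi _ _ _ (Q * K2 * E * G + Lc)) => e e0.
pose e' := Num.min (Num.min 1 ((be - x0) / 4)) e.
have e'0 : 0 < e' by rewrite !lt_min ltr01 e0 divr_gt0 // subr_gt0.
have [M hM] := natSinv_le (divr_gt0 e'0 q0).
pose n := M.+1.
have hh : q / n%:R <= e'.
  have := hM M (leqnn _); rewrite ler_pdivlMr // mulrC; exact.
have he : q / n%:R <= e by apply: le_trans hh _; rewrite !ge_min lexx orbT.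
have h1 : q / n%:R <= 1 by apply: le_trans hh _; rewrite !ge_min lexx.
have hab : 4 * (q / n%:R) <= be - x0.
  by rewrite mulrC -ler_pdivlMr //; apply: le_trans hh _; rewrite !ge_min lexx ?orbT.
have [b [s [bB /andP[s0 s1] ts W]]] := reflection_grid_estimate muf su (ltn0Sn M) C0 c00 B0 Lc0
   uB uL x00 abe be1 pb uc h1 hab eps0 le_eps t01.
rewrite -/Om -/K2 -/G -/Q -/E -/n in W ts *.
set h := q / n%:R in he h1 hab W ts.
have h0 : 0 <= h by rewrite divr_ge0 // ltW.
have E0 : 0 <= E by rewrite addr_ge0 // !mulr_ge0 // addr_ge0 // mulr_ge0 // ltW.
have Q0 : 0 <= Q by rewrite !addr_ge0 ?divr_ge0 ?mulr_ge0 ?subr_ge0 ?(ltW q0) ?(ltW abe).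
have T1 : normc (u (- t)) <= normc (u (- s)) + Lc * h.
  have := normcD_le (u (- t) - u (- s)) (u (- s)); rewrite subrK => T.
  have := uL (- t) (- s); rewrite -opprD normrN => T'.
  have := ler_wpM2l Lc0 ts; lra.
have T2 : normc (u (2 * q - s)) <= eta.
  by apply: hX; rewrite ger0_norm; move: pX pb x00 abe; lra.
have T3 : normc (u (q - s)) <= eta.
  by apply: hX; rewrite ger0_norm; move: pX pb x00 abe; lra.
have T4 : normc (b * u (q - s)) <= 2 * B / c0 * eta.
  by rewrite normcM; apply: ler_pM; rewrite ?normc_ge0.
have T5 : normc (u (- s)) <= normc (u (2 * q - s) + u (- s) - b * u (q - s))
     + normc (b * u (q - s)) + normc (u (2 * q - s)).
  have {1}-> : u (- s) = (u (2 * q - s) + u (- s) - b * u (q - s)) + b * u (q - s) - u (2 * q - s).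
    by ring.
  by apply: le_trans (normcB _ _) _; rewrite lerD2r normcD_le.
have W' : Q * K2 * (8 * (q + 1) * eps + h * E) * G = Q * K2 * (8 * (q + 1) * eps) * G + Q * K2 * E * G * h.
  by ring.
have he' : (Q * K2 * E * G + Lc) * h <= (Q * K2 * E * G + Lc) * e.
  by rewrite ler_wpM2l // addr_ge0 // !mulr_ge0 // expR_ge0.
rewrite W' in W.
by move: W T1 T2 T4 T5 he' key; lra.
Unshelve. all: by end_near. Qed.

End absence.

Theorem theorem5p4 (R : realType) (mu : local_measure R) (C : R) :
  loc_unif mu -> 0 < C -> weak_gordon mu C ->
  forall z : R[i],
    ((Normc.normc z)%:E < (C ^+ 2)%:E - unif_norm mu)%E -> ~ schroedinger_eigenvalue mu z.
Proof.
move=> muf C0 wg z; rewrite -(fineK (unif_norm_fin_num muf)) -EFinB lte_fin ltrBrDr => zC.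
move=> [u [su []]]; apply: aeW => x.
by apply: (solution_eq0 muf C0 wg _ su); rewrite addrC.
Qed.
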